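(* Let $\mathcal{C}$ be a pivotal fusion category over an algebraically closed field $k$ (of arbitrary characteristic), let $U:\mathcal{Z}(\mathcal{C})\to\mathcal{C}$ be the forgetful functor from the monoidal (Drinfeld) center, and let $R$ be a right adjoint of $U$. Then the following four conditions are equivalent: (1) $\mathsf{Gr}_k(\mathcal{C})$ is a semisimple algebra. (2) $\mathcal{C}$ is non-degenerate, i.e. $\dim(\mathcal{C})\neq 0$ in $k$. (3) $\mathcal{Z}(\mathcal{C})$ is a semisimple abelian category. (4) $R(\mathbf{1})\in\mathcal{Z}(\mathcal{C})$ is a semisimple object.
   Context: A finite tensor category over $k$ is a rigid monoidal category that is, as a $k$-linear category, equivalent to the category of finite-dimensional modules over a finite-dimensional $k$-algebra, with $\otimes$ $k$-linear in each variable and $\mathrm{End}(\mathbf{1})\cong k$. A fusion category is a semisimple finite tensor category. A pivotal structure is an isomorphism $j:\mathrm{id}_{\mathcal{C}}\to(-)^{**}$ of monoidal functors ($X^*$ is the left dual, with $\mathrm{ev}_X:X^*\otimes X\to\mathbf{1}$, $\mathrm{coev}_X:\mathbf{1}\to X\otimes X^*$), and a pivotal fusion category is one equipped with a pivotal structure. The pivotal dimension is $\dim(X)=\mathrm{ev}_{X^*}\circ(j_X\otimes\mathrm{id}_{X^*})\circ\mathrm{coev}_X\in\mathrm{End}(\mathbf{1})=k$. With $V_0=\mathbf{1},V_1,\dots,V_m$ representatives of the isomorphism classes of simple objects, $\dim(\mathcal{C})=\sum_{i=0}^m\dim(V_i^* )\dim(V_i)\in k$. $\mathsf{Gr}_k(\mathcal{C})=k\otimes_{\mathbb{Z}}\mathsf{Gr}(\mathcal{C})$,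 where $\mathsf{Gr}(\mathcal{C})$ is the Grothendieck ring, $[V]\cdot[W]=[V\otimes W]$. The center $\mathcal{Z}(\mathcal{C})$ has objects $(V,\sigma)$ with $V\in\mathcal{C}$ and $\sigma_X:V\otimes X\to X\otimes V$ a natural isomorphism satisfying $\sigma_{X\otimes Y}=(\mathrm{id}_X\otimes\sigma_Y)\circ(\sigma_X\otimes\mathrm{id}_Y)$; morphisms are morphisms of $\mathcal{C}$ compatible with the $\sigma$'s. The right adjoint $R$ exists. *)

(* Defs.v *)
From HB Require Import structures.
From mathcomp Require Import all_boot all_order all_algebra all_field.
From mathcomp Require Import boolp.

Set Implicit Arguments.
Unset Strict Implicit.
Unset Printing Implicit Defensive.

Import GRing.Theory.

Local Open Scope ring_scope.
Local Open Scope quotient_scope.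

Record lincat (k : fieldType) := LinCat {
  obj :> Type;
  hom : obj -> obj -> lmodType k;
  idm : forall X, hom X X;
  compm : forall X Y Z, hom Y Z -> hom X Y -> hom X Z;
  comp1m : forall X Y (f : hom X Y), compm (idm Y) f = f;
  compm1 : forall X Y (f : hom X Y), compm f (idm X) = f;
  compmA : forall X Y Z T (f : hom Z T) (g : hom Y Z) (h : hom X Y),
    compm f (compm g h) = compm (compm f g) h;
  compmDl : forall X Y Z (f g : hom Y Z) (h : hom X Y),
    compm (f + g) h = compm f h + compm g h;
  compmDr : forall X Y Z (f : hom Y Z) (g h : hom X Y),
    compm f (g + h) = compm f g + compm f h;
  compmZl : forall X Y Z (a : k) (f : hom Y Z) (h : hom X Y),
    compm (a *: f) h = a *: compm f h;
  compmZr : forall X Y Z (a : k) (f : hom Y Z) (h : hom X Y),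
    compm f (a *: h) = a *: compm f h
}.

Arguments hom {k l} X Y.
Arguments idm {k l} X.
Arguments compm {k l X Y Z} f g.

Notation "f \oc g" := (compm f g) (at level 40, left associativity).

Section LinCatTheory.
Variables (k : fieldType) (C : lincat k).

Definition is_iso (X Y : C) (f : hom X Y) : Prop :=
  exists g : hom Y X, g \oc f = idm X /\ f \oc g = idm Y.

Definition isomorphic (X Y : C) : Prop := exists f : hom X Y, is_iso f.

Definition is_zero (X : C) : Prop :=
  (forall Y (f : hom X Y), f = 0) /\ (forall Y (f : hom Y X), f = 0).

Definition is_mono (X Y : C) (f : hom X Y) : Prop :=
  forall W (g h : hom W X), f \oc g = f \oc h -> g = h.

Definition is_epi (X Y : C) (f : hom X Y) : Prop :=
  forall W (g h : hom Y W), g \oc f = h \oc f -> g = h.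

Definition is_kernel (K X Y : C) (i : hom K X) (f : hom X Y) : Prop :=
  f \oc i = 0 /\
  forall W (h : hom W X), f \oc h = 0 -> exists! u : hom W K, i \oc u = h.

Definition is_cokernel (X Y Q : C) (p : hom Y Q) (f : hom X Y) : Prop :=
  p \oc f = 0 /\
  forall W (h : hom Y W), h \oc f = 0 -> exists! u : hom Q W, u \oc p = h.

Definition short_exact (X Y Z : C) (f : hom X Y) (g : hom Y Z) : Prop :=
  is_kernel f g /\ is_cokernel g f.

Definition is_direct_sum n (S : 'I_n -> C) (X : C) : Prop :=
  exists (inj : forall i, hom (S i) X) (prj : forall i, hom X (S i)),
    [/\ forall i, prj i \oc inj i = idm (S i),
        forall i j, i != j -> prj i \oc inj j = 0
      & \sum_i inj i \oc prj i = idm X].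

Definition is_simple (X : C) : Prop :=
  ~ is_zero X /\
  forall Y (f : hom Y X), is_mono f -> is_zero Y \/ is_iso f.

Definition semisimple_object (X : C) : Prop :=
  exists n (S : 'I_n -> C), (forall i, is_simple (S i)) /\ is_direct_sum S X.

End LinCatTheory.

(* The case n = 0 of the first clause provides the zero object. *)
Definition abelian_category (k : fieldType) (C : lincat k) : Prop :=
  [/\ forall n (S : 'I_n -> C), exists X, is_direct_sum S X,
      forall (X Y : C) (f : hom X Y), exists K (i : hom K X), is_kernel i f,
      forall (X Y : C) (f : hom X Y), exists Q (p : hom Y Q), is_cokernel p f,
      forall (X Y : C) (f : hom X Y), is_mono f ->
        exists Z (g : hom Y Z), is_kernel f g
    & forall (X Y : C) (f : hom X Y), is_epi f ->
        exists Z (g : hom Z X), is_cokernel f g].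

Definition semisimple_category (k : fieldType) (C : lincat k) : Prop :=
  abelian_category C /\ forall X : C, semisimple_object X.

Record functor (k : fieldType) (C D : lincat k) := Functor {
  fobj :> C -> D;
  fmap : forall X Y, hom X Y -> hom (fobj X) (fobj Y);
  fmap1 : forall X, fmap (idm X) = idm (fobj X);
  fmapM : forall X Y Z (f : hom Y Z) (g : hom X Y),
    fmap (f \oc g) = fmap f \oc fmap g
}.

Arguments fmap {k C D} _ {X Y} _.

(* [adjunction F G]: F is left adjoint to G. *)
Record adjunction (k : fieldType) (C D : lincat k)
    (F : functor C D) (G : functor D C) := Adjunction {
  adj : forall X Y, hom (F X) Y -> hom X (G Y);
  adj_bij : forall X Y, bijective (@adj X Y);
  adj_natl : forall X X' Y (f : hom X' X) (h : hom (F X) Y),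
    adj (h \oc fmap F f) = adj h \oc f;
  adj_natr : forall X Y Y' (g : hom Y Y') (h : hom (F X) Y),
    adj (g \oc h) = fmap G g \oc adj h
}.

Section ModuleCategory.
Variables (k : fieldType) (A : falgType k).

Record fdmod := FdMod {
  fdmod_space :> vectType k;
  fdmod_act : {linear A -> 'End(fdmod_space)};
  fdmod_act1 : fdmod_act 1 = \1%VF;
  fdmod_actM : forall a b, fdmod_act (a * b) = (fdmod_act a \o fdmod_act b)%VF
}.

Section Hom.
Variables M N : fdmod.

Definition fdmod_hom_pred : {pred 'Hom(M, N)} :=
  fun f => `[< forall a, (f \o fdmod_act M a)%VF = (fdmod_act N a \o f)%VF >].

Lemma fdmod_hom_submod : submod_closed fdmod_hom_pred.
Proof.
split=> [|c f g /asboolP ff /asboolP gg]; apply/asboolP => a.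
  by rewrite comp_lfun0l comp_lfun0r.
by rewrite comp_lfunDl comp_lfunDr -comp_lfunZl -comp_lfunZr ff gg.
Qed.

HB.instance Definition _ :=
  GRing.isSubmodClosed.Build k 'Hom(M, N) fdmod_hom_pred fdmod_hom_submod.

Record fdmod_hom := FdModHom {
  fdmod_fun :> 'Hom(M, N);
  fdmod_funP : fdmod_fun \in fdmod_hom_pred
}.

HB.instance Definition _ := [isSub for fdmod_fun].
HB.instance Definition _ := [Choice of fdmod_hom by <:].
HB.instance Definition _ := [SubChoice_isSubLmodule of fdmod_hom by <:].

End Hom.

Arguments fdmod_hom_pred : clear implicits.

Lemma fdmod_id_subproof (M : fdmod) : \1%VF \in fdmod_hom_pred M M.
Proof. by apply/asboolP => a; rewrite comp_lfun1l comp_lfun1r. Qed.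

Lemma fdmod_comp_subproof (M N P : fdmod)
    (f : fdmod_hom N P) (g : fdmod_hom M N) :
  (f \o g)%VF \in fdmod_hom_pred M P.
Proof.
have /asboolP ff := fdmod_funP f; have /asboolP gg := fdmod_funP g.
apply/asboolP => a.
by rewrite -comp_lfunA gg comp_lfunA ff comp_lfunA.
Qed.

Definition fdmod_id M : fdmod_hom M M := FdModHom (fdmod_id_subproof M).
Definition fdmod_comp M N P (f : fdmod_hom N P) (g : fdmod_hom M N) :
  fdmod_hom M P := FdModHom (fdmod_comp_subproof f g).

(* C is equivalent to the category of finite-dimensional A-modules: there is a
   k-linear, fully faithful and essentially surjective functor.  This is not
   phrased through [lincat], since the type of all finite-dimensional A-modules
   is too large to be the type of objects of a [lincat]. *)
Definition equivalent_to_fdmod (C : lincat k) : Prop :=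
  exists (F : C -> fdmod)
         (Fm : forall X Y : C, hom X Y -> fdmod_hom (F X) (F Y)),
    [/\ forall X, Fm X X (idm X) = fdmod_id (F X),
        forall X Y Z (f : hom Y Z) (g : hom X Y),
          Fm X Z (f \oc g) = fdmod_comp (Fm Y Z f) (Fm X Y g),
        forall X Y (a : k) (f g : hom X Y),
          Fm X Y (a *: f + g) = a *: Fm X Y f + Fm X Y g,
        forall X Y, bijective (Fm X Y)
      & forall M : fdmod, exists (X : C) (u : fdmod_hom (F X) M), bijective u].

End ModuleCategory.

Record moncat (k : fieldType) := MonCat {
  moncat_lincat :> lincat k;
  unit_obj : moncat_lincat;
  tens : moncat_lincat -> moncat_lincat -> moncat_lincat;
  tensm : forall X Y X' Y' : moncat_lincat,
    hom X Y -> hom X' Y' -> hom (tens X X') (tens Y Y');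
  assoc : forall X Y Z, hom (tens (tens X Y) Z) (tens X (tens Y Z));
  associ : forall X Y Z, hom (tens X (tens Y Z)) (tens (tens X Y) Z);
  lunit : forall X, hom (tens unit_obj X) X;
  luniti : forall X, hom X (tens unit_obj X);
  runit : forall X, hom (tens X unit_obj) X;
  runiti : forall X, hom X (tens X unit_obj);
  tensm1 : forall X Y, tensm (idm X) (idm Y) = idm (tens X Y);
  tensmM : forall X Y Z X' Y' Z' (f : hom Y Z) (g : hom X Y)
      (f' : hom Y' Z') (g' : hom X' Y'),
    tensm (f \oc g) (f' \oc g') = tensm f f' \oc tensm g g';
  tensmDl : forall X Y X' Y' (f g : hom X Y) (h : hom X' Y'),
    tensm (f + g) h = tensm f h + tensm g h;
  tensmDr : forall X Y X' Y' (f : hom X Y) (g h : hom X' Y'),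
    tensm f (g + h) = tensm f g + tensm f h;
  tensmZl : forall X Y X' Y' (a : k) (f : hom X Y) (h : hom X' Y'),
    tensm (a *: f) h = a *: tensm f h;
  tensmZr : forall X Y X' Y' (a : k) (f : hom X Y) (h : hom X' Y'),
    tensm f (a *: h) = a *: tensm f h;
  assocK : forall X Y Z, associ X Y Z \oc assoc X Y Z = idm _;
  associK : forall X Y Z, assoc X Y Z \oc associ X Y Z = idm _;
  lunitK : forall X, luniti X \oc lunit X = idm _;
  lunitiK : forall X, lunit X \oc luniti X = idm _;
  runitK : forall X, runiti X \oc runit X = idm _;
  runitiK : forall X, runit X \oc runiti X = idm _;
  assoc_nat : forall X Y Z X' Y' Z'
      (f : hom X X') (g : hom Y Y') (h : hom Z Z'),
    assoc X' Y' Z' \oc tensm (tensm f g) h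
      = tensm f (tensm g h) \oc assoc X Y Z;
  lunit_nat : forall X Y (f : hom X Y),
    lunit Y \oc tensm (idm unit_obj) f = f \oc lunit X;
  runit_nat : forall X Y (f : hom X Y),
    runit Y \oc tensm f (idm unit_obj) = f \oc runit X;
  pentagon : forall X Y Z T,
    assoc X Y (tens Z T) \oc assoc (tens X Y) Z T
      = tensm (idm X) (assoc Y Z T) \oc assoc X (tens Y Z) T
          \oc tensm (assoc X Y Z) (idm T);
  triangle : forall X Y,
    tensm (idm X) (lunit Y) \oc assoc X unit_obj Y = tensm (runit X) (idm Y)
}.

Arguments unit_obj {k} m.
Arguments tens {k m} X Y.
Arguments tensm {k m X Y X' Y'} f g.
Arguments assoc {k m} X Y Z.
Arguments associ {k m} X Y Z.
Arguments lunit {k m} X.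
Arguments luniti {k m} X.
Arguments runit {k m} X.
Arguments runiti {k m} X.

Notation "X \ox Y" := (tens X Y) (at level 38, left associativity).
Notation "f \om g" := (tensm f g) (at level 38, left associativity).

Section Duals.
Variables (k : fieldType) (C : moncat k).
Local Notation one := (unit_obj C).

Record dual_data (X : C) := DualData {
  dual_obj :> C;
  dual_ev : hom (dual_obj \ox X) one;
  dual_coev : hom one (X \ox dual_obj)
}.

Definition is_left_dual (X : C) (D : dual_data X) : Prop :=
  runit X \oc (idm X \om dual_ev D) \oc assoc X D X
      \oc (dual_coev D \om idm X) \oc luniti X = idm X /\
  lunit D \oc (dual_ev D \om idm (D : C)) \oc associ D X D
      \oc (idm (D : C) \om dual_coev D) \oc runiti D = idm (D : C).

(* The transpose of f with respect to arbitrary duals of X and Y; for f the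
   identity, this is the canonical comparison between two duals of X. *)
Definition transpose (X Y : C) (DX : dual_data X) (DY : dual_data Y)
    (f : hom X Y) : hom (DY : C) (DX : C) :=
  lunit DX \oc (dual_ev DY \om idm (DX : C)) \oc associ DY Y DX
    \oc (idm (DY : C) \om (f \om idm (DX : C)))
    \oc (idm (DY : C) \om dual_coev DX) \oc runiti DY.

Definition dual_unit : dual_data one :=
  @DualData one one (lunit one) (luniti one).

Definition dual_tens (X Y : C) (DX : dual_data X) (DY : dual_data Y) :
    dual_data (X \ox Y) :=
  @DualData (X \ox Y) (DY \ox DX)
    (dual_ev DY
       \oc (idm (DY : C) \om (lunit Y \oc (dual_ev DX \om idm Y)
                                \oc associ DX X Y))
       \oc assoc DY DX (X \ox Y))
    (associ X Y (DY \ox DX)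
       \oc (idm X \om (assoc Y DY DX \oc (dual_coev DY \om idm (DX : C))
                         \oc luniti DX))
       \oc dual_coev DX).

End Duals.

(* A right dual of X is an object Y of which X is a left dual. *)
Record rigidcat (k : fieldType) := RigidCat {
  rigidcat_moncat :> moncat k;
  ldual : forall X : rigidcat_moncat, dual_data X;
  ldualP : forall X, is_left_dual (ldual X);
  has_rdual : forall X : rigidcat_moncat,
    exists (Y : rigidcat_moncat) (ev : hom (X \ox Y) (unit_obj _))
           (coev : hom (unit_obj _) (Y \ox X)), is_left_dual (DualData ev coev)
}.

Arguments ldual {k r} X.

Definition star (k : fieldType) (C : rigidcat k) (X : C) : C := ldual X.

Definition starm (k : fieldType) (C : rigidcat k) (X Y : C) (f : hom X Y) :
  hom (star Y) (star X) := transpose (ldual X) (ldual Y) f.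

Section DoubleDual.
Variables (k : fieldType) (C : rigidcat k).
Local Notation one := (unit_obj C).

Definition dstar (X : C) : C := star (star X).
Definition dstarm (X Y : C) (f : hom X Y) : hom (dstar X) (dstar Y) :=
  starm (starm f).

(* The monoidal structure of the double dual functor: star turns the inverse
   (X \ox Y)^* -> Y^* \ox X^* of the canonical comparison into a morphism from
   the dual of Y^* \ox X^* to that of (X \ox Y)^*. *)
Definition dstar_tens (X Y : C) : hom (dstar X \ox dstar Y) (dstar (X \ox Y)) :=
  starm (transpose (dual_tens (ldual X) (ldual Y)) (ldual (X \ox Y))
           (idm (X \ox Y)))
  \oc transpose (ldual (star Y \ox star X))
        (dual_tens (ldual (star Y)) (ldual (star X)))
        (idm (star Y \ox star X)).

Definition dstar_unit : hom one (dstar one) :=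
  starm (transpose (dual_unit C) (ldual one) (idm one))
  \oc transpose (ldual one) (dual_unit C) (idm one).

Record pivotal_structure := PivotalStructure {
  piv : forall X, hom X (dstar X);
  piv_iso : forall X, is_iso (piv X);
  piv_nat : forall X Y (f : hom X Y), piv Y \oc f = dstarm f \oc piv X;
  piv_tens : forall X Y,
    piv (X \ox Y) = dstar_tens X Y \oc (piv X \om piv Y);
  piv_unit : piv one = dstar_unit
}.

End DoubleDual.

Record finite_tensor_category (k : fieldType) := FiniteTensorCategory {
  ftc_rigidcat :> rigidcat k;
  ftc_finite :
    exists A : falgType k, equivalent_to_fdmod A ftc_rigidcat;
  End1_scalar : hom (unit_obj ftc_rigidcat) (unit_obj ftc_rigidcat) -> k;
  scalarK : cancel (fun c : k => c *: idm (unit_obj ftc_rigidcat)) End1_scalar;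
  End1_scalarK :
    cancel End1_scalar (fun c : k => c *: idm (unit_obj ftc_rigidcat))
}.

Record fusion_category (k : fieldType) := FusionCategory {
  fusion_ftc :> finite_tensor_category k;
  fusion_semisimple : semisimple_category fusion_ftc
}.

Record pivotal_fusion_category (k : fieldType) := PivotalFusionCategory {
  pfc_fusion :> fusion_category k;
  pfc_pivotal : pivotal_structure pfc_fusion
}.

Section Dimension.
Variables (k : fieldType) (C : pivotal_fusion_category k).

Definition pdim (X : C) : k :=
  End1_scalar (dual_ev (ldual (star X))
                 \oc (piv (pfc_pivotal C) X \om idm (star X))
                 \oc dual_coev (ldual X)).

Definition simple_representatives m (V : 'I_m.+1 -> C) : Prop :=
  [/\ V ord0 = unit_obj C,
      forall i, is_simple (V i),
      forall i j, isomorphic (V i) (V j) -> i = j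
    & forall X : C, is_simple X -> exists i, isomorphic X (V i)].

Definition global_dim m (V : 'I_m.+1 -> C) : k :=
  \sum_i pdim (star (V i)) * pdim (V i).

End Dimension.

Section Center.
Variables (k : fieldType) (C : moncat k).

(* Objects of the center; [hbraid_tens] is sigma_(X \ox Y) =
   (id_X \ox sigma_Y) \oc (sigma_X \ox id_Y) with the associators inserted. *)
Record center_obj := CenterObj {
  center_ob :> C;
  hbraid : forall X, hom (center_ob \ox X) (X \ox center_ob);
  hbraid_iso : forall X, is_iso (hbraid X);
  hbraid_nat : forall X Y (f : hom X Y),
    hbraid Y \oc (idm center_ob \om f) = (f \om idm center_ob) \oc hbraid X;
  hbraid_tens : forall X Y,
    hbraid (X \ox Y)
      = associ X Y center_ob \oc (idm X \om hbraid Y) \oc assoc X center_ob Y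
          \oc (hbraid X \om idm Y) \oc associ center_ob X Y
}.

Section Hom.
Variables V W : center_obj.

Definition center_hom_pred : {pred hom (V : C) (W : C)} :=
  fun f => `[< forall X : C,
    hbraid W X \oc (f \om idm X) = (idm X \om f) \oc hbraid V X >].

Lemma center_hom_submod : submod_closed center_hom_pred.
Proof.
split=> [|c f g /asboolP ff /asboolP gg]; apply/asboolP => X.
  rewrite -[0](scale0r (0 : hom (V : C) (W : C))).
  by rewrite tensmZl tensmZr compmZl compmZr !scale0r.
by rewrite tensmDl tensmDr compmDl compmDr tensmZl tensmZr compmZl compmZr ff gg.
Qed.

HB.instance Definition _ := GRing.isSubmodClosed.Build
  k (hom (V : C) (W : C)) center_hom_pred center_hom_submod.

Record center_hom := CenterHom {
  center_mor :> hom (V : C) (W : C);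
  center_morP : center_mor \in center_hom_pred
}.

HB.instance Definition _ := [isSub for center_mor].
HB.instance Definition _ := [Choice of center_hom by <:].
HB.instance Definition _ := [SubChoice_isSubLmodule of center_hom by <:].

End Hom.

Arguments center_hom_pred : clear implicits.

Lemma center_id_subproof (V : center_obj) : idm (V : C) \in center_hom_pred V V.
Proof. by apply/asboolP => X; rewrite !tensm1 comp1m compm1. Qed.

Lemma center_comp_subproof (V W T : center_obj)
    (f : center_hom W T) (g : center_hom V W) :
  (f : hom (W : C) (T : C)) \oc g \in center_hom_pred V T.
Proof.
have /asboolP ff := center_morP f; have /asboolP gg := center_morP g.
apply/asboolP => X.
rewrite -[in LHS](comp1m (idm X)) -[in RHS](comp1m (idm X)) !tensmM.
by rewrite compmA ff -compmA gg compmA.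
Qed.

Definition center_id V : center_hom V V := CenterHom (center_id_subproof V).
Definition center_comp V W T (f : center_hom W T) (g : center_hom V W) :
  center_hom V T := CenterHom (center_comp_subproof f g).

Definition drinfeld_center : lincat k.
Proof.
apply: (@LinCat k center_obj (fun V W => center_hom V W) center_id center_comp).
- by move=> *; apply: val_inj; rewrite /= comp1m.
- by move=> *; apply: val_inj; rewrite /= compm1.
- by move=> *; apply: val_inj; rewrite /= compmA.
- by move=> *; apply: val_inj; rewrite /= compmDl.
- by move=> *; apply: val_inj; rewrite /= compmDr.
- by move=> *; apply: val_inj; rewrite /= compmZl.
- by move=> *; apply: val_inj; rewrite /= compmZr.
Defined.

Definition forgetful : functor drinfeld_center C :=
  @Functor k drinfeld_center C (fun V => center_ob V)
    (fun V W (f : center_hom V W) => center_mor f)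
    (fun V => erefl) (fun V W T f g => erefl).

End Center.

Section Coherence.
Variables (k : fieldType) (C : moncat k).
Local Notation one := (unit_obj C).
Implicit Types A B X Y Z : C.

Lemma tensm_idl A X Y Z (f : hom Y Z) (g : hom X Y) :
  idm A \om (f \oc g) = (idm A \om f) \oc (idm A \om g).
Proof. by rewrite -tensmM comp1m. Qed.

Lemma tensm_idr A X Y Z (f : hom Y Z) (g : hom X Y) :
  (f \oc g) \om idm A = (f \om idm A) \oc (g \om idm A).
Proof. by rewrite -tensmM comp1m. Qed.

Lemma tensm0l X Y X' Y' (h : hom X' Y') : (0 : hom X Y) \om h = 0.
Proof. by rewrite -(scale0r (0 : hom X Y)) tensmZl scale0r. Qed.

Lemma tensm0r X Y X' Y' (h : hom X' Y') : h \om (0 : hom X Y) = 0.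
Proof. by rewrite -(scale0r (0 : hom X Y)) tensmZr scale0r. Qed.

Lemma associ_nat X Y Z X' Y' Z' (f : hom X X') (g : hom Y Y') (h : hom Z Z') :
  associ X' Y' Z' \oc (f \om (g \om h)) = ((f \om g) \om h) \oc associ X Y Z.
Proof.
rewrite -[LHS]compm1 -(associK X Y Z) compmA -(compmA (associ _ _ _)).
by rewrite -assoc_nat !compmA assocK comp1m.
Qed.

Lemma runiti_nat X Y (f : hom X Y) :
  runiti Y \oc f = (f \om idm one) \oc runiti X.
Proof.
rewrite -[LHS]compm1 -(runitiK X) compmA -(compmA (runiti Y)).
by rewrite -runit_nat !compmA runitK comp1m.
Qed.

Lemma luniti_nat X Y (f : hom X Y) :
  luniti Y \oc f = (idm one \om f) \oc luniti X.
Proof.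
rewrite -[LHS]compm1 -(lunitiK X) compmA -(compmA (luniti Y)).
by rewrite -lunit_nat !compmA lunitK comp1m.
Qed.

Lemma runit_tens A B : (idm A \om runit B) \oc assoc A B one = runit (A \ox B).
Proof.
suff E : ((idm A \om runit B) \oc assoc A B one) \om idm one
         = runit (A \ox B) \om idm one.
  rewrite -[LHS]compm1 -[RHS]compm1 -(runitiK (A \ox B \ox one)) !compmA.
  by rewrite -[in LHS]runit_nat E runit_nat.
rewrite -[LHS]comp1m -[RHS]comp1m -assocK -!compmA; congr (_ \oc _).
rewrite tensm_idr compmA assoc_nat -(triangle B) -triangle.
rewrite tensm_idl -!compmA (compmA (idm A \om assoc _ _ _)) -pentagon.
by rewrite -(tensm1 A B) !compmA assoc_nat.
Qed.

Lemma lunit_tens A B : lunit (A \ox B) \oc assoc one A B = lunit A \om idm B.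
Proof.
suff E : idm one \om (lunit (A \ox B) \oc assoc one A B)
         = idm one \om (lunit A \om idm B).
  rewrite -[LHS]compm1 -[RHS]compm1 -(lunitiK (one \ox A \ox B)) !compmA.
  by rewrite -[in LHS]lunit_nat E lunit_nat.
rewrite -[LHS]compm1 -[RHS]compm1 -(associK one (one \ox A) B) !compmA.
congr (_ \oc _).
rewrite -[LHS]compm1 -[RHS]compm1 -(tensm1 _ B) -(associK one one A) tensm_idr.
rewrite !compmA; congr (_ \oc _).
rewrite -assoc_nat -(compmA (assoc one A B)) -tensm_idr triangle assoc_nat.
rewrite tensm1 -triangle tensm_idl -!compmA (compmA (_ \om assoc _ _ _)).
by rewrite -pentagon.
Qed.

Lemma runiti_tens A B : associ A B one \oc (idm A \om runiti B)
   = runiti (A \ox B).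
Proof.
rewrite -[LHS]comp1m -runitK -runit_tens -!compmA (compmA (assoc _ _ _)) associK.
by rewrite comp1m -tensm_idl runitiK tensm1 compm1.
Qed.

Lemma luniti_tens A B : assoc one A B \oc (luniti A \om idm B)
   = luniti (A \ox B).
Proof.
rewrite -[LHS]comp1m -lunitK -!compmA (compmA (lunit _)) lunit_tens.
by rewrite -tensm_idr lunitiK tensm1 compm1.
Qed.

Lemma trianglei A B : (runit A \om idm B) \oc associ A one B = idm A \om lunit B.
Proof. by rewrite -triangle -compmA associK compm1. Qed.

Lemma trianglei2 A B :
  associ A one B \oc (idm A \om luniti B) = runiti A \om idm B.
Proof.
rewrite -[LHS]comp1m -(tensm1 (A \ox one) B) -runitK tensm_idr -!compmA.
by rewrite (compmA (runit A \om _)) trianglei -tensm_idl lunitiK tensm1 compm1.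
Qed.

Lemma pentagoni1 X Y Z T :
  assoc (X \ox Y) Z T \oc (associ X Y Z \om idm T) \oc associ X (Y \ox Z) T
    = associ X Y (Z \ox T) \oc (idm X \om assoc Y Z T).
Proof.
rewrite -[LHS]comp1m -(assocK X Y (Z \ox T)) -!compmA; congr (_ \oc _).
rewrite !compmA pentagon -!compmA (compmA (_ \om idm T)) -tensm_idr associK.
by rewrite tensm1 comp1m associK compm1.
Qed.

Lemma pentagoni2 X Y Z T :
  (assoc X Y Z \om idm T) \oc associ (X \ox Y) Z T \oc associ X Y (Z \ox T)
    = associ X (Y \ox Z) T \oc (idm X \om associ Y Z T).
Proof.
rewrite -[LHS]compm1 -(tensm1 X) -(associK Y Z T) tensm_idl.
rewrite !compmA; congr (_ \oc _); rewrite -!compmA.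
rewrite -pentagoni1 (compmA (associ _ Z T)) (compmA (associ _ Z T)) assocK comp1m.
by rewrite compmA -tensm_idr associK tensm1 comp1m.
Qed.

Lemma pentagon3 X Y Z T :
  (idm X \om associ Y Z T) \oc assoc X Y (Z \ox T) \oc assoc (X \ox Y) Z T
    = assoc X (Y \ox Z) T \oc (assoc X Y Z \om idm T).
Proof.
rewrite -!compmA pentagon !compmA -tensm_idl assocK tensm1.
by rewrite comp1m.
Qed.

End Coherence.

Section Exactness.
Variables (k : fieldType) (C D : lincat k) (T : functor C D) (G : functor D C).
Variables (eta : forall X, hom X (G (T X))) (eps : forall Y, hom (T (G Y)) Y).
Hypothesis T0 : forall X Y, fmap T (0 : hom X Y) = 0.
Hypothesis G0 : forall X Y, fmap G (0 : hom X Y) = 0.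
Hypothesis eta_nat : forall X Y (f : hom X Y),
  eta Y \oc f = fmap G (fmap T f) \oc eta X.
Hypothesis eps_nat : forall X Y (f : hom X Y),
  eps Y \oc fmap T (fmap G f) = f \oc eps X.
Hypothesis etaK : forall X, eps (T X) \oc fmap T (eta X) = idm (T X).
Hypothesis epsK : forall Y, fmap G (eps Y) \oc eta (G Y) = idm (G Y).

Lemma comp0m (E : lincat k) (X Y Z : E) (f : hom X Y) : (0 : hom Y Z) \oc f = 0.
Proof. by rewrite -(scale0r (0 : hom Y Z)) compmZl scale0r. Qed.

Lemma compm0 (E : lincat k) (X Y Z : E) (f : hom Y Z) : f \oc (0 : hom X Y) = 0.
Proof. by rewrite -(scale0r (0 : hom X Y)) compmZr scale0r. Qed.

Lemma ladj_cokernel (X Y Z : C) (f : hom X Y) (p : hom Y Z) :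
  is_cokernel p f -> is_cokernel (fmap T p) (fmap T f).
Proof.
move=> [pf0 univ]; split=> [|W h hf0]; first by rewrite -fmapM pf0 T0.
have [|u [up uniq]] := univ (G W) (fmap G h \oc eta Y).
  by rewrite -compmA eta_nat compmA -fmapM hf0 G0 comp0m.
exists (eps W \oc fmap T u); split=> [|v vp].
  by rewrite -compmA -fmapM up fmapM compmA eps_nat -compmA etaK compm1.
rewrite (uniq (fmap G v \oc eta Z)).
  by rewrite fmapM compmA eps_nat -compmA etaK compm1.
by rewrite -compmA eta_nat compmA -fmapM vp.
Qed.

Lemma radj_kernel (X Y Z : D) (i : hom X Y) (f : hom Y Z) :
  is_kernel i f -> is_kernel (fmap G i) (fmap G f).
Proof.
move=> [if0 univ]; split=> [|W h fh0]; first by rewrite -fmapM if0 G0.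
have [|u [iu uniq]] := univ (T W) (eps Y \oc fmap T h).
  by rewrite compmA -eps_nat -compmA -fmapM fh0 T0 compm0.
exists (fmap G u \oc eta W); split=> [|v iv].
  by rewrite compmA -fmapM iu fmapM -compmA -eta_nat compmA epsK comp1m.
rewrite (uniq (eps X \oc fmap T v)).
  by rewrite fmapM -compmA -eta_nat compmA epsK comp1m.
by rewrite compmA -eps_nat -compmA -fmapM iv.
Qed.

End Exactness.

Section TensorFunctors.
Variables (k : fieldType) (C : moncat k).
Local Notation one := (unit_obj C).

Definition tensl (A : C) : functor C C :=
  @Functor k C C (fun X => A \ox X) (fun X Y f => idm A \om f)
    (fun X => tensm1 A X) (fun X Y Z f g => tensm_idl A f g).

Definition tensr (A : C) : functor C C :=
  @Functor k C C (fun X => X \ox A) (fun X Y f => f \om idm A)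
    (fun X => tensm1 X A) (fun X Y Z f g => tensm_idr A f g).

Variables (X : C) (D : dual_data X).
Hypothesis XD : is_left_dual D.

Let reta (A : C) : hom A (A \ox X \ox D) :=
  associ A X D \oc (idm A \om dual_coev D) \oc runiti A.
Let reps (B : C) : hom (B \ox D \ox X) B :=
  runit B \oc (idm B \om dual_ev D) \oc assoc B D X.
Let leta (B : C) : hom B (X \ox (D \ox B)) :=
  assoc X D B \oc (dual_coev D \om idm B) \oc luniti B.
Let leps (A : C) : hom (D \ox (X \ox A)) A :=
  lunit A \oc (dual_ev D \om idm A) \oc associ D X A.

Let tensr0 A (Y Z : C) : fmap (tensr A) (0 : hom Y Z) = 0.
Proof. exact: tensm0l. Qed.
Let tensl0 A (Y Z : C) : fmap (tensl A) (0 : hom Y Z) = 0.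
Proof. exact: tensm0r. Qed.

Let reta_nat A B (f : hom A B) :
  reta B \oc f = fmap (tensr D) (fmap (tensr X) f) \oc reta A.
Proof.
rewrite /reta /= -!compmA runiti_nat (compmA (idm B \om _)) -tensmM comp1m compm1.
rewrite [in RHS]compmA -associ_nat tensm1 -!compmA; congr (_ \oc _).
by rewrite compmA -tensmM comp1m compm1.
Qed.

Let reps_nat A B (f : hom A B) :
  reps B \oc fmap (tensr X) (fmap (tensr D) f) = f \oc reps A.
Proof.
rewrite /reps /= -compmA assoc_nat tensm1 !compmA; congr (_ \oc _).
by rewrite -compmA -tensmM -runit_nat -!compmA -tensmM !comp1m !compm1.
Qed.

Let leta_nat A B (f : hom A B) :
  leta B \oc f = fmap (tensl X) (fmap (tensl D) f) \oc leta A.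
Proof.
rewrite /leta /= -!compmA luniti_nat (compmA (_ \om idm B)) -tensmM comp1m compm1.
rewrite [in RHS]compmA -assoc_nat tensm1 -!compmA; congr (_ \oc _).
by rewrite compmA -tensmM comp1m compm1.
Qed.

Let leps_nat A B (f : hom A B) :
  leps B \oc fmap (tensl D) (fmap (tensl X) f) = f \oc leps A.
Proof.
rewrite /leps /= -compmA associ_nat tensm1 !compmA; congr (_ \oc _).
by rewrite -compmA -tensmM -lunit_nat -!compmA -tensmM !comp1m !compm1.
Qed.

Let retaK A : reps (A \ox X) \oc (reta A \om idm X) = idm (A \ox X).
Proof.
rewrite /reta /reps !tensm_idr -trianglei2 !compmA.
rewrite -(compmA _ _ (associ A one X)) -associ_nat !compmA.
rewrite -2!(compmA (runit _ \oc _)) pentagoni1 !compmA -(compmA (runit _)).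
rewrite -(tensm1 A X) -associ_nat !compmA -runit_tens.
rewrite -(compmA (idm A \om _)) associK compm1 -!tensm_idl tensm1.
by have [-> _] := XD; rewrite tensm1.
Qed.

Let repsK B : (reps B \om idm (D : C)) \oc reta (B \ox D) = idm (B \ox D).
Proof.
rewrite /reta /reps !tensm_idr -runiti_tens !compmA.
rewrite -(compmA _ _ (associ B D one)) -(tensm1 B D) -associ_nat !compmA.
rewrite -2!(compmA (runit B \om _ \oc _)) pentagoni2 !compmA.
rewrite -(compmA (runit B \om _)) -associ_nat !compmA trianglei -!tensm_idl.
by have [_ ->] := XD; rewrite !tensm1.
Qed.

Let letaK B : leps (D \ox B) \oc (idm (D : C) \om leta B) = idm (D \ox B).
Proof.
rewrite /leta /leps !tensm_idl !compmA.
rewrite -(compmA _ (associ _ _ _)) -pentagoni1 !compmA.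
rewrite -(compmA _ (associ D _ B)) associ_nat !compmA.
rewrite -(compmA _ (associ D one B)) trianglei2 -(tensm1 D B).
rewrite -(compmA (lunit _)) -assoc_nat !compmA lunit_tens -!tensm_idr.
by have [_ ->] := XD; rewrite tensm1.
Qed.

Let lepsK A : (idm X \om leps A) \oc leta (X \ox A) = idm (X \ox A).
Proof.
rewrite /leta /leps !tensm_idl -luniti_tens !compmA.
rewrite -(compmA _ (_ \om idm (X \ox A))) -(tensm1 X A) -assoc_nat !compmA.
rewrite -2!(compmA (idm X \om lunit A \oc _)) pentagon3 !compmA.
rewrite -(compmA (idm X \om lunit A)) -assoc_nat !compmA triangle -!tensm_idr.
by have [-> _] := XD; rewrite !tensm1.
Qed.

Lemma tensr_cokernel (A B Q : C) (p : hom B Q) (f : hom A B) :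
  is_cokernel p f -> is_cokernel (p \om idm X) (f \om idm X).
Proof.
exact: (@ladj_cokernel k C C (tensr X) (tensr D) reta reps
  (@tensr0 _) (@tensr0 _) reta_nat reps_nat retaK).
Qed.

Lemma tensr_kernel (K A B : C) (i : hom K A) (f : hom A B) :
  is_kernel i f -> is_kernel (i \om idm (D : C)) (f \om idm (D : C)).
Proof.
exact: (@radj_kernel k C C (tensr X) (tensr D) reta reps
  (@tensr0 _) (@tensr0 _) reta_nat reps_nat repsK).
Qed.

Lemma tensl_cokernel (A B Q : C) (p : hom B Q) (f : hom A B) :
  is_cokernel p f -> is_cokernel (idm (D : C) \om p) (idm (D : C) \om f).
Proof.
exact: (@ladj_cokernel k C C (tensl D) (tensl X) leta leps
  (@tensl0 _) (@tensl0 _) leta_nat leps_nat letaK).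
Qed.

Lemma tensl_kernel (K A B : C) (i : hom K A) (f : hom A B) :
  is_kernel i f -> is_kernel (idm X \om i) (idm X \om f).
Proof.
exact: (@radj_kernel k C C (tensl D) (tensl X) leta leps
  (@tensl0 _) (@tensl0 _) leta_nat leps_nat lepsK).
Qed.

End TensorFunctors.

Section RigidExact.
Variables (k : fieldType) (C : rigidcat k).

Lemma tensr_exact (A X Y Z : C) (f : hom X Y) (g : hom Y Z) :
  short_exact f g -> short_exact (f \om idm A) (g \om idm A).
Proof.
move=> [kf cg]; split; last exact: tensr_cokernel (ldualP A) _ _ _ _ _ cg.
have [Y' [ev [coev dA]]] := has_rdual A.
exact: tensr_kernel dA _ _ _ _ _ kf.
Qed.

Lemma tensl_exact (A X Y Z : C) (f : hom X Y) (g : hom Y Z) :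
  short_exact f g -> short_exact (idm A \om f) (idm A \om g).
Proof.
move=> [kf cg]; split; first exact: tensl_kernel (ldualP A) _ _ _ _ _ kf.
have [Y' [ev [coev dA]]] := has_rdual A.
exact: tensl_cokernel dA _ _ _ _ _ cg.
Qed.

End RigidExact.

(* For a commutative ring S, [gr S C] is the S-algebra S (x)_Z Gr(C): the
   S-module presented by one generator for each object of C and the relations
   [X] = [Y] for isomorphic X and Y, and [Y] = [X] + [Z] for each short exact
   sequence 0 -> X -> Y -> Z -> 0, with product [X] [Y] = [X \ox Y].  The ring
   gr int C is Gr(C) itself.  The list of the (a_i, X_i) stands for the formal
   sum of the a_i [X_i]. *)

Section Grothendieck.
Variables (S : comPzRingType) (k : fieldType) (C : rigidcat k).

Definition formal_sum : Type := seq (S * C).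
HB.instance Definition _ := gen_eqMixin formal_sum.
HB.instance Definition _ := gen_choiceMixin formal_sum.

Inductive gr_rel : formal_sum -> formal_sum -> Prop :=
| gr_rel_refl s : gr_rel s s
| gr_rel_sym s t : gr_rel s t -> gr_rel t s
| gr_rel_trans s t u : gr_rel s t -> gr_rel t u -> gr_rel s u
| gr_rel_cat s s' t t' :
    gr_rel s s' -> gr_rel t t' -> gr_rel (s ++ t) (s' ++ t')
| gr_rel_swap s t : gr_rel (s ++ t) (t ++ s)
| gr_rel_zero X : gr_rel [:: (0, X)] [::]
| gr_rel_add a b X : gr_rel [:: (a, X); (b, X)] [:: (a + b, X)]
| gr_rel_iso a X Y : isomorphic X Y -> gr_rel [:: (a, X)] [:: (a, Y)]
| gr_rel_exact a X Y Z (f : hom X Y) (g : hom Y Z) :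
    short_exact f g -> gr_rel [:: (a, Y)] [:: (a, X); (a, Z)].

Definition gr_eqv : rel formal_sum := fun s t => `[< gr_rel s t >].

Lemma gr_eqv_refl : reflexive gr_eqv.
Proof. by move=> s; apply/asboolP/gr_rel_refl. Qed.

Lemma gr_eqv_sym : symmetric gr_eqv.
Proof. by move=> s t; apply/asboolP/asboolP => /gr_rel_sym. Qed.

Lemma gr_eqv_trans : transitive gr_eqv.
Proof.
by move=> s t u /asboolP ts /asboolP su; apply/asboolP/(gr_rel_trans ts su).
Qed.

Canonical gr_equiv := EquivRel gr_eqv gr_eqv_refl gr_eqv_sym gr_eqv_trans.
Canonical gr_encModRel := defaultEncModRel gr_eqv.

Definition gr : Type := {eq_quot gr_eqv}.
HB.instance Definition _ := EqQuotient.on gr.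
HB.instance Definition _ := Choice.on gr.

Implicit Types (s t : formal_sum) (x y z : gr) (X Y Z : C).

Let cls s : gr := \pi_gr s.

Let clsP s t : cls s = cls t <-> gr_rel s t.
Proof.
split=> [/eqmodP /asboolP //|st]; exact/eqmodP/asboolP.
Qed.

Let clsK x : cls (repr x) = x. Proof. exact: reprK. Qed.

Let reprP s : gr_rel (repr (cls s)) s.
Proof. by apply/clsP; rewrite clsK. Qed.

Definition fscale (a : S) s : formal_sum := [seq (a * p.1, p.2) | p <- s].

Definition gr_zero : gr := \pi_gr ([::] : formal_sum).
Definition gr_plus x y : gr := \pi_gr (repr x ++ repr y : formal_sum).
Definition gr_scale (a : S) x : gr := \pi_gr (fscale a (repr x)).
Definition gr_opp x : gr := gr_scale (-1) x.

Let plusE s t : gr_plus (cls s) (cls t) = cls (s ++ t).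
Proof. by apply/clsP/gr_rel_cat; exact: reprP. Qed.

Let fscale_rel a s t : gr_rel s t -> gr_rel (fscale a s) (fscale a t).
Proof.
rewrite /fscale; elim=> {s t} /=.
- by move=> s; exact: gr_rel_refl.
- by move=> s t _; exact: gr_rel_sym.
- by move=> s t u _ st _; exact: gr_rel_trans.
- by move=> s s' t t' _ ss _ tt; rewrite !map_cat; exact: gr_rel_cat.
- by move=> s t; rewrite !map_cat; exact: gr_rel_swap.
- by move=> X; rewrite mulr0; exact: gr_rel_zero.
- by move=> b c X; rewrite mulrDr; exact: gr_rel_add.
- by move=> b X Y; exact: gr_rel_iso.
- by move=> b X Y Z f g; exact: gr_rel_exact.
Qed.

Let scaleE a s : gr_scale a (cls s) = cls (fscale a s).
Proof. by apply/clsP/fscale_rel/reprP. Qed.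

Let plusC : commutative gr_plus.
Proof. by move=> x y; apply/clsP/gr_rel_swap. Qed.

Let plusA : associative gr_plus.
Proof.
by move=> x y z; rewrite -(clsK x) -(clsK y) -(clsK z) !plusE catA.
Qed.

Let plus0 : left_id gr_zero gr_plus.
Proof. by move=> x; rewrite -(clsK x) plusE. Qed.

Let scale_cons a c X s :
  cls (fscale a ((c, X) :: s)) = gr_plus (cls [:: (a * c, X)]) (cls (fscale a s)).
Proof. by rewrite plusE. Qed.

Let scaleDl x a b : gr_scale (a + b) x = gr_plus (gr_scale a x) (gr_scale b x).
Proof.
rewrite -(clsK x) !scaleE; elim: (repr x) => [|[c X] s IHs].
  by rewrite plusE.
have E : cls [:: ((a + b) * c, X)]
         = gr_plus (cls [:: (a * c, X)]) (cls [:: (b * c, X)]).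
  by rewrite plusE mulrDl; apply/clsP/gr_rel_sym/gr_rel_add.
rewrite !scale_cons IHs E -!plusA; congr gr_plus.
by rewrite !plusA; congr gr_plus; exact: plusC.
Qed.

Let scale0 x : gr_scale 0 x = gr_zero.
Proof.
rewrite -(clsK x) scaleE; elim: (repr x) => [//|[c X] s IHs].
rewrite scale_cons IHs plusC plus0 mul0r; exact/clsP/gr_rel_zero.
Qed.

Let scale1 : left_id 1 gr_scale.
Proof.
move=> x; rewrite -[in RHS](clsK x) -[x in LHS]clsK scaleE; congr cls.
by rewrite /fscale -[RHS]map_id; apply: eq_map => -[c X]; rewrite mul1r.
Qed.

Let scaleA a b x : gr_scale a (gr_scale b x) = gr_scale (a * b) x.
Proof.
rewrite -(clsK x) !scaleE; congr cls; rewrite /fscale -map_comp.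
by apply: eq_map => -[c X] /=; rewrite mulrA.
Qed.

Let scaleDr : right_distributive gr_scale gr_plus.
Proof.
move=> a x y; rewrite -(clsK x) -(clsK y) !(plusE, scaleE).
by rewrite /fscale map_cat.
Qed.

Let plusN : left_inverse gr_zero gr_opp gr_plus.
Proof. by move=> x; rewrite -[x in gr_plus _ x]scale1 -scaleDl addNr scale0. Qed.

HB.instance Definition _ :=
  GRing.isZmodule.Build gr plusA plusC plus0 plusN.
HB.instance Definition _ :=
  GRing.Zmodule_isLmodule.Build S gr scaleA scale1 scaleDr scaleDl.

Definition gr_class X : gr := \pi_gr ([:: (1, X)] : formal_sum).

Lemma gr_class_iso X Y : isomorphic X Y -> gr_class X = gr_class Y.
Proof. by move=> XY; apply/clsP/gr_rel_iso. Qed.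

Lemma gr_class_exact X Y Z (f : hom X Y) (g : hom Y Z) :
  short_exact f g -> gr_class Y = gr_class X + gr_class Z.
Proof. by move=> fg; rewrite [RHS]plusE; apply/clsP/(gr_rel_exact _ fg). Qed.

(* The S-linear extension of a function on objects; it is meaningful only for
   the functions that satisfy [gr_additive]. *)
Definition gr_lift (M : lmodType S) (f : C -> M) x : M :=
  \sum_(p <- (repr x : formal_sum)) p.1 *: f p.2.

Definition gr_additive (M : lmodType S) (f : C -> M) : Prop :=
  (forall X Y, isomorphic X Y -> f X = f Y) /\
  (forall X Y Z (u : hom X Y) (v : hom Y Z),
     short_exact u v -> f Y = f X + f Z).

Section Lift.
Variables (M : lmodType S) (f : C -> M).
Hypothesis fadd : gr_additive f.

Let liftE s : gr_lift f (cls s) = \sum_(p <- s) p.1 *: f p.2.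
Proof.
suff E t u : gr_rel t u ->
    \sum_(p <- t) p.1 *: f p.2 = \sum_(p <- u) p.1 *: f p.2 by exact/E/reprP.
have [fiso fexact] := fadd.
elim=> {t u} //=.
- by move=> t u v _ -> _ ->.
- by move=> t t' u u' _ tt _ uu; rewrite !big_cat tt uu.
- by move=> t u; rewrite !big_cat /= addrC.
- by move=> X; rewrite big_seq1 big_nil scale0r.
- by move=> a b X; rewrite big_cons !big_seq1 scalerDl.
- by move=> a X Y XY; rewrite !big_seq1 (fiso _ _ XY).
- move=> a X Y Z u v uv.
  by rewrite !big_cons !big_nil !addr0 /= (fexact _ _ _ _ _ uv) scalerDr.
Qed.

Lemma gr_lift_class X : gr_lift f (gr_class X) = f X.
Proof. by rewrite liftE big_seq1 scale1r. Qed.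

Lemma gr_liftD x y : gr_lift f (x + y) = gr_lift f x + gr_lift f y.
Proof. by rewrite -(clsK x) -(clsK y) [_ + _]plusE !liftE big_cat. Qed.

Lemma gr_liftZ a x : gr_lift f (a *: x) = a *: gr_lift f x.
Proof.
rewrite -(clsK x) [_ *: _]scaleE !liftE /fscale big_map scaler_sumr.
by apply: eq_bigr => p _; rewrite scalerA.
Qed.

End Lift.

Lemma gr_ind (P : gr -> Prop) :
  P 0 -> (forall a X x, P x -> P (a *: gr_class X + x)) -> forall x, P x.
Proof.
move=> P0 PD x; rewrite -(clsK x); elim: (repr x) => [//|[a X] s Ps].
suff -> : cls ((a, X) :: s) = a *: gr_class X + cls s by exact: PD.
by rewrite [a *: _]scaleE [_ + _]plusE /= mulr1.
Qed.

Definition gr_one : gr := gr_class (unit_obj C).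
Definition gr_mul x y : gr :=
  gr_lift (fun X => gr_lift (fun Y => gr_class (X \ox Y)) y) x.

Let is_iso_tens X Y X' Y' (f : hom X Y) (g : hom X' Y') :
  is_iso f -> is_iso g -> is_iso (f \om g).
Proof.
move=> [f' [f'f ff']] [g' [g'g gg']]; exists (f' \om g').
by rewrite -!tensmM f'f g'g ff' gg' !tensm1.
Qed.

Let is_iso_idm X : is_iso (idm X).
Proof. by exists (idm X); rewrite comp1m. Qed.

Let tensl_additive X : gr_additive (fun Y => gr_class (X \ox Y)).
Proof.
split=> [Y Z [f fP]|Y Z T f g /(tensl_exact X)]; last exact: gr_class_exact.
by apply: gr_class_iso; exists (idm X \om f); exact: is_iso_tens.
Qed.

Let mul_additive y :
  gr_additive (fun X => gr_lift (fun Y => gr_class (X \ox Y)) y).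
Proof.
split=> [X X' [f fP]|X X' X'' f g fg]; rewrite /gr_lift.
  apply: eq_bigr => p _; congr (_ *: _); apply: gr_class_iso.
  by exists (f \om idm p.2); exact: is_iso_tens.
rewrite -big_split; apply: eq_bigr => p _ /=; rewrite -scalerDr; congr (_ *: _).
exact/gr_class_exact/tensr_exact/fg.
Qed.

Lemma gr_mul_class X Y : gr_mul (gr_class X) (gr_class Y) = gr_class (X \ox Y).
Proof. by rewrite /gr_mul gr_lift_class // gr_lift_class. Qed.

Let mulDl : left_distributive gr_mul +%R.
Proof. by move=> x y z; rewrite /gr_mul gr_liftD. Qed.

Let mulZl a x y : gr_mul (a *: x) y = a *: gr_mul x y.
Proof. by rewrite /gr_mul gr_liftZ. Qed.

Let mulE x y : gr_mul x y = \sum_(p <- (repr x : formal_sum))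
  p.1 *: gr_lift (fun Y => gr_class (p.2 \ox Y)) y.
Proof. by []. Qed.

Let mulDr : right_distributive gr_mul +%R.
Proof.
move=> x y z; rewrite !mulE -big_split; apply: eq_bigr => p _ /=.
by rewrite -scalerDr -gr_liftD.
Qed.

Let mulZr a x y : gr_mul x (a *: y) = a *: gr_mul x y.
Proof.
rewrite !mulE scaler_sumr; apply: eq_bigr => p _ /=.
by rewrite gr_liftZ // !scalerA mulrC.
Qed.

Let mul0 y : gr_mul 0 y = 0.
Proof. by rewrite -(scale0r 0) mulZl !scale0r. Qed.

Let mulr_0 x : gr_mul x 0 = 0.
Proof. by rewrite -(scale0r 0) mulZr !scale0r. Qed.

Let mulA : associative gr_mul.
Proof.
move=> x y z; elim/gr_ind: x => [|a X x IHx]; first by rewrite !mul0.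
rewrite !(mulDl, mulZl) IHx; congr (_ *: _ + _) => {x IHx}.
elim/gr_ind: y => [|b Y y IHy]; first by rewrite !(mul0, mulr_0).
rewrite !(mulDl, mulDr, mulZl, mulZr) IHy; congr (_ *: _ + _) => {y IHy}.
elim/gr_ind: z => [|c Z z IHz]; first by rewrite !(mul0, mulr_0).
rewrite !(mulDl, mulDr, mulZl, mulZr) IHz; congr (_ *: _ + _) => {z IHz}.
rewrite !gr_mul_class; apply: gr_class_iso; exists (associ X Y Z).
by exists (assoc X Y Z); rewrite associK assocK.
Qed.

Let mul1 : left_id gr_one gr_mul.
Proof.
elim/gr_ind=> [|a X x IHx]; rewrite ?mulr_0 // mulDr mulZr IHx gr_mul_class.
congr (_ *: _ + _); apply: gr_class_iso; exists (lunit X).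
by exists (luniti X); rewrite lunitK lunitiK.
Qed.

Let mulr_1 : right_id gr_one gr_mul.
Proof.
elim/gr_ind=> [|a X x IHx]; rewrite ?mul0 // mulDl mulZl IHx gr_mul_class.
congr (_ *: _ + _); apply: gr_class_iso; exists (runit X).
by exists (runiti X); rewrite runitK runitiK.
Qed.

HB.instance Definition _ :=
  GRing.Zmodule_isPzRing.Build gr mulA mul1 mulr_1 mulDl mulDr.

Lemma gr_classM X Y : gr_class X * gr_class Y = gr_class (X \ox Y).
Proof. exact: gr_mul_class. Qed.

Lemma gr_scalerAl a x y : a *: (x * y) = a *: x * y.
Proof. by rewrite [RHS]mulZl. Qed.

Lemma gr_scalerAr a x y : a *: (x * y) = x * (a *: y).
Proof. by rewrite [RHS]mulZr. Qed.

End Grothendieck.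

Arguments gr S {k} C.

(* [gr k C] carries the structures [pzRingType] and [lmodType k] only, since the
   algebra structures of the library exclude the zero ring.  Semisimplicity of
   an algebra is that of its underlying ring: the regular left module is a
   direct sum of finitely many simple submodules. *)
Definition left_ideal (A : pzRingType) (I : A -> Prop) : Prop :=
  [/\ I 0, forall x y, I x -> I y -> I (x + y) & forall a x, I x -> I (a * x)].

Definition simple_left_ideal (A : pzRingType) (I : A -> Prop) : Prop :=
  [/\ left_ideal I, exists2 x, I x & x != 0
    & forall J, left_ideal J -> (forall x, J x -> I x) ->
        (forall x, J x -> x = 0) \/ (forall x, I x -> J x)].

Definition semisimple_ring (A : pzRingType) : Prop :=
  exists n (I : 'I_n -> A -> Prop),
    (forall i, simple_left_ideal (I i)) /\
    forall x, exists! x_ : {ffun 'I_n -> A},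
      (forall i, I i (x_ i)) /\ x = \sum_i x_ i.

(* Main.v *)
From HB Require Import structures.
From mathcomp Require Import all_boot all_algebra.
From mathcomp Require Import boolp.
Require Import Defs.

(* Write S(h) for the sum over the simple objects V_i of dim(V_i^* ) times the
   partial trace over V_i of a family h that is natural in a strand.  Handle
   slides show that S(h) absorbs any further strand.

   (1) => (2): the class L of sum_i dim(V_i^* ) V_i satisfies [Y] L = dim(Y) L,
   so L^2 = dim(C) L, and a semisimple ring has no nonzero L with L A L = 0.

   (2) => (3): for g : U(Z) -> U(Z') in C, the sum S of the conjugates of g by
   the half-braidings is a morphism g' of the center, and f g f = f implies
   f g' f = dim(C) f for every morphism f : Z' -> Z of the center.  As C is
   von Neumann regular, so is Z(C); it has kernels and direct sums, hence it
   is semisimple abelian.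

   (4) => (1): Gr_k(C) acts on Hom(U -, 1), a class [X] encircling a morphism
   by a loop coloured by X, so it maps to End(R(1)) by the Yoneda lemma.  This
   is an isomorphism, because R(1) is a retract of T, the direct sum of the
   V_i (x) V_i^* with its canonical half-braiding, and Hom(U(T), 1) is free of
   rank one over Gr_k(C). *)

Set Implicit Arguments.
Unset Strict Implicit.
Unset Printing Implicit Defensive.

Import GRing.Theory.
Local Open Scope ring_scope.

(** * Nested string diagrams and modular families *)

Notation "X |> f" := (idm X \om f) (at level 37, right associativity).
Notation "f <| W" := (f \om idm W) (at level 36, right associativity).
Notation "X \ot W" := (tens X W) (at level 37, right associativity, only parsing).

(** Dimensions of an object and of its dual may differ, so the orientation of every loop matters:
    the weight of a simple object is the loop [ev] after [cr], while the strand of h is closed by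
    [er] after [cv]. The product of the two loops is a summand of the global dimension. Sums over
    simple objects run over resolutions, which are arbitrary factorisations of an identity through
    simple objects. The Casimir slide shows that bilinear expressions in the two factors do not
    depend on the choice of resolution and can be moved along morphisms. This replaces dual bases
    and avoids choosing, for each simple object, the representative of its dual. Averaging is
    applied to the equation f g f = f rather than to sections, because this one equation survives
    averaging up to the factor dim(C) and splits monomorphisms and epimorphisms alike. *)

Section Composition.
Variables (k : fieldType) (C : lincat k).

Lemma comp_rw1 (X Y Z T : C) (f : hom Y Z) (g : hom X Y) h (a : hom Z T) :
  f \oc g = h -> a \oc f \oc g = a \oc h.
Proof. by move=> <-; rewrite compmA. Qed.

Lemma comp_rw2 (X Y Y' Z T : C) (f : hom Y Z) (g : hom X Y) (f' : hom Y' Z)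
    (g' : hom X Y') (a : hom Z T) :
  f \oc g = f' \oc g' -> a \oc f \oc g = a \oc f' \oc g'.
Proof. by move=> e; rewrite -compmA e compmA. Qed.

Lemma compm_suml I (r : seq I) P (X Y Z : C) (F : I -> hom Y Z) (g : hom X Y) :
  (\sum_(i <- r | P i) F i) \oc g = \sum_(i <- r | P i) (F i \oc g).
Proof.
elim/big_rec2: _ => [|i y x _ <-]; last by rewrite compmDl.
by rewrite -(scale0r (0 : hom Y Z)) compmZl scale0r.
Qed.

Lemma compm_sumr I (r : seq I) P (X Y Z : C) (F : I -> hom X Y) (g : hom Y Z) :
  g \oc (\sum_(i <- r | P i) F i) = \sum_(i <- r | P i) (g \oc F i).
Proof.
elim/big_rec2: _ => [|i y x _ <-]; last by rewrite compmDr.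
by rewrite -(scale0r (0 : hom X Y)) compmZr scale0r.
Qed.

Lemma compmN (X Y Z : C) (f : hom Y Z) (g : hom X Y) : f \oc (- g) = - (f \oc g).
Proof. by rewrite -scaleN1r compmZr scaleN1r. Qed.

Lemma compNm (X Y Z : C) (f : hom Y Z) (g : hom X Y) : (- f) \oc g = - (f \oc g).
Proof. by rewrite -scaleN1r compmZl scaleN1r. Qed.

Lemma compmBr (X Y Z : C) (f : hom Y Z) (g h : hom X Y) :
  f \oc (g - h) = f \oc g - f \oc h.
Proof. by rewrite compmDr compmN. Qed.

Lemma compmBl (X Y Z : C) (f g : hom Y Z) (h : hom X Y) :
  (f - g) \oc h = f \oc h - g \oc h.
Proof. by rewrite compmDl compNm. Qed.

End Composition.

(** * Evaluations and coevaluations beside a spectator strand *)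

Section NestedDuals.
Variables (k : fieldType) (C : moncat k).
Local Notation one := (unit_obj C).
Implicit Types X Y Z W A B : C.

Lemma interchange X Y W W' (f : hom X Y) (g : hom W W') :
  (f <| W') \oc (X |> g) = (Y |> g) \oc (f <| W).
Proof. by rewrite -!tensmM !compm1 !comp1m. Qed.

Lemma tensmE X Y W W' (f : hom X Y) (g : hom W W') :
  f \om g = (f <| W') \oc (X |> g).
Proof. by rewrite -!tensmM !compm1 !comp1m. Qed.

Lemma tensm_faithful X Y (f g : hom X Y) :
  (forall W, f <| W = g <| W) -> f = g.
Proof.
move=> e; rewrite -[f]compm1 -[g]compm1 -(runitiK X) !compmA -!runit_nat.
by rewrite e.
Qed.

Lemma to_unit_faithful X (f g : hom X one) :
  (forall W, lunit W \oc (f <| W) = lunit W \oc (g <| W)) -> f = g.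
Proof.
move=> e; apply: tensm_faithful => W; rewrite -[LHS]comp1m -[RHS]comp1m.
by rewrite -(lunitK W) -!compmA e.
Qed.

Lemma tensm_suml I (r : seq I) P X Y X' Y' (F : I -> hom X Y) (g : hom X' Y') :
  (\sum_(i <- r | P i) F i) \om g = \sum_(i <- r | P i) (F i \om g).
Proof.
elim/big_rec2: _ => [|i y x _ <-]; [exact: tensm0l | by rewrite tensmDl].
Qed.

Lemma tensm_sumr I (r : seq I) P X Y X' Y' (F : I -> hom X Y) (g : hom X' Y') :
  g \om (\sum_(i <- r | P i) F i) = \sum_(i <- r | P i) (g \om F i).
Proof.
elim/big_rec2: _ => [|i y x _ <-]; [exact: tensm0r | by rewrite tensmDr].
Qed.

(* Diagrams are locked: rewriting with the associativity of composition would
   otherwise unfold them. *)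
Definition evn X (D : dual_data X) W : hom ((D : C) \ot X \ot W) W :=
  locked (lunit W \oc (dual_ev D <| W) \oc associ D X W).
Definition cvn X (D : dual_data X) W : hom W (X \ot (D : C) \ot W) :=
  locked (assoc X D W \oc (dual_coev D <| W) \oc luniti W).

Lemma evnE X (D : dual_data X) W :
  evn D W = lunit W \oc (dual_ev D <| W) \oc associ D X W.
Proof. by rewrite /evn -lock. Qed.

Lemma cvnE X (D : dual_data X) W :
  cvn D W = assoc X D W \oc (dual_coev D <| W) \oc luniti W.
Proof. by rewrite /cvn -lock. Qed.

Lemma evn_nat X (D : dual_data X) W W' (f : hom W W') :
  evn D W' \oc ((D : C) |> X |> f) = f \oc evn D W.
Proof.
rewrite !evnE -compmA associ_nat !compmA tensm1 (comp_rw2 _ (interchange _ _)).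
by rewrite lunit_nat.
Qed.

Lemma cvn_nat X (D : dual_data X) W W' (f : hom W W') :
  cvn D W' \oc f = (X |> (D : C) |> f) \oc cvn D W.
Proof.
rewrite !cvnE !compmA -assoc_nat tensm1 -compmA luniti_nat !compmA.
by rewrite (comp_rw2 _ (interchange _ _)).
Qed.

Lemma evn_cvn_dual X (D : dual_data X) W : is_left_dual D ->
  evn D ((D : C) \ox W) \oc ((D : C) |> cvn D W) = idm ((D : C) \ox W).
Proof.
case=> _ zz; rewrite cvnE evnE !tensm_idl !compmA.
rewrite -(compmA _ (associ _ _ _)) -pentagoni1 !compmA.
rewrite -(compmA _ (associ D _ W)) associ_nat !compmA.
rewrite -(compmA _ (associ D one W)) trianglei2 -(tensm1 D W).
rewrite -(compmA (lunit _)) -assoc_nat !compmA lunit_tens -!tensm_idr.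
by rewrite zz tensm1.
Qed.

Lemma evn_cvn X (D : dual_data X) W : is_left_dual D ->
  (X |> evn D W) \oc cvn D (X \ox W) = idm (X \ox W).
Proof.
case=> zz _; rewrite cvnE evnE !tensm_idl -luniti_tens !compmA.
rewrite -(compmA _ (_ \om idm (X \ox W))) -(tensm1 X W) -assoc_nat !compmA.
rewrite -2!(compmA (idm X \om lunit W \oc _)) pentagon3 !compmA.
rewrite -(compmA (idm X \om lunit W)) -assoc_nat !compmA triangle -!tensm_idr.
by rewrite zz !tensm1.
Qed.

(** Together with [cvn_assoc] this makes the nested duality maps morphisms of module functors. *)
Lemma evn_assoc X (D : dual_data X) A W :
  evn D (A \ox W) \oc ((D : C) |> assoc X A W) \oc assoc D (X \ox A) W
  = evn D A <| W.
Proof.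
rewrite !evnE !tensm_idr -lunit_tens.
have e : associ D X (A \ox W) \oc ((D : C) |> assoc X A W) \oc assoc D (X \ox A) W
   = assoc (D \ox X) A W \oc (associ D X A <| W).
  rewrite -pentagoni1 -!compmA assocK compm1; congr (_ \oc _).
rewrite -!compmA (compmA (associ _ _ _)) e !compmA.
rewrite -(compmA _ (assoc one A W)) assoc_nat tensm1.
by rewrite !compmA.
Qed.

Lemma cvn_assoc X (D : dual_data X) A W :
  (X |> assoc D A W) \oc assoc X (D \ox A) W \oc (cvn D A <| W)
  = cvn D (A \ox W).
Proof.
rewrite !cvnE !tensm_idr -luniti_tens !compmA -pentagon -!compmA; congr (_ \oc _).
by rewrite !compmA assoc_nat tensm1.
Qed.

Lemma transpose_evn X Y (DX : dual_data X) (DY : dual_data Y) (f : hom X Y) :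
  transpose DX DY f = evn DY DX \oc ((DY : C) |> f <| DX)
    \oc ((DY : C) |> dual_coev DX) \oc runiti DY.
Proof. by rewrite ?evnE ?cvnE. Qed.

Lemma dual_ev_tens X Y (DX : dual_data X) (DY : dual_data Y) :
  dual_ev (dual_tens DX DY) = dual_ev DY \oc ((DY : C) |> evn DX Y)
   \oc assoc DY DX (X \ox Y).
Proof. by rewrite ?evnE ?cvnE. Qed.

Lemma dual_coev_tens X Y (DX : dual_data X) (DY : dual_data Y) :
  dual_coev (dual_tens DX DY) = associ X Y (DY \ox DX) \oc (X |> cvn DY DX)
   \oc dual_coev DX.
Proof. by rewrite ?evnE ?cvnE. Qed.

Lemma transposeE X Y (DX : dual_data X) (DY : dual_data Y) (f : hom X Y) W :
  transpose DX DY f <| W =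
  evn DY ((DX : C) \ox W) \oc ((DY : C) |> (f <| (DX \ox W)))
    \oc ((DY : C) |> cvn DX W).
Proof.
rewrite transpose_evn !tensm_idr -evn_assoc.
rewrite !(comp_rw2 _ (assoc_nat _ _ _)) -trianglei2 !compmA.
rewrite (comp_rw1 _ (associK _ _ _)) compm1 cvnE !tensm_idl !compmA.
congr (_ \oc _ \oc _).
rewrite -!(compmA (evn _ _)); congr (_ \oc _).
by rewrite -!tensm_idl assoc_nat tensm1.
Qed.

Lemma evn_transpose X Y (DX : dual_data X) (DY : dual_data Y) (f : hom X Y) W :
  is_left_dual DX ->
  evn DX W \oc (transpose DX DY f <| (X \ox W)) = evn DY W \oc ((DY : C) |> f <| W).
Proof.
move=> dX; rewrite transposeE !compmA -evn_nat -!(compmA (evn _ _)).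
rewrite -!tensm_idl -compmA; congr (_ \oc (_ |> _)).
by rewrite compmA -interchange -compmA evn_cvn // compm1.
Qed.

Lemma transpose_cvn X Y (DX : dual_data X) (DY : dual_data Y) (f : hom X Y) W :
  is_left_dual DY ->
  (Y |> transpose DX DY f <| W) \oc cvn DY W = (f <| (DX \ox W)) \oc cvn DX W.
Proof.
move=> dY; rewrite transposeE -(compmA (evn _ _)) -tensm_idl tensm_idl.
by rewrite -compmA -cvn_nat !compmA evn_cvn // comp1m.
Qed.

(** The cap of a tensor product consists of two nested caps, that of X inside that of Y. *)
Lemma evn_dual_tens X Y (DX : dual_data X) (DY : dual_data Y) W :
  evn (dual_tens DX DY) W = evn DY W \oc ((DY : C) |> evn DX (Y \ox W))
    \oc assoc DY DX (X \ot Y \ot W) \oc ((DY \ox DX : C) |> assoc X Y W).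
Proof.
have e : evn DX (Y \ox W) \oc ((DX : C) |> assoc X Y W)
   = (evn DX Y <| W) \oc associ DX (X \ox Y) W.
  by rewrite -evn_assoc -compmA associK compm1.
rewrite -(tensm1 DY DX) -compmA assoc_nat !compmA (comp_rw1 _ (esym (tensm_idl _ _ _))).
rewrite e tensm_idl !compmA (evnE DY) evnE dual_ev_tens.
rewrite !tensm_idr !compmA (comp_rw2 _ (associ_nat _ _ _)).
rewrite -!compmA; congr (_ \oc (_ \oc (_ \oc _))).
rewrite !compmA -pentagoni2 -!compmA assocK compm1 //.
Qed.

Lemma cvn_dual_tens X Y (DX : dual_data X) (DY : dual_data Y) W :
  assoc X Y (DY \ot DX \ot W) \oc ((X \ox Y) |> assoc DY DX W)
    \oc cvn (dual_tens DX DY) W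
  = (X |> cvn DY (DX \ox W)) \oc cvn DX W.
Proof.
rewrite -(tensm1 X Y) assoc_nat.
have -> : cvn (dual_tens DX DY) W = assoc (X \ox Y) (DY \ox DX) W
   \oc (associ X Y (DY \ox DX) <| W) \oc ((X |> cvn DY DX) <| W)
   \oc (dual_coev DX <| W) \oc luniti W.
  by rewrite cvnE dual_coev_tens !tensm_idr !compmA.
rewrite !compmA (comp_rw1 _ (pentagon _ _ _ _)) !compmA.
rewrite (comp_rw1 _ (esym (tensm_idr _ (assoc _ _ _) _))) associK tensm1 compm1.
rewrite (comp_rw2 _ (assoc_nat _ _ _)) -!tensm_idl cvn_assoc.
by rewrite (cvnE DX) !compmA.
Qed.

End NestedDuals.

Section ModuleFunctors.
Variables (k : fieldType) (C : moncat k).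
Local Notation one := (unit_obj C).
Implicit Types X Y Z W A B : C.

(* Associators are avoided by writing a string diagram as a family of morphisms
   between objects X \ox (Y \ox (... \ox W)), natural in W and compatible with
   tensoring on the right: a morphism of module functors, where a word
   X, Y, ... is the functor [mcons X (mcons Y ... mone)]. *)
Record mfun := MFun {
  mobj :> C -> C;
  mmap : forall W W', hom W W' -> hom (mobj W) (mobj W');
  mstr : forall A W, hom (mobj A \ox W) (mobj (A \ox W));
  mstri : forall A W, hom (mobj (A \ox W)) (mobj A \ox W);
  mmap1 : forall W, mmap (idm W) = idm (mobj W);
  mmapM : forall W W' W'' (f : hom W' W'') (g : hom W W'),
    mmap (f \oc g) = mmap f \oc mmap g;
  mmapD : forall W W' (f g : hom W W'), mmap (f + g) = mmap f + mmap g;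
  mmapZ : forall W W' a (f : hom W W'), mmap (a *: f) = a *: mmap f;
  mstr_nat : forall A A' W W' (f : hom A A') (g : hom W W'),
    mmap (f \om g) \oc mstr A W = mstr A' W' \oc (mmap f \om g);
  mstrK : forall A W, mstri A W \oc mstr A W = idm _;
  mstriK : forall A W, mstr A W \oc mstri A W = idm _
}.

Definition mone : mfun.
Proof.
apply: (@MFun (fun W => W) (fun W W' f => f) (fun A W => idm _) (fun A W => idm _)) => //.
- by move=> *; rewrite compm1 comp1m.
- by move=> *; rewrite compm1.
- by move=> *; rewrite compm1.
Defined.

Definition mcons X (F : mfun) : mfun.
Proof.
apply: (@MFun (fun W => X \ox F W) (fun W W' f => X |> mmap F f)
  (fun A W => (X |> mstr F A W) \oc assoc X (F A) W)
  (fun A W => associ X (F A) W \oc (X |> mstri F A W))).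
- by move=> W; rewrite mmap1 tensm1.
- by move=> *; rewrite mmapM tensm_idl.
- by move=> *; rewrite mmapD tensmDr.
- by move=> *; rewrite mmapZ tensmZr.
- by move=> *; rewrite !compmA -tensm_idl mstr_nat tensm_idl -!compmA assoc_nat.
- move=> *; rewrite !compmA (comp_rw1 _ (esym (tensm_idl _ _ _))) mstrK tensm1.
  by rewrite compm1 assocK.
- move=> *; rewrite !compmA (comp_rw1 _ (associK _ _ _)) compm1.
  by rewrite -tensm_idl mstriK tensm1.
Defined.

Implicit Types F G H : mfun.

Definition modular (F G : mfun) (phi : forall W, hom (F W) (G W)) : Prop :=
  (forall W W' (f : hom W W'), phi W' \oc mmap F f = mmap G f \oc phi W) /\
  (forall A W, phi (A \ox W) \oc mstr F A W = mstr G A W \oc (phi A <| W)).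

Lemma modular_comp F G H (phi : forall W, hom (F W) (G W))
    (psi : forall W, hom (G W) (H W)) :
  modular phi -> modular psi -> @modular F H (fun W => psi W \oc phi W).
Proof.
move=> [pn pm] [qn qm]; split=> *; rewrite -compmA ?pn ?pm !compmA ?qn ?qm //.
by rewrite -!compmA tensm_idr.
Qed.

Lemma modular_cons X F G (phi : forall W, hom (F W) (G W)) :
  modular phi -> @modular (mcons X F) (mcons X G) (fun W => X |> phi W).
Proof.
move=> [pn pm]; split=> * /=; first by rewrite -!tensm_idl pn.
by rewrite compmA -tensm_idl pm tensm_idl -!compmA assoc_nat.
Qed.

Lemma modular_act X Y F (f : hom X Y) :
  @modular (mcons X F) (mcons Y F) (fun W => f <| F W).
Proof.
split=> * /=; first by rewrite interchange.
by rewrite compmA interchange -!compmA assoc_nat tensm1.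
Qed.

Lemma modular_ev X (D : dual_data X) F :
  @modular (mcons D (mcons X F)) F (fun W => evn D (F W)).
Proof.
split=> * /=; first by rewrite evn_nat.
by rewrite tensm_idl !compmA evn_nat -evn_assoc !compmA.
Qed.

Lemma modular_cv X (D : dual_data X) F :
  @modular F (mcons X (mcons D F)) (fun W => cvn D (F W)).
Proof.
split=> * /=; first by rewrite cvn_nat.
by rewrite tensm_idl -!compmA (compmA (X |> assoc _ _ _)) cvn_assoc cvn_nat.
Qed.

Lemma modular_split X Y F :
  @modular (mcons (X \ox Y) F) (mcons X (mcons Y F)) (fun W => assoc X Y (F W)).
Proof.
split=> * /=; first by rewrite -(tensm1 X) assoc_nat.
rewrite !compmA -(tensm1 X) assoc_nat !tensm_idl -!compmA pentagon.
by rewrite !compmA.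
Qed.

Lemma modular_inv F G (phi : forall W, hom (F W) (G W))
    (psi : forall W, hom (G W) (F W)) :
  (forall W, psi W \oc phi W = idm _) -> (forall W, phi W \oc psi W = idm _) ->
  modular phi -> @modular G F psi.
Proof.
move=> K1 K2 [pn pm]; split=> [W W' f|A W].
  rewrite -[LHS]compm1 -(K2 W) !compmA -(compmA _ _ (phi W)) -pn.
  by rewrite compmA K1 comp1m.
rewrite -[LHS]compm1 -(tensm1 (G A) W) -(K2 A) tensm_idr !compmA.
rewrite -(compmA _ _ (phi A <| W)) -pm.
by rewrite compmA K1 comp1m.
Qed.

Lemma modular_merge X Y F :
  @modular (mcons X (mcons Y F)) (mcons (X \ox Y) F) (fun W => associ X Y (F W)).
Proof.
apply: modular_inv (modular_split X Y F) => W; rewrite ?assocK ?associK //.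
Qed.

Lemma mmap0 (F : mfun) W W' : mmap F (0 : hom W W') = 0.
Proof. by rewrite -(scale0r (0 : hom W W')) mmapZ scale0r. Qed.

Lemma mmap_sum (F : mfun) I (r : seq I) P W W' (f : I -> hom W W') :
  mmap F (\sum_(i <- r | P i) f i) = \sum_(i <- r | P i) mmap F (f i).
Proof.
elim/big_rec2: _ => [|i y x _ <-]; [exact: mmap0 | by rewrite mmapD].
Qed.

Lemma modular_sum F G I (r : seq I) P (phi : I -> forall W, hom (F W) (G W)) :
  (forall i, modular (phi i)) ->
  @modular F G (fun W => \sum_(i <- r | P i) phi i W).
Proof.
move=> m; split=> *; rewrite ?tensm_suml compm_suml compm_sumr;
 by apply: eq_bigr => i _; have [e1 e2] := m i; rewrite ?e1 ?e2.
Qed.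

Lemma modular_scale F G a (phi : forall W, hom (F W) (G W)) :
  modular phi -> @modular F G (fun W => a *: phi W).
Proof.
by move=> [pn pm]; split=> *; rewrite ?tensmZl compmZl compmZr ?pn ?pm.
Qed.

Lemma modular_eq F G (phi : forall W, hom (F W) (G W))
    (psi : forall W, hom (F W) (G W)) :
  (forall W, psi W = phi W) -> modular phi -> modular psi.
Proof. by move=> e [pn pm]; split=> *; rewrite !e. Qed.

(** Writing W as [one \ox W] lets modularity pull W out of phi, so phi is determined by its
    component at [one]. The lemmas [mor11E] to [mor21E] are instances. *)
Lemma modularE F G (phi : forall W, hom (F W) (G W)) W : modular phi ->
  phi W \oc (mmap F (lunit W) \oc mstr F one W)
  = mmap G (lunit W) \oc mstr G one W \oc (phi one <| W).
Proof. by move=> [pn pm]; rewrite compmA pn -compmA pm compmA. Qed.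

Lemma mstr_one1 X W : mmap (mcons X mone) (lunit W) \oc mstr (mcons X mone) one W
  = runit X <| W.
Proof. by rewrite /= tensm1 comp1m triangle. Qed.

Lemma mstr_one2 X Y W :
  mmap (mcons X (mcons Y mone)) (lunit W) \oc mstr (mcons X (mcons Y mone)) one W
  = assoc X Y W \oc ((X |> runit Y) <| W).
Proof.
by rewrite /= tensm1 comp1m compmA -tensm_idl triangle assoc_nat.
Qed.

Lemma mstr_one0 W : mmap mone (lunit W) \oc mstr mone one W = lunit W.
Proof. by rewrite /= compm1. Qed.

(* A modular family between words in the functors X \ox - comes from a
   morphism between the corresponding tensor products. *)
Definition mor11 X Y (phi : forall W, hom (X \ox W) (Y \ox W)) : hom X Y :=
  locked (runit Y \oc phi one \oc runiti X).

Lemma mor11E X Y phi : @modular (mcons X mone) (mcons Y mone) phi ->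
  forall W, phi W = mor11 phi <| W.
Proof.
move=> m W; have := modularE W m; rewrite !mstr_one1 => e.
rewrite /mor11 -lock !tensm_idr -e (comp_rw1 _ (esym (tensm_idr _ _ _))) runitiK tensm1 compm1 //.
Qed.

Definition mor10 X (phi : forall W, hom (X \ox W) W) : hom X one :=
  locked (phi one \oc runiti X).

Lemma mor10E X phi : @modular (mcons X mone) mone phi ->
  forall W, phi W = lunit W \oc (mor10 phi <| W).
Proof.
move=> m W; have := modularE W m; rewrite mstr_one0 mstr_one1 => e.
rewrite /mor10 -lock !tensm_idr compmA -e (comp_rw1 _ (esym (tensm_idr _ _ _))).
by rewrite runitiK tensm1 compm1.
Qed.

Definition mor22 X Y X' Y' (phi : forall W, hom (X \ot Y \ot W) (X' \ot Y' \ot W)) :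
   hom (X \ox Y) (X' \ox Y') :=
  locked ((X' |> runit Y') \oc phi one \oc (X |> runiti Y)).

Lemma mor22E X Y X' Y' phi :
  @modular (mcons X (mcons Y mone)) (mcons X' (mcons Y' mone)) phi ->
  forall W, phi W \oc assoc X Y W = assoc X' Y' W \oc (mor22 phi <| W).
Proof.
move=> m W; have := modularE W m; rewrite !mstr_one2 => e.
rewrite /mor22 -lock !tensm_idr !compmA -e !compmA (comp_rw1 _ (esym (tensm_idr _ _ _))).
by rewrite -tensm_idl runitiK !tensm1 compm1.
Qed.

Definition mor21 X Y Z (phi : forall W, hom (X \ot Y \ot W) (Z \ox W)) :
   hom (X \ox Y) Z :=
  locked (runit Z \oc phi one \oc (X |> runiti Y)).

Lemma mor21E X Y Z phi :
  @modular (mcons X (mcons Y mone)) (mcons Z mone) phi ->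
  forall W, phi W \oc assoc X Y W = mor21 phi <| W.
Proof.
move=> m W; have := modularE W m; rewrite mstr_one1 mstr_one2 => e.
rewrite /mor21 -lock !tensm_idr -e !compmA (comp_rw1 _ (esym (tensm_idr _ _ _))).
by rewrite -tensm_idl runitiK !tensm1 compm1.
Qed.

End ModuleFunctors.

(** * Pivotal duality *)

Section RigidNested.
Variables (k : fieldType) (C : rigidcat k).
Local Notation one := (unit_obj C).
Implicit Types X Y Z W A B : C.

Definition ev X W : hom (star X \ot X \ot W) W := evn (ldual X) W.
Definition cv X W : hom W (X \ot star X \ot W) := cvn (ldual X) W.

Lemma ev_nat X W W' (f : hom W W') :
  ev X W' \oc (star X |> X |> f) = f \oc ev X W.
Proof. exact: evn_nat. Qed.

Lemma cv_nat X W W' (f : hom W W') :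
  cv X W' \oc f = (X |> star X |> f) \oc cv X W.
Proof. exact: cvn_nat. Qed.

Lemma ev_cv X W : (X |> ev X W) \oc cv X (X \ox W) = idm (X \ox W).
Proof. exact/evn_cvn/ldualP. Qed.

Lemma ev_cv_star X W :
  ev X (star X \ox W) \oc (star X |> cv X W) = idm (star X \ox W).
Proof. exact/evn_cvn_dual/ldualP. Qed.

Lemma ev_starm X Y (f : hom X Y) W :
  ev X W \oc (starm f <| (X \ox W)) = ev Y W \oc (star Y |> f <| W).
Proof. exact/evn_transpose/ldualP. Qed.

Lemma modular_evs X (F : mfun C) :
  @modular k C (mcons (star X) (mcons X F)) F (fun W => ev X (F W)).
Proof. exact: modular_ev. Qed.

Lemma modular_cvs X (F : mfun C) :
  @modular k C F (mcons X (mcons (star X) F)) (fun W => cv X (F W)).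
Proof. exact: modular_cv. Qed.

(* The comparison of the duals (X \ox Y)^* -> Y^* \ox X^*. *)
Definition delta X Y W : hom (star (X \ox Y) \ox W) (star Y \ot star X \ot W) :=
  locked (ev (X \ox Y) (star Y \ot star X \ot W)
    \oc (star (X \ox Y) |> (associ X Y (star Y \ot star X \ot W)
       \oc (X |> cv Y (star X \ox W)) \oc cv X W))).

Lemma deltaE X Y W : delta X Y W = ev (X \ox Y) (star Y \ot star X \ot W)
    \oc (star (X \ox Y) |> (associ X Y (star Y \ot star X \ot W)
       \oc (X |> cv Y (star X \ox W)) \oc cv X W)).
Proof. by rewrite /delta -lock. Qed.

Lemma cv_tens X Y W :
  assoc X Y (star Y \ot star X \ot W) \oc ((X \ox Y) |> delta X Y W) \oc cv (X \ox Y) W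
  = (X |> cv Y (star X \ox W)) \oc cv X W.
Proof.
rewrite deltaE tensm_idl -!compmA -cv_nat (compmA _ (cv _ _)) ev_cv comp1m.
by rewrite !compmA associK comp1m.
Qed.

Let delta_mor X Y : hom (star (X \ox Y)) (star Y \ox star X) :=
  transpose (dual_tens (ldual X) (ldual Y)) (ldual (X \ox Y)) (idm (X \ox Y)).

(** The monoidal structure of the double dual is given by [transpose]; identifying its comparison
    with [delta] turns [piv_tens] into a statement about nested diagrams. *)
Let delta_morE X Y W :
  assoc (star Y) (star X) W \oc (delta_mor X Y <| W) = delta X Y W.
Proof.
rewrite /delta_mor (transposeE (dual_tens _ _)) tensm1 tensm1 compm1 compmA -evn_nat deltaE -compmA.
rewrite -tensm_idl; congr (_ \oc (_ |> _)).
rewrite -[LHS]comp1m -assocK -!compmA; congr (_ \oc _).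
by rewrite !compmA cvn_dual_tens.
Qed.

Variable p : pivotal_structure C.

Definition pivi X : hom (dstar X) X := projT1 (cid (piv_iso p X)).

Lemma pivK X : pivi X \oc piv p X = idm X.
Proof. by rewrite /pivi; case: cid => ? []. Qed.

Lemma piviK X : piv p X \oc pivi X = idm _.
Proof. by rewrite /pivi; case: cid => ? []. Qed.

(** Through the identification of X with its double dual, [er] and [cr] make [star X] a dual of X on
    the other side as well. *)
Definition er X W : hom (X \ot star X \ot W) W :=
  locked (ev (star X) W \oc (piv p X <| (star X \ox W))).

Definition cr X W : hom W (star X \ot X \ot W) :=
  locked ((star X |> pivi X <| W) \oc cv (star X) W).

Lemma erE X W : er X W = ev (star X) W \oc (piv p X <| (star X \ox W)).
Proof. by rewrite /er -lock. Qed.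

Lemma crE X W : cr X W = (star X |> pivi X <| W) \oc cv (star X) W.
Proof. by rewrite /cr -lock. Qed.

Lemma er_nat X W W' (f : hom W W') :
  er X W' \oc (X |> star X |> f) = f \oc er X W.
Proof. by rewrite !erE -compmA interchange compmA ev_nat compmA. Qed.

Lemma cr_nat X W W' (f : hom W W') :
  cr X W' \oc f = (star X |> X |> f) \oc cr X W.
Proof. by rewrite !crE -compmA cv_nat !compmA -!tensm_idl interchange. Qed.

Lemma er_cr X W : er X (X \ox W) \oc (X |> cr X W) = idm (X \ox W).
Proof.
rewrite crE erE tensm_idl -!compmA (compmA (piv _ _ <| _)) interchange -compmA.
rewrite interchange !compmA ev_nat -(compmA _ (ev _ _)) ev_cv_star compm1.
by rewrite -tensm_idr pivK tensm1.
Qed.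

Lemma er_cr_star X W :
  (star X |> er X W) \oc cr X (star X \ox W) = idm (star X \ox W).
Proof.
rewrite crE erE tensm_idl -!compmA (compmA (_ |> piv _ _ <| _)) -tensm_idl.
by rewrite -tensm_idr piviK !tensm1 comp1m ev_cv.
Qed.

Lemma modular_er X (F : mfun C) :
  @modular k C (mcons X (mcons (star X) F)) F (fun W => er X (F W)).
Proof.
apply: (@modular_eq _ _ (mcons X (mcons (star X) F)) F _ _ (fun W => erE X (F W))).
exact: modular_comp (modular_act _ _) (modular_evs _ _).
Qed.

Lemma modular_cr X (F : mfun C) :
  @modular k C F (mcons (star X) (mcons X F)) (fun W => cr X (F W)).
Proof.
apply: (@modular_eq _ _ F (mcons (star X) (mcons X F)) _ _ (fun W => crE X (F W))).
exact: modular_comp (modular_cvs _ _) (modular_cons _ (modular_act _ _)).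
Qed.

Lemma er_starm X Y (f : hom X Y) W :
  er X W \oc (X |> starm f <| W) = er Y W \oc (f <| (star Y \ox W)).
Proof.
rewrite !erE -compmA interchange compmA -ev_starm -!compmA -!tensm_idr.
by rewrite piv_nat.
Qed.

(** Monoidality of the pivotal structure enters here: with [cv_tens] it opens a loop coloured by
    [X \ox Y] into two nested loops. *)
Lemma er_tens X Y W : er (X \ox Y) W =
  er X W \oc (X |> er Y (star X \ox W)) \oc assoc X Y (star Y \ot star X \ot W)
    \oc ((X \ox Y) |> delta X Y W).
Proof.
rewrite erE piv_tens /dstar_tens.
rewrite -/(delta_mor X Y).
(* Both factors of [dstar_tens] matter only through their effect under an evaluation: [epE] replaces
   it by nested evaluations, and [stE] carries [delta_mor] over to the other strand. *)
set ep := transpose _ _ (idm (star Y \ox star X)).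
have epE : ev (star Y \ox star X) W \oc (ep <| ((star Y \ox star X) \ox W))
    = evn (dual_tens (ldual (star Y)) (ldual (star X))) W.
  by rewrite [LHS]evn_transpose ?tensm1 ?compm1 //; exact: ldualP.
move: ep epE => ep epE.
move: (starm _) (@ev_starm _ _ (delta_mor X Y) W) => st stE.
rewrite !tensm_idr !compmA stE.
rewrite (comp_rw2 _ (esym (interchange _ _))).
rewrite epE evn_dual_tens.
rewrite -[LHS]/(ev (star X) W \oc (dstar X |> ev (star Y) (star X \ox W))
  \oc assoc (dstar X) (dstar Y) (star Y \ot star X \ot W)
  \oc ((dstar X \ox dstar Y) |> assoc (star Y) (star X) W)
  \oc ((dstar X \ox dstar Y) |> delta_mor X Y <| W)
  \oc ((piv p X \om piv p Y) <| (star (X \ox Y) \ox W))).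
rewrite (comp_rw1 _ (esym (tensm_idl _ (assoc _ _ _) _))) delta_morE.
rewrite (comp_rw2 _ (esym (interchange _ _))).
rewrite (comp_rw2 _ (assoc_nat _ _ _)) !erE; congr (_ \oc _ \oc _).
rewrite tensm_idl !compmA (comp_rw2 _ (interchange _ _)).
rewrite -!compmA (tensmE (piv p X) (piv p Y <| _)) (compmA (_ |> ev _ _)).
by rewrite -interchange !compmA.
Qed.

Lemma er_cv_one W : er one W \oc cv one W = idm W.
Proof.
rewrite erE piv_unit /dstar_unit.
set eta := transpose (dual_unit C) _ _; set zeta := transpose _ (dual_unit C) _.
have etaE : (one |> eta <| W) \oc cv one W = cvn (dual_unit C) W.
  rewrite [LHS]transpose_cvn ?tensm1 ?comp1m //; exact: ldualP.
have zetaE : ev one W \oc (zeta <| (one \ox W)) = evn (dual_unit C) W.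
  rewrite [LHS]evn_transpose ?tensm1 ?compm1 //; exact: ldualP.
move: (starm eta) (@ev_starm _ _ eta W) => st stE.
rewrite -/eta in st stE *; move: eta zeta etaE zetaE stE => eta zeta etaE zetaE stE.
rewrite tensm_idr compmA stE -!compmA (compmA (_ |> _)) -interchange -!compmA etaE.
rewrite compmA zetaE evnE cvnE !compmA (comp_rw1 _ (assocK _ _ _)) compm1.
rewrite (comp_rw1 _ (esym (tensm_idr _ _ _))) lunitiK tensm1 compm1.
exact: lunitiK.
Qed.

Lemma er_cv X W : er X W \oc cv X W =
  lunit W \oc ((dual_ev (ldual (star X)) \oc (piv p X <| star X)
     \oc dual_coev (ldual X)) <| W) \oc luniti W.
Proof.
rewrite erE /ev /cv evnE cvnE !compmA !tensm_idr -(tensm1 (star X)) !compmA.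
rewrite (comp_rw2 _ (associ_nat _ _ _)).
by rewrite (comp_rw1 _ (assocK _ _ _)) compm1.
Qed.

Let one_star W : hom W (star one \ox W) := lunit _ \oc cv one W.

Let one_star_nat W W' (f : hom W W') :
  one_star W' \oc f = (star one |> f) \oc one_star W.
Proof. by rewrite /one_star -!compmA cv_nat !compmA lunit_nat. Qed.

Let ev_one_star W : ev one W \oc one_star (one \ox W) = lunit W.
Proof. by rewrite /one_star compmA -lunit_nat -compmA ev_cv compm1. Qed.

Let er_one_star W : er one W \oc (one |> one_star W) = lunit W.
Proof.
rewrite /one_star tensm_idl.
have -> : one |> lunit (star one \ox W) = lunit (one \ox (star one \ox W)).
  rewrite -[LHS]comp1m -[RHS]comp1m -(lunitK (star one \ox W)) -!compmA.
  by rewrite lunit_nat.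
by rewrite compmA -lunit_nat -compmA -tensm_idl er_cv_one tensm1 compm1.
Qed.

(** The pivotal isomorphism of [star X] is forced by that of X: dinaturality of [er] is applied to
    the evaluation, as a morphism from [star X \ox X] to the unit, and [er_tens] expands the
    loop. *)
Lemma er_star X W : er (star X) W \oc (star X |> piv p X <| W) = ev X W.
Proof.
suff e : er (star X) W \oc (star X |> piv p X <| W) \oc assoc (star X) X W
    = ev X W \oc assoc (star X) X W.
  by rewrite -[LHS]compm1 -(associK (star X) X W) compmA e -compmA associK compm1.
have := er_starm (dual_ev (ldual X)) W.
move/(congr1 (fun f => f \oc ((star X \ox X) |> one_star W))).
rewrite -[in RHS]compmA interchange !compmA er_one_star.
rewrite [X in _ = X -> _](_ : _ = ev X W \oc assoc (star X) X W); last first.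
  by rewrite /ev evnE -!compmA assocK compm1.
move=> <-; rewrite er_tens -!compmA -!tensm_idl.
(* Up to [delta] and [one_star], the transpose of the evaluation of X is the coevaluation of
   [star X]. *)
have -> : delta (star X) X W \oc ((starm (dual_ev (ldual X)) <| W) \oc one_star W)
    = cv (star X) W.
  rewrite deltaE -!compmA (compmA (_ |> _) (_ <| _)) -interchange !compmA ev_starm.
  rewrite -(compmA (ev _ _)) -tensm_idl !compmA.
  have -> : (dual_ev (ldual X) <| (star X \ot star (star X) \ot W))
      \oc associ (star X) X (star X \ot star (star X) \ot W)
    = luniti _ \oc ev X _.
    by rewrite /ev evnE !compmA lunitK comp1m.
  rewrite -(compmA (luniti _)) ev_cv_star compm1 -!compmA -/(one_star W).
  rewrite -one_star_nat (compmA (ev one _) (one_star _)) ev_one_star compmA.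
  by rewrite lunitiK comp1m.
rewrite -[RHS]/(er (star X) W \oc ((star X |> er X (star (star X) \ox W))
  \oc (assoc (star X) X (star X \ot star (star X) \ot W)
  \oc ((star X \ox X) |> cv (star X) W)))).
rewrite -(tensm1 (star X) X) assoc_nat; congr (_ \oc _); rewrite compmA.
rewrite -tensm_idl; congr ((_ |> _) \oc _).
rewrite erE -compmA interchange compmA ev_cv_star comp1m //.
Qed.

End RigidNested.

(** * Mates and the Casimir slide *)

Section Mates.
Variables (k : fieldType) (C : rigidcat k).
Implicit Types (X Y Z W A B V : C) (F G : mfun C).

Lemma mstri_nat F A A' W W' (f : hom A A') (g : hom W W') :
  mstri F A' W' \oc mmap F (f \om g) = (mmap F f \om g) \oc mstri F A W.
Proof.
rewrite -[LHS]compm1 -(mstriK F A W) !compmA (comp_rw2 _ (mstr_nat _ _ _)).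
by rewrite mstrK comp1m.
Qed.

Lemma modular_mstri F G (phi : forall W, hom (F W) (G W)) A W : modular phi ->
  mstri G A W \oc phi (A \ox W) = (phi A <| W) \oc mstri F A W.
Proof.
move=> [_ e]; rewrite -[LHS]compm1 -(mstriK F A W) !compmA (comp_rw2 _ (e _ _)).
by rewrite mstrK comp1m.
Qed.

(** The mate of q under the dualities of X and V. For the empty word it is the transpose, see
    [sharp_starm]. *)
Definition sharp F X V (q : hom (F X) V) W : hom (star V \ot F W) (star X \ot W) :=
  locked (ev V (star X \ox W) \oc (star V |> ((q <| (star X \ox W))
    \oc mstri F X (star X \ox W) \oc mmap F (cv X W)))).

Lemma sharpE F X V (q : hom (F X) V) W : sharp q W =
  ev V (star X \ox W) \oc (star V |> ((q <| (star X \ox W))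
    \oc mstri F X (star X \ox W) \oc mmap F (cv X W))).
Proof. by rewrite /sharp -lock. Qed.

Lemma sharp_cv F X V (q : hom (F X) V) W :
  (V |> sharp q W) \oc cv V (F W)
  = (q <| (star X \ox W)) \oc mstri F X (star X \ox W) \oc mmap F (cv X W).
Proof. by rewrite sharpE tensm_idl -compmA -cv_nat compmA ev_cv comp1m. Qed.

Lemma ev_sharp F X V (q : hom (F X) V) W :
  ev X W \oc sharp q (X \ox W) = ev V W \oc (star V |> ((q <| W) \oc mstri F X W)).
Proof.
rewrite sharpE compmA -ev_nat -compmA -tensm_idl -!compmA.
rewrite (compmA (V |> _)) -interchange -compmA.
rewrite (compmA (F X |> _)) -[F X |> _]/(idm _ \om _) -(mmap1 F X) -mstri_nat.
by rewrite -compmA -mmapM ev_cv mmap1 compm1.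
Qed.

Lemma sharp_modular F G X V (phi : forall W, hom (F W) (G W)) (q : hom (G X) V) W :
  modular phi ->
  sharp q W \oc (star V |> phi W) = sharp (q \oc phi X) W.
Proof.
move=> m; have [pn _] := m; rewrite !sharpE -!compmA -!tensm_idl; congr (_ \oc (_ |> _)).
by rewrite -!compmA -pn (compmA (mstri _ _ _)) modular_mstri // !compmA tensm_idr.
Qed.

Lemma sharp_cons Y G X V V' (q : hom (Y \ox V') V) (q' : hom (G X) V') W :
  @sharp (mcons Y G) X V (q \oc (Y |> q')) W
  = sharp q' W \oc @sharp (mcons Y (mone C)) V' V q (G W).
Proof.
rewrite (@sharpE (mcons Y (mone C)) V' V q) (@sharpE (mcons Y G) X V) /= tensm1 compm1.
rewrite (compmA (sharp _ _)) -ev_nat -(compmA (ev _ _)) -tensm_idl; congr (_ \oc (_ |> _)).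
rewrite !compmA -interchange.
rewrite -(tensm1 Y V') (comp_rw2 _ (esym (associ_nat _ _ _))).
rewrite -[RHS]compmA -tensm_idl sharp_cv !tensm_idl !compmA.
by rewrite (comp_rw2 _ (associ_nat _ _ _)) !tensm_idr.
Qed.

Lemma sharpD F X V (q q' : hom (F X) V) W : sharp (q + q') W = sharp q W + sharp q' W.
Proof. by rewrite !sharpE tensmDl !compmDl tensmDr compmDr. Qed.

Lemma sharpZ F X V a (q : hom (F X) V) W : sharp (a *: q) W = a *: sharp q W.
Proof. by rewrite !sharpE tensmZl !compmZl tensmZr compmZr. Qed.

Lemma sharp0 F X V W : sharp (0 : hom (F X) V) W = 0.
Proof. by rewrite -(scale0r (0 : hom (F X) V)) sharpZ scale0r. Qed.

Lemma sharp_sum F X V I (r : seq I) P (q : I -> hom (F X) V) W :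
  sharp (\sum_(i <- r | P i) q i) W = \sum_(i <- r | P i) sharp (q i) W.
Proof.
elim/big_rec2: _ => [|i y x _ <-]; [exact: sharp0 | by rewrite sharpD].
Qed.

Lemma modular_sharp Y X V (q : hom (Y \ox X) V) (G : mfun C) :
  @modular k C (mcons (star V) (mcons Y G)) (mcons (star X) G)
    (fun W => @sharp (mcons Y (mone C)) X V q (G W)).
Proof.
pose phi W := ev V (star X \ox G W) \oc ((star V |> q <| (star X \ox G W))
    \oc ((star V |> associ Y X (star X \ox G W)) \oc (star V |> Y |> cv X (G W)))).
apply: (@modular_eq _ _ (mcons (star V) (mcons Y G)) (mcons (star X) G) phi) => [W|].
  by rewrite sharpE /= tensm1 compm1 /phi -!tensm_idl !compmA.
exact: (modular_comp (modular_comp (modular_comp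
  (modular_cons _ (modular_cons _ (modular_cvs X G)))
  (modular_cons _ (modular_merge Y X (mcons (star X) G))))
  (modular_cons _ (modular_act (mcons (star X) G) q))) (modular_evs V _)).
Qed.

Lemma sharp_starm X Y (f : hom X Y) W : starm f <| W = @sharp (mone C) X Y f W.
Proof. by rewrite sharpE /= compm1 [LHS]transposeE tensm_idl compmA. Qed.

Lemma sharp_comp X Y Z (f : hom X Y) (g : hom Y Z) W :
  @sharp (mone C) X Y f W \oc @sharp (mone C) Y Z g W
  = @sharp (mone C) X Z (g \oc f) W.
Proof.
rewrite (@sharpE (mone C) Y Z) (@sharpE (mone C) X Z) /= !compm1.
rewrite (compmA (@sharp (mone C) _ _ f W)) -ev_nat -(compmA (ev _ _)) -tensm_idl.
rewrite (compmA (Z |> _)) -interchange -compmA.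
by rewrite (@sharp_cv (mone C)) /= compm1 compmA -tensm_idr.
Qed.

Lemma sharp_id X W : @sharp (mone C) X X (idm X) W = idm _.
Proof. by rewrite sharpE /= tensm1 comp1m comp1m ev_cv_star. Qed.

(** Mates are unique: bending both strands of w and straightening them again by the zigzags returns
    w. *)
Lemma sharp_of_mate F X V (w : forall W, hom (star V \ot F W) (star X \ot W))
    (q : hom (F X) V) :
  (forall W W' (f : hom W W'), w W' \oc (star V |> mmap F f) = (star X |> f) \oc w W) ->
  (forall W, (q <| W) \oc mstri F X W
     = (V |> ev X W) \oc (V |> w (X \ox W)) \oc cv V (F (X \ox W))) ->
  forall W, w W = sharp q W.
Proof.
move=> wn e W; rewrite sharpE e -!compmA cv_nat !compmA.
rewrite (comp_rw1 _ (esym (tensm_idl _ (w _) _))) wn -(tensm_idl V) compmA.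
rewrite ev_cv_star comp1m tensm_idl compmA ev_nat -compmA ev_cv_star.
by rewrite compm1.
Qed.

(** Fullness of duality transfers Schur's lemma from the simple objects to their duals. *)
Lemma star_full X Y (f : hom (star X) (star Y)) :
  exists c : hom Y X, forall W, f <| W = @sharp (mone C) Y X c W.
Proof.
pose t W := (X |> ev Y W) \oc ((X |> f <| (Y \ox W)) \oc cv X (Y \ox W)).
have mt : @modular _ C (mcons Y (mone C)) (mcons X (mone C)) t.
  exact: (modular_comp (modular_comp (modular_cvs X (mcons Y (mone C)))
     (modular_cons _ (modular_act (mcons Y (mone C)) f)))
     (modular_cons _ (modular_evs Y (mone C)))).
exists (mor11 t); apply: (@sharp_of_mate (mone C)) => [W W' g|W] /=.
  by rewrite interchange.
by rewrite compm1 -(mor11E mt) /t compmA.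
Qed.

Lemma sharp_full X Y V (w : forall W, hom (star V \ot Y \ot W) (star X \ot W)) :
  (forall F, @modular _ C (mcons (star V) (mcons Y F)) (mcons (star X) F)
     (fun W => w (F W))) ->
  exists q : hom (Y \ox X) V, forall W, w W = @sharp (mcons Y (mone C)) X V q W.
Proof.
move=> mw; pose t W := (V |> ev X W) \oc ((V |> w (X \ox W)) \oc cv V (Y \ot X \ot W)).
have mt : @modular _ C (mcons Y (mcons X (mone C))) (mcons V (mone C)) t.
  exact: (modular_comp (modular_comp (modular_cvs V (mcons Y (mcons X (mone C))))
     (modular_cons _ (mw (mcons X (mone C)))))
     (modular_cons _ (modular_evs X (mone C)))).
exists (mor21 t); apply: (@sharp_of_mate (mcons Y (mone C))) => [W W' g|W] /=.
  by have [e _] := mw (mone C); exact: e.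
rewrite tensm1 compm1 -(mor21E mt) -[LHS]compmA associK compm1 /t compmA //.
Qed.

(** The bilinear pairing in which x acts on the strand U and the mate of y on the strand [star U].
    Summed over a resolution it gives the canonical tensors of the handle slide and of the
    half-braiding. *)
Definition kpair F G X U (x : hom U (G X)) (y : hom (F X) U) W :
  hom (U \ot star U \ot F W) (G (X \ot star X \ot W)) :=
  locked (mstr G X (star X \ox W) \oc (x <| (star X \ox W)) \oc (U |> sharp y W)).

Lemma kpairE F G X U (x : hom U (G X)) (y : hom (F X) U) W : kpair x y W =
  mstr G X (star X \ox W) \oc (x <| (star X \ox W)) \oc (U |> sharp y W).
Proof. by rewrite /kpair -lock. Qed.

Lemma kpairDl F G X U (x x' : hom U (G X)) (y : hom (F X) U) W :
  kpair (x + x') y W = kpair x y W + kpair x' y W.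
Proof. by rewrite !kpairE tensmDl !(compmDl, compmDr). Qed.

Lemma kpairDr F G X U (x : hom U (G X)) (y y' : hom (F X) U) W :
  kpair x (y + y') W = kpair x y W + kpair x y' W.
Proof. by rewrite !kpairE sharpD tensmDr !(compmDl, compmDr). Qed.

Lemma kpairZl F G X U a (x : hom U (G X)) (y : hom (F X) U) W :
  kpair (a *: x) y W = a *: kpair x y W.
Proof. by rewrite !kpairE tensmZl !(compmZl, compmZr). Qed.

Lemma kpairZr F G X U a (x : hom U (G X)) (y : hom (F X) U) W :
  kpair x (a *: y) W = a *: kpair x y W.
Proof. by rewrite !kpairE sharpZ tensmZr !(compmZl, compmZr). Qed.

Lemma kpair_suml F G X U I (r : seq I) P (x : I -> hom U (G X)) (y : hom (F X) U) W :
  kpair (\sum_(i <- r | P i) x i) y W = \sum_(i <- r | P i) kpair (x i) y W.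
Proof.
elim/big_rec2: _ => [|i u v _ <-]; last by rewrite kpairDl.
by rewrite -(scale0r (0 : hom U (G X))) kpairZl scale0r.
Qed.

Section Pivotal.
Variable p : pivotal_structure C.

(** The mate with respect to the other-sided duality [er], [cr]; composed with [sharp] it gives
    endomorphisms of dual objects. *)
Definition flat F X V (x : hom V (F X)) W : hom (star X \ot W) (star V \ot F W) :=
  locked ((star V |> (mmap F (er p X W) \oc mstr F X (star X \ox W)
     \oc (x <| (star X \ox W)))) \oc cr p V (star X \ox W)).

Lemma flatE F X V (x : hom V (F X)) W : flat x W =
  (star V |> (mmap F (er p X W) \oc mstr F X (star X \ox W)
     \oc (x <| (star X \ox W)))) \oc cr p V (star X \ox W).
Proof. by rewrite /flat -lock. Qed.

Lemma er_flat F X V (x : hom V (F X)) W :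
  er p V (F W) \oc (V |> flat x W)
  = mmap F (er p X W) \oc mstr F X (star X \ox W) \oc (x <| (star X \ox W)).
Proof. by rewrite flatE tensm_idl compmA er_nat -compmA er_cr compm1. Qed.

Lemma flat_cr F X V (x : hom V (F X)) W :
  flat x (X \ox W) \oc cr p X W = (star V |> (mstr F X W \oc (x <| W))) \oc cr p V W.
Proof.
rewrite flatE -compmA cr_nat compmA -tensm_idl -!compmA interchange.
rewrite (compmA (mstr _ _ _)) -(mmap1 F X) -mstr_nat.
by rewrite compmA compmA -mmapM er_cr mmap1 comp1m.
Qed.

(** Cyclicity of the trace: x travels round the loop and meets q on the strand U. *)
Lemma ev_sharp_flat F X U (q : hom (F X) U) (x : hom U (F X)) W :
  ev X W \oc (sharp q (X \ox W) \oc flat x (X \ox W)) \oc cr p X W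
  = ev U W \oc (star U |> (q \oc x) <| W) \oc cr p U W.
Proof.
rewrite compmA ev_sharp -!compmA flat_cr; congr (_ \oc _); rewrite compmA.
rewrite -tensm_idl -compmA (compmA (mstri _ _ _)) mstrK comp1m.
by rewrite -tensm_idr.
Qed.

Lemma modular_flat Y X V (x : hom V (Y \ox X)) (G : mfun C) :
  @modular k C (mcons (star X) G) (mcons (star V) (mcons Y G))
    (fun W => @flat (mcons Y (mone C)) X V x (G W)).
Proof.
pose phi W := (star V |> Y |> er p X (G W)) \oc
   ((star V |> assoc Y X (star X \ox G W)) \oc
    ((star V |> x <| (star X \ox G W)) \oc cr p V (star X \ox G W))).
apply: (@modular_eq _ _ (mcons (star X) G) (mcons (star V) (mcons Y G)) phi) => [W|].
  by rewrite flatE /= tensm1 comp1m /phi !compmA -!tensm_idl.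
exact: (modular_comp (modular_comp (modular_comp
  (modular_cr p V (mcons (star X) G))
  (modular_cons _ (modular_act (mcons (star X) G) x)))
  (modular_cons _ (modular_split Y X (mcons (star X) G))))
  (modular_cons _ (modular_cons _ (modular_er p X G)))).
Qed.

End Pivotal.
End Mates.

Section Resolutions.
Variables (k : fieldType) (C : rigidcat k) (p : pivotal_structure C).
Variables (m : nat) (V : 'I_m -> C).
Implicit Types (X Y Z W A B M N : C) (F G : mfun C).

(* A factorisation of the identity of M through the V i; it need not come from
   a direct sum decomposition. *)
Record resolution M := Resolution {
  rsize : nat;
  rinj : forall i, 'I_rsize -> hom (V i) M;
  rprj : forall i, 'I_rsize -> hom M (V i);
  resolutionP : \sum_i \sum_a rinj i a \oc rprj i a = idm M
}.

Arguments rinj {M} r i a.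
Arguments rprj {M} r i a.

Hypothesis schur_neq : forall i j (c : hom (V i) (V j)), i != j -> c = 0.
Hypothesis schur_eq : forall i (c : hom (V i) (V i)), exists s, c = s *: idm (V i).

Section Casimir.
Variables (L : lmodType k) (M N : C).
Variable beta : forall i, hom (V i) N -> hom M (V i) -> L.
Hypothesis betaDl : forall i (x x' : hom (V i) N) y,
  beta (x + x') y = beta x y + beta x' y.
Hypothesis betaDr : forall i (x : hom (V i) N) y y',
  beta x (y + y') = beta x y + beta x y'.
Hypothesis betaZl : forall i a (x : hom (V i) N) y, beta (a *: x) y = a *: beta x y.
Hypothesis betaZr : forall i a (x : hom (V i) N) y, beta x (a *: y) = a *: beta x y.

Let beta0l i (y : hom M (V i)) : beta (0 : hom (V i) N) y = 0.
Proof. by rewrite -(scale0r (0 : hom (V i) N)) betaZl scale0r. Qed.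
Let beta0r i (x : hom (V i) N) : beta x (0 : hom M (V i)) = 0.
Proof. by rewrite -(scale0r (0 : hom M (V i))) betaZr scale0r. Qed.

Let beta_suml i I (r : seq I) P (x : I -> hom (V i) N) y :
  beta (\sum_(a <- r | P a) x a) y = \sum_(a <- r | P a) beta (x a) y.
Proof. by elim/big_rec2: _ => [|a u v _ <-]; [exact: beta0l | exact: betaDl]. Qed.
Let beta_sumr i I (r : seq I) P (x : hom (V i) N) y :
  beta x (\sum_(a <- r | P a) y a) = \sum_(a <- r | P a) beta x (y a).
Proof. by elim/big_rec2: _ => [|a u v _ <-]; [exact: beta0r | exact: betaDr]. Qed.

Let beta_balanced i j (c : hom (V i) (V j)) (x : hom (V j) N) (y : hom M (V i)) :
  beta (x \oc c) y = beta x (c \oc y).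
Proof.
have [e|ne] := eqVneq i j; last first.
  by rewrite (schur_neq c ne) comp0m compm0 beta0l beta0r.
subst j; have [s ->] := schur_eq c.
by rewrite compmZl compmZr comp1m compm1 betaZl betaZr.
Qed.

(** Inserting s on the left and r on the right gives the same double sum, because the middle
    morphism from V i to V j is a scalar or zero and crosses [beta]. For f the identity, the sum is
    independent of the resolution. *)
Lemma casimir_slide (f : hom M N) (r : resolution M) (s : resolution N) :
  \sum_i \sum_a beta (f \oc rinj r i a) (rprj r i a)
  = \sum_j \sum_b beta (rinj s j b) (rprj s j b \oc f).
Proof.
transitivity (\sum_i \sum_a \sum_j \sum_b
   beta (rinj s j b \oc (rprj s j b \oc f \oc rinj r i a)) (rprj r i a)).
  apply: eq_bigr => i _; apply: eq_bigr => a _.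
  rewrite -[f in LHS]comp1m -(resolutionP s) !compm_suml beta_suml.
  apply: eq_bigr => j _; rewrite !compm_suml beta_suml.
  by apply: eq_bigr => b _; rewrite !compmA.
transitivity (\sum_j \sum_b \sum_i \sum_a
   beta (rinj s j b) (rprj s j b \oc f \oc rinj r i a \oc rprj r i a)); last first.
  apply: eq_bigr => j _; apply: eq_bigr => b _.
  rewrite -[in RHS](compm1 f) -(resolutionP r) !compm_sumr beta_sumr.
  apply: eq_bigr => i _; rewrite !compm_sumr beta_sumr.
  by apply: eq_bigr => a _; rewrite !compmA.
under eq_bigr do under eq_bigr do under eq_bigr do under eq_bigr do
  rewrite beta_balanced.
under eq_bigr do rewrite exchange_big /=.
rewrite exchange_big /=; apply: eq_bigr => j _.
under eq_bigr do rewrite exchange_big /=.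
by rewrite exchange_big.
Qed.

End Casimir.
End Resolutions.

Arguments rinj {k C m V M} r i a.
Arguments rprj {k C m V M} r i a.

(** * Partial traces and handle slides *)

Section NaturalFamilies.
Variables (k : fieldType) (C : rigidcat k) (p : pivotal_structure C).
Variables (P Q : mfun C) (h : forall X W : C, hom (P (X \ox W)) (Q (X \ox W))).
Implicit Types (X Y Z W A B M N : C) (F G : mfun C).

Definition natural_family : Prop :=
  (forall X X' (f : hom X X') W,
     h X' W \oc mmap P (f <| W) = mmap Q (f <| W) \oc h X W) /\
  (forall X W W' (g : hom W W'),
     h X W' \oc mmap P (X |> g) = mmap Q (X |> g) \oc h X W).

Hypothesis hnat : natural_family.

(* The partial trace of h over X. *)
Definition ptr X W : hom (P W) (Q W) :=
  locked (mmap Q (er p X W) \oc h X (star X \ox W) \oc mmap P (cv X W)).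

Lemma ptrE X W :
  ptr X W = mmap Q (er p X W) \oc h X (star X \ox W) \oc mmap P (cv X W).
Proof. by rewrite /ptr -lock. Qed.

Lemma ptr_nat X W W' (f : hom W W') : ptr X W' \oc mmap P f = mmap Q f \oc ptr X W.
Proof.
have [_ hW] := hnat; rewrite !ptrE -compmA -mmapM cv_nat mmapM !compmA.
by rewrite (comp_rw2 _ (hW _ _ _ _)) -!mmapM er_nat.
Qed.

(** Each term of the resolved identity slides half round the loop, by naturality of h and by passing
    to the dual strand, until [prj i] meets [inj i]. *)
Lemma ptr_split n (S : 'I_n -> C) X (inj : forall i, hom (S i) X)
    (prj : forall i, hom X (S i)) W :
  (forall i, prj i \oc inj i = idm (S i)) -> \sum_i inj i \oc prj i = idm X ->
  ptr X W = \sum_i ptr (S i) W.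
Proof.
have [hX hW] := hnat => pi ip; rewrite ptrE.
rewrite -[mmap P (cv X W)]comp1m -(mmap1 P) -(tensm1 X) -ip.
rewrite tensm_suml mmap_sum compm_suml compm_sumr; apply: eq_bigr => i _.
rewrite ptrE tensm_idr mmapM !compmA (comp_rw2 _ (hX _ _ _ _)) -mmapM.
rewrite -(compmA _ _ (mmap P (cv X W))) -mmapM.
have -> : (prj i <| (star X \ox W)) \oc cv X W
   = (S i |> @sharp _ _ (mone C) X (S i) (prj i) W) \oc cv (S i) W.
  by rewrite [RHS](@sharp_cv _ _ (mone C)) /= compm1.
rewrite (mmapM P) compmA (comp_rw2 _ (hW _ _ _ _)) -mmapM.
congr (mmap Q _ \oc _ \oc _).
rewrite -er_starm sharp_starm -compmA -tensm_idl sharp_comp pi sharp_id.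
by rewrite tensm1 compm1.
Qed.

Lemma ptr_iso X Y W : isomorphic X Y -> ptr X W = ptr Y W.
Proof.
move=> [f [g [gf fg]]].
rewrite (@ptr_split 1 (fun=> Y) X (fun=> g) (fun=> f)) ?big_ord1 //.
Qed.

Lemma ptr_tens X Y W :
  ptr (X \ox Y) W = mmap Q (er p X W) \oc
    (mmap Q (X |> er p Y (star X \ox W)) \oc mmap Q (assoc X Y _)
      \oc h (X \ox Y) (star Y \ot star X \ot W) \oc mmap P (associ X Y _)
      \oc mmap P (X |> cv Y (star X \ox W)))
    \oc mmap P (cv X W).
Proof.
have [hX hW] := hnat; rewrite ptrE er_tens (mmapM Q) -(compmA (mmap Q _)) -hW.
rewrite -!compmA -!(mmapM P) !(mmapM Q) -!compmA; congr (_ \oc (_ \oc (_ \oc (_ \oc mmap P _)))).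
rewrite -cv_tens !compmA assocK comp1m //.
Qed.

(** Naturality of h brings x and the mate of y, which lie after h, together before h. In a sum over
    a resolution, [x \oc y] then becomes an identity. *)
Lemma natural_kpair F G X U (x : hom U (G X)) (y : hom (F X) U) W :
  mmap Q (kpair x y W) \oc h U (star U \ox F W) \oc mmap P (cv U (F W))
  = mmap Q (mstr G X (star X \ox W)) \oc h (G X) (star X \ox W)
      \oc mmap P ((x \oc y) <| (star X \ox W))
      \oc mmap P (mstri F X (star X \ox W) \oc mmap F (cv X W)).
Proof.
have [hX hW] := hnat; rewrite kpairE !(mmapM Q) (comp_rw2 _ (esym (hW _ _ _ _))).
rewrite (comp_rw2 _ (esym (hX _ _ _ _))) -!compmA -!(mmapM P); congr (_ \oc (_ \oc mmap P _)).
by rewrite sharp_cv tensm_idr !compmA.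
Qed.

Section Semisimple.
Variables (m : nat) (V : 'I_m -> C).
Hypothesis schur_neq : forall i j (c : hom (V i) (V j)), i != j -> c = 0.
Hypothesis schur_eq : forall i (c : hom (V i) (V i)), exists s, c = s *: idm (V i).

Variable rs : forall M, resolution V M.
(** The weight is the dimension of [star (V i)], given by the loop oriented oppositely to the one
    closing [ptr]. *)
Variable d : 'I_m -> k.
Hypothesis dE : forall i W, ev (V i) W \oc cr p (V i) W = d i *: idm W.


Lemma schur_star_neq i j (t : forall W, hom (star (V j) \ox W) (star (V i) \ox W)) W :
  @modular _ C (mcons (star (V j)) (mone C)) (mcons (star (V i)) (mone C)) t ->
  i != j -> t W = 0.
Proof.
move=> mt ne; rewrite (mor11E mt); have [c ->] := star_full (mor11 t).
by rewrite (schur_neq c ne) sharp0.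
Qed.

Lemma schur_star_eq j (t : forall W, hom (star (V j) \ox W) (star (V j) \ox W)) :
  @modular _ C (mcons (star (V j)) (mone C)) (mcons (star (V j)) (mone C)) t ->
  exists s, forall W, t W = s *: idm _.
Proof.
move=> mt; have [c e] := star_full (mor11 t); have [s es] := schur_eq c.
by exists s => W; rewrite (mor11E mt) e es sharpZ sharp_id.
Qed.

Lemma modular_sharp_flat Y X X' U (q : hom (Y \ox X) U) (x : hom U (Y \ox X')) :
  @modular _ C (mcons (star X') (mone C)) (mcons (star X) (mone C))
   (fun W => @sharp _ _ (mcons Y (mone C)) X U q W
      \oc @flat _ _ p (mcons Y (mone C)) X' U x W).
Proof. exact: (modular_comp (modular_flat p x (mone C)) (modular_sharp q (mone C))). Qed.

Lemma sharp_flat_neq Y l j i (q : hom (Y \ox V l) (V i)) (x : hom (V i) (Y \ox V j)) W :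
  l != j ->
  @sharp _ _ (mcons Y (mone C)) (V l) (V i) q W
      \oc @flat _ _ p (mcons Y (mone C)) (V j) (V i) x W = 0.
Proof. exact: schur_star_neq (modular_sharp_flat q x). Qed.

(* Both composites of q and x are scalars; comparing their traces over V l^*
   and V i^* gives the ratio. *)
Lemma sharp_flat_eq Y l i (q : hom (Y \ox V l) (V i)) (x : hom (V i) (Y \ox V l)) s W :
  q \oc x = s *: idm (V i) ->
  d l *: (@sharp _ _ (mcons Y (mone C)) (V l) (V i) q W
      \oc @flat _ _ p (mcons Y (mone C)) (V l) (V i) x W) = (d i * s) *: idm _.
Proof.
move=> qx; have [c e] := schur_star_eq (modular_sharp_flat q x).
have e1 W' : (d i * s) *: idm W' = (d l * c) *: idm W'.
  have : ev (V l) W' \oc (@sharp _ _ (mcons Y (mone C)) (V l) (V i) q (V l \ox W')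
      \oc @flat _ _ p (mcons Y (mone C)) (V l) (V i) x (V l \ox W')) \oc cr p (V l) W'
    = (d l * c) *: idm W'.
    by rewrite e compmZr compmZl compm1 dE scalerA mulrC.
  move=> <-; rewrite ev_sharp_flat qx.
  by rewrite tensmZl tensm1 tensmZr tensm1 compmZr compmZl compm1 dE scalerA mulrC.
by rewrite e scalerA -e1.
Qed.

(** Dualising a resolution of [star M] factors M through the duals of the V l, without knowing which
    V j each of these duals is. *)
Lemma star_resolution M W :
  \sum_l \sum_b ((M |> er p (V l) W) \oc (M |> rprj (rs (star M)) l b <| (star (V l) \ox W))
      \oc cv M (star (V l) \ox W))
    \oc ((star (V l) |> ev M W) \oc (star (V l) |> rinj (rs (star M)) l b <| (M \ox W))
      \oc cr p (V l) (M \ox W))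
  = idm (M \ox W).
Proof.
transitivity ((M |> ev M W) \oc (M |> idm (star M) <| (M \ox W)) \oc cv M (M \ox W)).
  rewrite -(resolutionP (rs (star M))) tensm_suml tensm_sumr compm_sumr compm_suml.
  apply: eq_bigr => l _; rewrite tensm_suml tensm_sumr compm_sumr compm_suml.
  apply: eq_bigr => b _; set inj := rinj _ _ _; set prj := rprj _ _ _.
  rewrite -(compmA _ (cv _ _)) cv_nat compmA -!tensm_idl; congr ((M |> _) \oc _).
  rewrite -compmA interchange tensm_idr !compmA; congr (_ \oc _).
  by rewrite tensm_idl compmA er_nat -compmA er_cr compm1.
by rewrite tensm1 tensm1 compm1 ev_cv.
Qed.

Let Fw Y := mcons Y (mone C).

(* The canonical tensors of the pairings of V i with the Y \ox V j and of
   V i^* \ox Y with the V j^* agree up to the traces. *)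
Lemma kirby_word Y i W :
  \sum_j \sum_a d j *: ((Y |> er p (V j) W) \oc
    @kpair _ _ (Fw Y) (Fw Y) (V j) (V i) (rinj (rs (Y \ox V j)) i a)
       (rprj (rs (Y \ox V j)) i a) W)
  = d i *: er p (V i) (Y \ox W).
Proof.
(* Bending x round the cap leaves the cap of V i, with both mates now on the dual strand. *)
have e j (x : hom (V i) (Y \ox V j)) (y : hom (Y \ox V j) (V i)) :
   (Y |> er p (V j) W) \oc @kpair _ _ (Fw Y) (Fw Y) (V j) (V i) x y W
   = er p (V i) (Y \ox W) \oc (V i |> (@flat _ _ p (Fw Y) (V j) (V i) x W \oc
        @sharp _ _ (Fw Y) (V j) (V i) y W)).
  rewrite kpairE tensm_idl [RHS]compmA (er_flat p (F := Fw Y)) [LHS]compmA.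
  by congr (_ \oc _); exact: compmA.
under eq_bigr do under eq_bigr do rewrite e -compmZr -tensmZr.
under eq_bigr do rewrite -compm_sumr -tensm_sumr.
rewrite -compm_sumr -tensm_sumr.
suff -> : \sum_j \sum_a d j *: (@flat _ _ p (Fw Y) (V j) (V i) (rinj (rs (Y \ox V j)) i a) W \oc
        @sharp _ _ (Fw Y) (V j) (V i) (rprj (rs (Y \ox V j)) i a) W) = d i *: idm _.
  by rewrite tensmZr tensm1 compmZr compm1.
set S := \sum_j _.
(* The sum S is tested against a factorisation of M through the [star (V l)], with inclusions u and
   projections w. *)
pose M := star (V i) \ox Y.
pose u l b W' := assoc (star (V i)) Y W' \oc ((M |> er p (V l) W') \oc (M |> rprj (rs (star M)) l b <| (star (V l) \ox W'))
      \oc cv M (star (V l) \ox W')).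
pose w l b W' := (star (V l) |> ev M W') \oc ((star (V l) |> rinj (rs (star M)) l b <| (M \ox W'))
      \oc (cr p (V l) (M \ox W') \oc associ (star (V i)) Y W')).
have uw : \sum_l \sum_b u l b W \oc w l b W = idm _.
  have := star_resolution M W.
  move/(congr1 (fun f => assoc (star (V i)) Y W \oc f \oc associ (star (V i)) Y W)).
  rewrite compm1 associK => <-; rewrite compm_sumr compm_suml; apply: eq_bigr => l _.
  rewrite compm_sumr compm_suml; apply: eq_bigr => b _.
  by rewrite /u /w !compmA.
(* As a mate, each projection can be composed with [flat] to an endomorphism governed by Schur's
   lemma. *)
have ws l b : exists q : hom (Y \ox V l) (V i), forall W', w l b W' = @sharp _ _ (Fw Y) (V l) (V i) q W'.
  apply: sharp_full => G; rewrite /w.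
  exact: (modular_comp (modular_comp (modular_comp (modular_merge (star (V i)) Y G)
    (modular_cr p (V l) (mcons M G)))
    (modular_cons _ (modular_act (mcons M G) (rinj (rs (star M)) l b))))
    (modular_cons _ (modular_evs M G))).
rewrite -[LHS]comp1m -uw compm_suml scaler_sumr; apply: eq_bigr => l _.
rewrite compm_suml scaler_sumr; apply: eq_bigr => b _.
have [q qE] := ws l b.
rewrite -compmA qE -compmZr; congr (_ \oc _).
(* Schur's lemma for duals leaves only j = l, after which [sharp_flat_eq] exchanges the weight d l
   for d i. *)
rewrite /S compm_sumr (bigD1 l) //= [X in _ + X]big1 ?addr0 => [|j jl]; last first.
  rewrite compm_sumr big1 // => a _.
  by rewrite compmZr compmA sharp_flat_neq ?comp0m ?scaler0 // eq_sym.
have -> : d i *: @sharp _ _ (Fw Y) (V l) (V i) q W = \sum_a d i *: @sharp _ _ (Fw Y) (V l) (V i)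
     (q \oc rinj (rs (Y \ox V l)) i a \oc rprj (rs (Y \ox V l)) i a) W.
  rewrite -scaler_sumr -sharp_sum; congr (_ *: sharp _ W).
  rewrite -[LHS]compm1 -(resolutionP (rs (Y \ox V l))).
  rewrite compm_sumr (bigD1 i) //= [X in _ + X]big1 ?addr0 => [|j ji]; last first.
    rewrite compm_sumr big1 // => a _.
    by rewrite compmA [X in X \oc _](schur_neq _ ji) comp0m.
  by rewrite compm_sumr; apply: eq_bigr => a _; rewrite compmA.
rewrite compm_sumr; apply: eq_bigr => a _.
have [s es] := schur_eq (q \oc rinj (rs (Y \ox V l)) i a).
rewrite compmZr !compmA -compmZl (sharp_flat_eq _ es) es.
by rewrite !compmZl !comp1m sharpZ scalerA.
Qed.

(* A handle slide: sums over the V j of traces of h absorb a strand Y. *)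
Lemma kirby_slide Y W :
  \sum_j d j *: (mmap Q (Y |> er p (V j) W) \oc mmap Q (assoc Y (V j) _)
      \oc h (Y \ox V j) (star (V j) \ox W) \oc mmap P (associ Y (V j) _)
      \oc mmap P (Y |> cv (V j) W))
  = \sum_j d j *: ptr (V j) (Y \ox W).
Proof.
(* Resolving [Y \ox V j] in front of h allows each term to be rewritten, by [natural_kpair], as h
   evaluated on a single V i. *)
have e j : h (Y \ox V j) (star (V j) \ox W) \oc mmap P (associ Y (V j) _)
      \oc mmap P (Y |> cv (V j) W)
   = \sum_i \sum_a h (Y \ox V j) (star (V j) \ox W)
      \oc mmap P ((rinj (rs (Y \ox V j)) i a \oc rprj (rs (Y \ox V j)) i a) <| _)
      \oc mmap P (mstri (Fw Y) (V j) (star (V j) \ox W) \oc mmap (Fw Y) (cv (V j) W)).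
  under [RHS]eq_bigr do rewrite -compm_suml -compm_sumr -mmap_sum -tensm_suml.
  rewrite -compm_suml -compm_sumr -mmap_sum -tensm_suml resolutionP tensm1 mmap1 compm1.
  by rewrite /= tensm1 compm1 mmapM compmA.
transitivity (\sum_j \sum_i \sum_a d j *:
   (mmap Q ((Y |> er p (V j) W) \oc
    @kpair _ _ (Fw Y) (Fw Y) (V j) (V i) (rinj (rs (Y \ox V j)) i a)
       (rprj (rs (Y \ox V j)) i a) W) \oc h (V i) _ \oc mmap P (cv (V i) (Y \ox W)))).
  apply: eq_bigr => j _; rewrite -!compmA (compmA (h _ _)) e !compm_sumr scaler_sumr.
  apply: eq_bigr => i _; rewrite !compm_sumr scaler_sumr; apply: eq_bigr => a _.
  have := @natural_kpair (Fw Y) (Fw Y) (V j) (V i) (rinj (rs (Y \ox V j)) i a)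
     (rprj (rs (Y \ox V j)) i a) W.
  rewrite /= tensm1 comp1m => nk.
  rewrite (mmapM Q (_ |> _)) -(compmA (mmap Q (_ |> _))) -(compmA (mmap Q (_ |> _))) nk.
  by rewrite !compmA.
(* For fixed i, the sum over j is the one computed by [kirby_word]. *)
rewrite exchange_big; apply: eq_bigr => i _.
under eq_bigr do under eq_bigr do rewrite -!compmZl -mmapZ.
under eq_bigr do rewrite -!compm_suml -mmap_sum.
by rewrite -!compm_suml -mmap_sum kirby_word mmapZ !compmZl ptrE.
Qed.

(** The Y-strand is slid off the inner traces, so the Y-loop closes freely and contributes its value
    c. *)
Lemma kirby_absorb Y c W : (forall W', er p Y W' \oc cv Y W' = c *: idm W') ->
  \sum_j d j *: ptr (Y \ox V j) W = c *: \sum_j d j *: ptr (V j) W.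
Proof.
move=> e; transitivity (mmap Q (er p Y W) \oc
    (\sum_j d j *: ptr (V j) (Y \ot star Y \ot W)) \oc mmap P (cv Y W)).
  rewrite -kirby_slide compm_sumr compm_suml; apply: eq_bigr => j _.
  by rewrite ptr_tens compmZr compmZl.
rewrite compm_sumr compm_suml scaler_sumr; apply: eq_bigr => j _.
rewrite compmZr compmZl -ptr_nat -compmA -mmapM e mmapZ mmap1 compmZr compm1.
by rewrite !scalerA mulrC.
Qed.

End Semisimple.
End NaturalFamilies.

(** * The center in nested form *)

Section CenterNested.
Variables (k : fieldType) (C : moncat k).
Local Notation one := (unit_obj C).
Implicit Types (X Y W A B : C) (F G : mfun C).

Section HalfBraidings.
Variables (Z : C) (s : forall X, hom (Z \ox X) (X \ox Z)).

Definition nest X W : hom (Z \ot X \ot W) (X \ot Z \ot W) :=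
  locked (assoc X Z W \oc (s X <| W) \oc associ Z X W).

Lemma nestE X W : nest X W = assoc X Z W \oc (s X <| W) \oc associ Z X W.
Proof. by rewrite /nest -lock. Qed.

Lemma nest_tens X Y W :
  assoc X Y (Z \ox W) \oc (assoc (X \ox Y) Z W
     \oc ((associ X Y Z \oc (X |> s Y) \oc assoc X Z Y \oc (s X <| Y)
          \oc associ Z X Y) <| W) \oc associ Z (X \ox Y) W)
    \oc (Z |> associ X Y W)
  = (X |> nest Y W) \oc nest X (Y \ox W).
Proof.
rewrite !nestE !tensm_idr !compmA pentagon.
rewrite (comp_rw1 _ (esym (tensm_idr _ (assoc X Y Z) _))) associK tensm1 compm1.
rewrite (comp_rw2 _ (assoc_nat _ _ _)) !tensm_idl.
rewrite -(compmA _ (assoc X (Z \ox Y) W)) -pentagon3 !compmA.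
rewrite (comp_rw2 _ (assoc_nat _ _ _)) tensm1.
have e := pentagoni1 Z X Y W.
rewrite -[_ \oc assoc (Z \ox X) Y W \oc _ \oc _]compmA.
rewrite -[_ \oc (assoc (Z \ox X) Y W) \oc _]compmA (compmA (assoc (Z \ox X) Y W)) e.
by rewrite -!compmA -tensm_idl associK tensm1 compm1.
Qed.

Lemma modular_nest X F :
  @modular k C (mcons Z (mcons X F)) (mcons X (mcons Z F)) (fun W => nest X (F W)).
Proof.
apply: (@modular_eq _ _ (mcons Z (mcons X F)) (mcons X (mcons Z F)) _ _
   (fun W => nestE X (F W))).
exact: (modular_comp (modular_merge Z X F)
  (modular_comp (modular_act F (s X)) (modular_split X Z F))).
Qed.

Lemma nest_natr X W W' (f : hom W W') :
  nest X W' \oc (Z |> X |> f) = (X |> Z |> f) \oc nest X W.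
Proof. by have [e _] := modular_nest X (mone C); exact: e. Qed.

Lemma nest_natl X Y (f : hom X Y) W :
  s Y \oc (Z |> f) = (f <| Z) \oc s X ->
  nest Y W \oc (Z |> f <| W) = (f <| (Z \ox W)) \oc nest X W.
Proof.
move=> e; rewrite !nestE -!compmA associ_nat !compmA.
rewrite -2!(compmA (assoc _ _ _)) -tensm_idr e tensm_idr !compmA.
by rewrite assoc_nat tensm1.
Qed.

End HalfBraidings.

Definition br (Z : center_obj C) := nest (hbraid Z).

Lemma br_natl (Z : center_obj C) X Y (f : hom X Y) W :
  br Z Y W \oc ((Z : C) |> f <| W) = (f <| (Z \ox W)) \oc br Z X W.
Proof. exact/nest_natl/hbraid_nat. Qed.

Lemma br_natr (Z : center_obj C) X W W' (f : hom W W') :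
  br Z X W' \oc ((Z : C) |> X |> f) = (X |> (Z : C) |> f) \oc br Z X W.
Proof. exact: nest_natr. Qed.

Lemma br_tens (Z : center_obj C) X Y W :
  assoc X Y (Z \ox W) \oc br Z (X \ox Y) W \oc ((Z : C) |> associ X Y W)
  = (X |> br Z Y W) \oc br Z X (Y \ox W).
Proof. by rewrite /br -nest_tens (nestE _ (X \ox Y)) hbraid_tens !compmA. Qed.

Lemma modular_br (Z : center_obj C) X F :
  @modular k C (mcons Z (mcons X F)) (mcons X (mcons Z F)) (fun W => br Z X (F W)).
Proof. exact: modular_nest. Qed.

Definition hbraidi (Z : center_obj C) X : hom (X \ox Z) (Z \ox X) :=
  projT1 (cid (hbraid_iso Z X)).

Lemma hbraidK (Z : center_obj C) X : hbraidi Z X \oc hbraid Z X = idm _.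
Proof. by rewrite /hbraidi; case: cid => ? []. Qed.

Lemma hbraidiK (Z : center_obj C) X : hbraid Z X \oc hbraidi Z X = idm _.
Proof. by rewrite /hbraidi; case: cid => ? []. Qed.

Definition bri (Z : center_obj C) X W : hom (X \ot Z \ot W) (Z \ot X \ot W) :=
  locked (assoc Z X W \oc (hbraidi Z X <| W) \oc associ X Z W).

Lemma brK (Z : center_obj C) X W : bri Z X W \oc br Z X W = idm _.
Proof.
rewrite /bri -lock /br nestE !compmA (comp_rw1 _ (assocK _ _ _)) compm1.
by rewrite (comp_rw1 _ (esym (tensm_idr _ _ _))) hbraidK tensm1 compm1 associK.
Qed.

Lemma briK (Z : center_obj C) X W : br Z X W \oc bri Z X W = idm _.
Proof.
rewrite /bri -lock /br nestE !compmA (comp_rw1 _ (assocK _ _ _)) compm1.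
by rewrite (comp_rw1 _ (esym (tensm_idr _ _ _))) hbraidiK tensm1 compm1 associK.
Qed.

Lemma modular_bri (Z : center_obj C) X F :
  @modular k C (mcons X (mcons Z F)) (mcons Z (mcons X F)) (fun W => bri Z X (F W)).
Proof.
by apply: modular_inv (modular_br Z X F) => W; rewrite ?brK ?briK.
Qed.

Lemma bri_natl (Z : center_obj C) X Y (f : hom X Y) W :
  bri Z Y W \oc (f <| (Z \ox W)) = ((Z : C) |> f <| W) \oc bri Z X W.
Proof.
rewrite -[LHS]compm1 -(briK Z X W) !compmA -(compmA (bri _ _ _)) -br_natl.
by rewrite compmA brK comp1m.
Qed.

Lemma bri_natr (Z : center_obj C) X W W' (f : hom W W') :
  bri Z X W' \oc (X |> (Z : C) |> f) = ((Z : C) |> X |> f) \oc bri Z X W.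
Proof. by have [e _] := modular_bri Z X (mone C); exact: e. Qed.

Lemma center_homE (Z Z' : center_obj C) (f : center_hom Z Z') X W :
  br Z' X W \oc ((f : hom (Z : C) (Z' : C)) <| (X \ox W))
  = (X |> (f : hom (Z : C) (Z' : C)) <| W) \oc br Z X W.
Proof.
have /asboolP e := center_morP f.
rewrite /br !nestE -!compmA -(tensm1 X W) associ_nat !compmA.
rewrite -2!(compmA (assoc _ _ _)) -tensm_idr e tensm_idr !compmA.
by rewrite assoc_nat.
Qed.

Lemma center_hom_nested (Z Z' : center_obj C) (f : hom (Z : C) (Z' : C)) :
  (forall X W, br Z' X W \oc (f <| (X \ox W)) = (X |> f <| W) \oc br Z X W) ->
  f \in @center_hom_pred k C Z Z'.
Proof.
move=> e; apply/asboolP => X; apply: tensm_faithful => W.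
have := e X W; rewrite /br !nestE => /(congr1 (fun g => g \oc assoc Z X W)).
rewrite -!compmA assocK compm1 -(tensm1 X W) -assoc_nat (compmA (associ _ _ _)) assocK comp1m.
rewrite (compmA (_ |> _)) -assoc_nat -!compmA.
move/(congr1 (fun g => associ X Z' W \oc g)); rewrite !compmA assocK !comp1m.
by rewrite !tensm_idr.
Qed.

(** * Objects of the center from nested half-braidings *)

Section MakeCenter.
Variables (T : C) (s : forall X W, hom (T \ot X \ot W) (X \ot T \ot W)).
Variable si : forall X W, hom (X \ot T \ot W) (T \ot X \ot W).
Hypothesis sK : forall X W, si X W \oc s X W = idm _.
Hypothesis siK : forall X W, s X W \oc si X W = idm _.
Hypothesis s_modular : forall X,
  @modular k C (mcons T (mcons X (mone C))) (mcons X (mcons T (mone C))) (s X).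
Hypothesis s_natl : forall X Y (f : hom X Y) W,
  s Y W \oc (T |> f <| W) = (f <| (T \ox W)) \oc s X W.
Hypothesis s_tens : forall X Y W,
  assoc X Y (T \ox W) \oc s (X \ox Y) W \oc (T |> associ X Y W)
  = (X |> s Y W) \oc s X (Y \ox W).

Let sigma X : hom (T \ox X) (X \ox T) := mor22 (s X).
Let sigmai X : hom (X \ox T) (T \ox X) := mor22 (si X).

Let sigmaE X W : s X W \oc assoc T X W = assoc X T W \oc (sigma X <| W).
Proof. exact: (mor22E (s_modular X)). Qed.

Let sigmaiE X W : si X W \oc assoc X T W = assoc T X W \oc (sigmai X <| W).
Proof.
apply: mor22E; exact: (@modular_inv _ _ (mcons T (mcons X (mone C)))
  (mcons X (mcons T (mone C))) (s X) (si X) (sK X) (siK X) (s_modular X)).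
Qed.

Let assoc_mono X Y A W (f g : hom A (X \ox Y \ox W)) :
  assoc X Y W \oc f = assoc X Y W \oc g -> f = g.
Proof.
by move/(congr1 (fun h => associ X Y W \oc h)); rewrite !compmA assocK !comp1m.
Qed.

Let nest_sigma X W : nest sigma X W = s X W.
Proof. by rewrite nestE -sigmaE -compmA associK compm1. Qed.

Let sigma_iso X : is_iso (sigma X).
Proof.
exists (sigmai X); split; apply: tensm_faithful => W; apply: assoc_mono.
  rewrite tensm_idr compmA -sigmaiE -compmA -sigmaE compmA sK.
  by rewrite tensm1 comp1m compm1.
rewrite tensm_idr compmA -sigmaE -compmA -sigmaiE compmA siK.
by rewrite tensm1 comp1m compm1.
Qed.

Let sigma_nat X Y (f : hom X Y) : sigma Y \oc (T |> f) = (f <| T) \oc sigma X.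
Proof.
apply: tensm_faithful => W; apply: assoc_mono.
rewrite !tensm_idr !compmA -sigmaE -compmA assoc_nat compmA s_natl.
by rewrite assoc_nat tensm1 -!compmA sigmaE.
Qed.

Let sigma_tens X Y : sigma (X \ox Y) = associ X Y T \oc (X |> sigma Y)
  \oc assoc X T Y \oc (sigma X <| Y) \oc associ T X Y.
Proof.
apply: tensm_faithful => W; apply: assoc_mono; apply: assoc_mono.
have := nest_tens sigma X Y W; rewrite !nest_sigma -s_tens.
move/(congr1 (fun g => g \oc (T |> assoc X Y W) \oc assoc T (X \ox Y) W)).
rewrite -!compmA !(compmA (T |> associ _ _ _)) -tensm_idl assocK tensm1 comp1m.
by rewrite assocK compm1 sigmaE.
Qed.

Definition make_center : center_obj C := CenterObj sigma_iso sigma_nat sigma_tens.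

Lemma br_make_center X W : br make_center X W = s X W.
Proof. exact: nest_sigma. Qed.

End MakeCenter.

End CenterNested.

(** * Averaging and the action of loops *)

Section Averaging.
Variables (k : fieldType) (C : rigidcat k) (p : pivotal_structure C).
Local Notation one := (unit_obj C).
Implicit Types (X Y W A B : C) (F G : mfun C) (Z : center_obj C).

Lemma bri_tens Z X Y W :
  ((Z : C) |> assoc X Y W) \oc bri Z (X \ox Y) W \oc associ X Y (Z \ox W)
  = bri Z X (Y \ox W) \oc (X |> bri Z Y W).
Proof.
have e := br_tens Z X Y W.
rewrite -[LHS]compm1 -(tensm1 X) -(briK Z Y W) tensm_idl.
rewrite -[(X |> br Z Y W)]compm1 -(briK Z X (Y \ox W)) !compmA.
rewrite -(compmA _ (X |> br _ _ _)) -e !compmA.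
rewrite (comp_rw1 _ (assocK _ _ _)) compm1 (comp_rw1 _ (brK _ _ _)) compm1.
by rewrite -tensm_idl associK tensm1 comp1m.
Qed.

Section Conjugate.
Variables (Z Z' : center_obj C) (g : hom (Z : C) (Z' : C)).

Definition conj X W : hom ((Z : C) \ot X \ot W) ((Z' : C) \ot X \ot W) :=
  locked (bri Z' X W \oc ((X |> g <| W) \oc br Z X W)).

Lemma conjE X W : conj X W = bri Z' X W \oc ((X |> g <| W) \oc br Z X W).
Proof. by rewrite /conj -lock. Qed.

Lemma conj_natural : @natural_family k C (mcons Z (mone C)) (mcons Z' (mone C)) conj.
Proof.
split=> [X X' f W|X W W' f] /=; rewrite !conjE.
  rewrite -!compmA br_natl (compmA (_ |> _)) -interchange !compmA.
  by rewrite bri_natl.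
rewrite -!compmA br_natr (compmA (_ |> _)) -tensm_idl interchange tensm_idl !compmA.
by rewrite bri_natr.
Qed.

Lemma conj_tens X Y W :
  ((Z' : C) |> assoc X Y W) \oc conj (X \ox Y) W \oc ((Z : C) |> associ X Y W)
  = bri Z' X (Y \ox W) \oc (X |> conj Y W) \oc br Z X (Y \ox W).
Proof.
have e : assoc X Y (Z' \ox W) \oc ((X \ox Y) |> g <| W)
   = (X |> Y |> g <| W) \oc assoc X Y (Z \ox W) by rewrite -(tensm1 X) assoc_nat.
rewrite !conjE !tensm_idl !compmA -bri_tens.
rewrite -(compmA _ (_ |> br _ _ _)) -br_tens !compmA.
rewrite -(compmA _ _ (assoc X Y _)) -e !compmA.
by rewrite (comp_rw1 _ (assocK _ _ _)) compm1.
Qed.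

Lemma modular_conj X F : @modular k C (mcons Z (mcons X F)) (mcons Z' (mcons X F))
  (fun W => conj X (F W)).
Proof.
apply: (@modular_eq _ _ (mcons Z (mcons X F)) (mcons Z' (mcons X F)) _ _
  (fun W => conjE X (F W))).
exact: (modular_comp (modular_comp (modular_br Z X F) (modular_cons X (modular_act F g)))
  (modular_bri Z' X F)).
Qed.

End Conjugate.

Section Average.
Variables (m : nat) (V : 'I_m -> C).
Hypothesis schur_neq : forall i j (c : hom (V i) (V j)), i != j -> c = 0.
Hypothesis schur_eq : forall i (c : hom (V i) (V i)), exists s, c = s *: idm (V i).
Variable rs : forall M, resolution V M.
Variable d : 'I_m -> k.
Hypothesis dE : forall i W, ev (V i) W \oc cr p (V i) W = d i *: idm W.

Section Central.
Variables (Z Z' : center_obj C) (g : hom (Z : C) (Z' : C)).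

Let cptr X W : hom ((Z : C) \ox W) ((Z' : C) \ox W) :=
  @ptr k C p (mcons Z (mone C)) (mcons Z' (mone C)) (conj g) X W.

Let modular_cptr X : @modular k C (mcons Z (mone C)) (mcons Z' (mone C)) (cptr X).
Proof.
apply: (@modular_eq _ _ (mcons Z (mone C)) (mcons Z' (mone C)) _ _
  (fun W => @ptrE k C p (mcons Z (mone C)) (mcons Z' (mone C)) (conj g) X W)).
exact: (modular_comp (modular_cons Z (modular_cvs X (mone C)))
  (modular_comp (modular_conj g X (mcons (star X) (mone C)))
     (modular_cons Z' (modular_er p X (mone C))))).
Qed.

Let avgn W := \sum_j d j *: cptr (V j) W.

Let modular_avgn : @modular k C (mcons Z (mone C)) (mcons Z' (mone C)) avgn.
Proof. by apply: modular_sum => j; apply: modular_scale; exact: modular_cptr. Qed.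

Definition avg : hom (Z : C) (Z' : C) := mor11 avgn.

Lemma avgE W : avg <| W = \sum_j d j *:
   @ptr k C p (mcons Z (mone C)) (mcons Z' (mone C)) (conj g) (V j) W.
Proof. by rewrite -(mor11E modular_avgn). Qed.

(** The handle slide moves the strand Y into the averaged loops, where conjugation by [Y \ox V j] is
    conjugation by V j followed by one by Y; the latter cancels the half-braiding with Y. *)
Lemma avg_central : avg \in @center_hom_pred k C Z Z'.
Proof.
apply: center_hom_nested => Y W; rewrite !avgE.
have := kirby_slide (conj_natural g) schur_neq schur_eq rs dE Y W; rewrite /= => <-.
rewrite compm_sumr tensm_sumr compm_suml; apply: eq_bigr => j _.
rewrite compmZr tensmZr compmZl; congr (_ *: _).
rewrite -(compmA (_ |> _) _ (conj _ _ _)).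
rewrite -2!(compmA (Z' |> Y |> _)) conj_tens ptrE /= !compmA br_natr.
rewrite (comp_rw1 _ (briK _ _ _)) compm1 -compmA br_natr.
by rewrite !tensm_idl !compmA.
Qed.

End Central.

(** Since f commutes with the half-braidings, surrounding [conj g] by f conjugates f g f = f and
    gives f again. Each strand then closes to a free loop of value dd j. *)
Lemma avg_regular (dd : 'I_m -> k)
    (ddE : forall i W, er p (V i) W \oc cv (V i) W = dd i *: idm W)
    Z Z' (f : center_hom Z Z') (g : hom (Z' : C) (Z : C)) :
  (f : hom (Z : C) (Z' : C)) \oc g \oc f = f ->
  (f : hom (Z : C) (Z' : C)) \oc avg g \oc f
  = (\sum_j d j * dd j) *: (f : hom (Z : C) (Z' : C)).
Proof.
move=> fgf; apply: tensm_faithful => W; rewrite !tensm_idr avgE.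
rewrite compm_sumr compm_suml tensmZl scaler_suml; apply: eq_bigr => j _.
rewrite compmZr compmZl -scalerA; congr (_ *: _).
have bf X W' : (f : hom (Z : C) (Z' : C)) <| (X \ox W') \oc bri Z X W'
    = bri Z' X W' \oc (X |> (f : hom (Z : C) (Z' : C)) <| W').
  rewrite -[LHS]comp1m -(brK Z' X W') -!compmA; congr (_ \oc _).
  by rewrite compmA center_homE -compmA briK compm1.
have e X W' : (f : hom (Z : C) (Z' : C)) <| (X \ox W') \oc conj g X W' \oc (f <| (X \ox W'))
    = f <| (X \ox W').
  rewrite conjE -!compmA center_homE !compmA bf.
  have fgf' : (X |> (f : hom (Z : C) (Z' : C)) <| W') \oc (X |> g <| W')
      \oc (X |> (f : hom (Z : C) (Z' : C)) <| W')
      = X |> (f : hom (Z : C) (Z' : C)) <| W' by rewrite -!tensm_idl -!tensm_idr fgf.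
  by rewrite -!(compmA (bri _ _ _)) fgf' -center_homE compmA brK comp1m.
rewrite ptrE /= !compmA (comp_rw2 _ (esym (interchange _ _))) interchange.
rewrite -!(compmA ((Z' : C) |> _)) e compmA -interchange -compmA -tensm_idl ddE.
by rewrite tensmZr tensm1 compmZr compm1.
Qed.

(** * Encircling a morphism to the unit by a loop *)

Section Action.
Variables (Z : center_obj C) (f : hom (Z : C) one).
Let fn W : hom ((Z : C) \ox W) W := lunit W \oc (f <| W).

Definition pull X W : hom ((Z : C) \ot X \ot W) (X \ox W) :=
  locked ((X |> fn W) \oc br Z X W).

Lemma pullE X W : pull X W = (X |> (lunit W \oc (f <| W))) \oc br Z X W.
Proof. by rewrite /pull -lock. Qed.

Let modular_fn F : @modular k C (mcons Z F) F (fun W => fn (F W)).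
Proof.
split=> [W W' u|A W] /=; rewrite /fn.
  by rewrite -compmA interchange compmA lunit_nat compmA.
rewrite tensm_idr -lunit_tens !compmA -(compmA (lunit _)) interchange.
rewrite compmA lunit_nat -!compmA; congr (_ \oc (_ \oc _)).
by rewrite assoc_nat tensm1.
Qed.

Lemma modular_pull X F :
  @modular k C (mcons Z (mcons X F)) (mcons X F) (fun W => pull X (F W)).
Proof.
apply: (@modular_eq _ _ (mcons Z (mcons X F)) (mcons X F) _ _
  (fun W => pullE X (F W))).
exact: (modular_comp (modular_br Z X F) (modular_cons X (modular_fn F))).
Qed.

Lemma pull_natural : @natural_family k C (mcons Z (mone C)) (mone C) pull.
Proof.
split=> [X X' u W|X W W' u] /=; last first.
  by have [e _] := modular_pull X (mone C); exact: e.
by rewrite !pullE -!compmA br_natl compmA -interchange !compmA.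
Qed.

Lemma pull_tens X Y W :
  assoc X Y W \oc pull (X \ox Y) W \oc ((Z : C) |> associ X Y W)
  = (X |> pull Y W) \oc br Z X (Y \ox W).
Proof.
rewrite !pullE (tensm_idl X (Y |> _)) -[RHS]compmA -br_tens !compmA.
by rewrite -[((X \ox Y) |> _)]/(idm (X \ox Y) \om _) -(tensm1 X Y) assoc_nat.
Qed.

Let actn X W : hom ((Z : C) \ox W) W := @ptr k C p (mcons Z (mone C)) (mone C) pull X W.

Let modular_actn X : @modular k C (mcons Z (mone C)) (mone C) (actn X).
Proof.
apply: (@modular_eq _ _ (mcons Z (mone C)) (mone C) _ _
  (fun W => @ptrE k C p (mcons Z (mone C)) (mone C) pull X W)).
exact: (modular_comp (modular_cons Z (modular_cvs X (mone C)))
  (modular_comp (modular_pull X (mcons (star X) (mone C)))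
     (modular_er p X (mone C)))).
Qed.

(* The class of X acts on Hom(U Z, 1) by encircling a morphism with a loop
   coloured by X. *)
Definition act X : hom (Z : C) one := mor10 (actn X).

Lemma actE X W : lunit W \oc (act X <| W) =
  @ptr k C p (mcons Z (mone C)) (mone C) pull X W.
Proof. by rewrite -(mor10E (modular_actn X)). Qed.

Lemma act_split n (S : 'I_n -> C) X (inj : forall i, hom (S i) X)
    (prj : forall i, hom X (S i)) :
  (forall i, prj i \oc inj i = idm (S i)) -> \sum_i inj i \oc prj i = idm X ->
  act X = \sum_i act (S i).
Proof.
move=> e1 e2; apply: to_unit_faithful => W; rewrite actE (ptr_split p pull_natural W e1 e2).
by rewrite tensm_suml compm_sumr; apply: eq_bigr => i _; rewrite actE.
Qed.

Lemma act_iso X Y : isomorphic X Y -> act X = act Y.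
Proof.
move=> XY; apply: to_unit_faithful => W; rewrite !actE; exact: (ptr_iso p pull_natural W XY).
Qed.

Lemma act_kirby Y c : (forall W, er p Y W \oc cv Y W = c *: idm W) ->
  \sum_j d j *: act (Y \ox V j) = c *: \sum_j d j *: act (V j).
Proof.
move=> e; apply: to_unit_faithful => W.
have := kirby_absorb pull_natural schur_neq schur_eq rs dE W e.
rewrite tensmZl compmZr !tensm_suml !compm_sumr.
under eq_bigr do rewrite -actE -compmZr -tensmZl.
move=> ->; congr (_ *: _); apply: eq_bigr => j _.
by rewrite -actE -compmZr -tensmZl.
Qed.

End Action.

Lemma pull_act Z (f : hom (Z : C) one) Y X W :
  pull (act f Y) X W = (X |> @ptr k C p (mcons Z (mone C)) (mone C) (pull f) Y W) \oc br Z X W.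
Proof. by rewrite pullE actE. Qed.

Lemma act_tens Z (f : hom (Z : C) one) X Y :
  act f (X \ox Y) = act (act f Y) X.
Proof.
apply: to_unit_faithful => W; rewrite !actE (ptr_tens p (pull_natural f)) ptrE /= pull_act.
rewrite -(compmA (X |> _) _ (pull _ _ _)) -2!(compmA (X |> er _ _ _)) pull_tens.
rewrite ptrE /= !compmA; congr (_ \oc _).
rewrite -!compmA; congr (_ \oc _); rewrite !compmA -(compmA _ (br _ _ _)) br_natr.
by rewrite !tensm_idl !compmA.
Qed.

(** A morphism of the center slides through the crossing, so the action is natural in Z and the
    Yoneda lemma applies. *)
Lemma act_comp Z Z' (f : hom (Z' : C) one) (g : center_hom Z Z') X :
  act (f \oc (g : hom (Z : C) (Z' : C))) X = act f X \oc (g : hom (Z : C) (Z' : C)).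
Proof.
apply: to_unit_faithful => W; rewrite actE tensm_idr compmA actE !ptrE /=.
rewrite -[RHS]compmA -interchange !pullE -[RHS]compmA.
rewrite (compmA ((X |> _) \oc _)) -(compmA (X |> _)) center_homE.
by rewrite tensm_idr !tensm_idl !compmA.
Qed.

Lemma act_lin Z a (f g : hom (Z : C) one) X : act (a *: f + g) X = a *: act f X + act g X.
Proof.
apply: to_unit_faithful => W; rewrite tensmDl tensmZl compmDr compmZr !actE !ptrE /=.
rewrite !pullE tensmDl tensmZl compmDr compmZr tensmDr tensmZr.
by rewrite !(compmDl, compmDr, compmZl, compmZr).
Qed.

End Average.

(* Multiplicativity makes the half-braiding with 1 idempotent, up to the unit
   constraints, hence trivial. *)
Lemma br_one Z W : br Z one W = luniti _ \oc ((Z : C) |> lunit W).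
Proof.
have e : lunit (Z \ox (one \ox W)) \oc br Z one (one \ox W)
    = (Z : C) |> lunit (one \ox W).
  have := br_tens Z one one W.
  move/(congr1 (fun g => lunit (one \ox (Z \ox W)) \oc g)).
  rewrite !compmA lunit_tens -br_natl lunit_nat -compmA -tensm_idl -lunit_tens -compmA.
  rewrite associK compm1 => /(congr1 (fun g => bri Z one W \oc g)).
  by rewrite !compmA brK !comp1m => <-.
have inj (g g' : hom ((Z : C) \ot one \ot W) (Z \ox W)) :
    g \oc ((Z : C) |> one |> lunit W) = g' \oc ((Z : C) |> one |> lunit W) -> g = g'.
  move/(congr1 (fun u => u \oc ((Z : C) |> one |> luniti W))).
  by rewrite -!compmA -!tensm_idl lunitiK !tensm1 !compm1.
rewrite -[LHS]comp1m -(lunitK (Z \ox W)) -compmA; congr (_ \oc _); apply: inj.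
rewrite -compmA br_natr compmA lunit_nat -compmA e -!tensm_idl.
by rewrite lunit_nat.
Qed.

Lemma act_one Z (f : hom (Z : C) one) : act f one = f.
Proof.
apply: to_unit_faithful => W; rewrite actE ptrE /= pullE br_one.
rewrite (compmA (one |> _)) -luniti_nat !compmA.
rewrite -(compmA _ _ ((Z : C) |> lunit _)) -(compmA _ _ ((Z : C) |> cv _ _)).
rewrite -(compmA _ ((Z : C) |> lunit _)) -tensm_idl interchange !compmA.
rewrite -(compmA _ (lunit _) (_ |> _)) lunit_nat !compmA (comp_rw1 _ (lunitK _)).
by rewrite compm1 er_cv_one comp1m.
Qed.

End Averaging.

(** * The object representing Hom(U -, 1) *)

Section TraceObject.
Variables (k : fieldType) (C : rigidcat k) (p : pivotal_structure C).
Local Notation one := (unit_obj C).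
Implicit Types (X Y W A B : C) (F G : mfun C) (Z : center_obj C).
Variables (m : nat) (V : 'I_m -> C).
Hypothesis schur_neq : forall i j (c : hom (V i) (V j)), i != j -> c = 0.
Hypothesis schur_eq : forall i (c : hom (V i) (V i)), exists s, c = s *: idm (V i).
Variable rs : forall M, resolution V M.
Variables (T : C) (inc : forall i, hom (V i \ox star (V i)) T)
  (pr : forall i, hom T (V i \ox star (V i))).
Hypothesis prK : forall i, pr i \oc inc i = idm _.
Hypothesis pr_neq : forall i j, i != j -> pr i \oc inc j = 0.
Hypothesis incK : \sum_i inc i \oc pr i = idm T.

Definition prn i W : hom (T \ox W) (V i \ot star (V i) \ot W) :=
  locked (assoc (V i) (star (V i)) W \oc (pr i <| W)).
Definition incn i W : hom (V i \ot star (V i) \ot W) (T \ox W) :=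
  locked ((inc i <| W) \oc associ (V i) (star (V i)) W).

Lemma prnE i W : prn i W = assoc (V i) (star (V i)) W \oc (pr i <| W).
Proof. by rewrite /prn -lock. Qed.
Lemma incnE i W : incn i W = (inc i <| W) \oc associ (V i) (star (V i)) W.
Proof. by rewrite /incn -lock. Qed.

Lemma prn_incn i W : prn i W \oc incn i W = idm _.
Proof.
rewrite prnE incnE !compmA (comp_rw1 _ (esym (tensm_idr _ _ _))) prK tensm1 compm1.
by rewrite associK.
Qed.

Lemma prn_incn_neq i j W : i != j -> prn i W \oc incn j W = 0.
Proof.
move=> ne; rewrite prnE incnE !compmA (comp_rw1 _ (esym (tensm_idr _ _ _))).
by rewrite pr_neq // tensm0l compm0 comp0m.
Qed.

Lemma incn_prn W : \sum_i incn i W \oc prn i W = idm (T \ox W).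
Proof.
rewrite -(tensm1 T) -incK tensm_suml; apply: eq_bigr => i _.
rewrite prnE incnE !compmA (comp_rw1 _ (assocK _ _ _)) compm1.
by rewrite -tensm_idr.
Qed.

Lemma modular_prn i F :
  @modular k C (mcons T F) (mcons (V i) (mcons (star (V i)) F)) (fun W => prn i (F W)).
Proof.
apply: (@modular_eq _ _ (mcons T F) (mcons (V i) (mcons (star (V i)) F)) _ _
  (fun W => prnE i (F W))).
exact: (modular_comp (modular_act F (pr i)) (modular_split (V i) (star (V i)) F)).
Qed.

Lemma modular_incn i F :
  @modular k C (mcons (V i) (mcons (star (V i)) F)) (mcons T F) (fun W => incn i (F W)).
Proof.
apply: (@modular_eq _ _ (mcons (V i) (mcons (star (V i)) F)) (mcons T F) _ _
  (fun W => incnE i (F W))).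
exact: (modular_comp (modular_merge (V i) (star (V i)) F) (modular_act F (inc i))).
Qed.

Lemma prn_nat i W W' (f : hom W W') :
  prn i W' \oc (T |> f) = (V i |> star (V i) |> f) \oc prn i W.
Proof. by have [e _] := modular_prn i (mone C); exact: e. Qed.

(* The universal dinatural family T -> X \ox X^*, with a word F in between. *)
Definition dinat F X W : hom (T \ox F W) (F (X \ot star X \ot W)) :=
  locked (\sum_i \sum_a kpair (rinj (rs (F X)) i a) (rprj (rs (F X)) i a) W
                         \oc prn i (F W)).

Lemma dinatE F X W : dinat F X W =
  \sum_i \sum_a kpair (rinj (rs (F X)) i a) (rprj (rs (F X)) i a) W \oc prn i (F W).
Proof. by rewrite /dinat -lock. Qed.

(** Admitting all words F makes this natural along every modular family; the choices [er] and [cr]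
    then yield invertibility, and [assoc] the tensor axiom. *)
Definition tbr F W : hom (T \ox F W) (F (T \ox W)) :=
  locked (\sum_j mmap F (incn j W) \oc dinat F (V j) W).

Lemma prn_tbr F j W : mmap F (prn j W) \oc tbr F W = dinat F (V j) W.
Proof.
rewrite /tbr -lock compm_sumr (bigD1 j) //= big1 ?addr0 => [|i ij].
  by rewrite compmA -mmapM prn_incn mmap1 comp1m.
by rewrite compmA -mmapM prn_incn_neq ?mmap0 ?comp0m // eq_sym.
Qed.

Lemma kpair_post F G X U (phi : forall W, hom (F W) (G W)) (x : hom U (F X))
    (y : hom (F X) U) W : modular phi ->
  phi (X \ot star X \ot W) \oc kpair x y W = kpair (phi X \oc x) y W.
Proof.
move=> [_ e]; rewrite !kpairE !compmA e tensm_idr !compmA //.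
Qed.

Lemma kpair_pre F G X U (phi : forall W, hom (F W) (G W)) (x : hom U (G X))
    (y : hom (G X) U) W : modular phi ->
  kpair x y W \oc (U |> star U |> phi W) = kpair x (y \oc phi X) W.
Proof.
by move=> mphi; rewrite !kpairE -compmA -tensm_idl sharp_modular.
Qed.

(** The Casimir slide for [kpair]: a modular family acts by composition on either entry of a
    pair. *)
Lemma dinat_nat F G X (phi : forall W, hom (F W) (G W)) W : modular phi ->
  phi (X \ot star X \ot W) \oc dinat F X W = dinat G X W \oc (T |> phi W).
Proof.
move=> mphi; rewrite !dinatE compm_sumr compm_suml.
pose beta i (x : hom (V i) (G X)) (y : hom (F X) (V i)) := kpair x y W \oc prn i (F W).
transitivity (\sum_i \sum_a beta i (phi X \oc rinj (rs (F X)) i a) (rprj (rs (F X)) i a)).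
  apply: eq_bigr => i _; rewrite compm_sumr; apply: eq_bigr => a _.
  by rewrite compmA kpair_post.
rewrite (casimir_slide schur_neq schur_eq _ _ _ _ (phi X) _ (rs (G X))).
- apply: eq_bigr => i _; rewrite compm_suml; apply: eq_bigr => a _.
  by rewrite /beta -kpair_pre // -!compmA prn_nat.
- by move=> *; rewrite /beta kpairDl compmDl.
- by move=> *; rewrite /beta kpairDr compmDl.
- by move=> *; rewrite /beta kpairZl compmZl.
- by move=> *; rewrite /beta kpairZr compmZl.
Qed.

Lemma tbr_nat F G (phi : forall W, hom (F W) (G W)) W : modular phi ->
  phi (T \ox W) \oc tbr F W = tbr G W \oc (T |> phi W).
Proof.
move=> mphi; rewrite /tbr -!lock compm_sumr compm_suml; apply: eq_bigr => j _.
have [e _] := mphi.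
by rewrite compmA e -compmA dinat_nat // compmA.
Qed.

(** By Schur's lemma only i = j contributes, and there the entries are scalars whose products sum to
    the identity. *)
Lemma dinat_simple j W : dinat (mone C) (V j) W = prn j W.
Proof.
rewrite dinatE /= (bigD1 j) //= [X in _ + X]big1 ?addr0 => [|i ij]; last first.
  apply: big1 => a _; rewrite kpairE /=.
  by rewrite (schur_neq (rinj (rs (V j)) i a) ij) tensm0l compm0 !comp0m.
have res : \sum_a rinj (rs (V j)) j a \oc rprj (rs (V j)) j a = idm (V j).
  have := resolutionP (rs (V j)); rewrite (bigD1 j) //= [X in _ + X]big1 ?addr0 // => i ij.
  by apply: big1 => a _; rewrite (schur_neq (rinj (rs (V j)) i a) ij) comp0m.
transitivity (\sum_a @kpair _ _ (mone C) (mone C) (V j) (V j) (idm _)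
   (rinj (rs (V j)) j a \oc rprj (rs (V j)) j a) W \oc prn j W).
  apply: eq_bigr => a _; congr (_ \oc _).
  have [s ->] := schur_eq (rinj (rs (V j)) j a).
  by rewrite kpairZl compmZl kpairZr comp1m.
rewrite -compm_suml -[RHS]comp1m; congr (_ \oc _).
transitivity (@kpair _ _ (mone C) (mone C) (V j) (V j) (idm _)
   (\sum_a rinj (rs (V j)) j a \oc rprj (rs (V j)) j a) W).
  rewrite kpairE sharp_sum tensm_sumr compm_sumr.
  by apply: eq_bigr => a _; rewrite kpairE.
by rewrite res kpairE sharp_id !tensm1 !comp1m.
Qed.

Lemma tbr_one W : tbr (mone C) W = idm _.
Proof.
rewrite /tbr -lock -incn_prn; apply: eq_bigr => j _; rewrite dinat_simple //.
Qed.

(** Resolving first G X by the V j and then each [Y \ox V j] gives the same tensor as resolving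
    [Y \ox G X] directly. *)
Lemma dinat_cons Y G X W :
  dinat (mcons Y G) X W = (Y |> dinat G X W) \oc tbr (mcons Y (mone C)) (G W).
Proof.
pose Fw := mcons Y (mone C).
pose beta i (x : hom (V i) (Y \ox G X)) (y : hom (Y \ox G X) (V i)) :=
  @kpair _ _ (mcons Y G) (mcons Y G) X (V i) x y W \oc prn i (Y \ox G W).
have betaE i j (x : hom (V i) (Y \ox V j)) (y : hom (Y \ox V j) (V i))
   (u : hom (V j) (G X)) (v : hom (G X) (V j)) :
  (Y |> kpair u v W) \oc (@kpair _ _ Fw Fw (V j) (V i) x y (G W) \oc prn i (Y \ox G W))
  = beta i ((Y |> u) \oc x) (y \oc (Y |> v)).
  rewrite /beta compmA; congr (_ \oc _); rewrite !kpairE sharp_cons tensm_idr.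
  rewrite /= !tensm1 !comp1m !tensm_idl !compmA.
  rewrite -(compmA _ _ (assoc Y (V j) _)) -assoc_nat tensm1 !compmA.
  rewrite -(compmA _ _ (x <| _)) -interchange !compmA; congr (_ \oc _ \oc _ \oc _).
  by rewrite -!compmA assoc_nat.
rewrite !dinatE tensm_sumr compm_suml.
transitivity (\sum_j \sum_b \sum_i \sum_a beta i
   ((Y |> rinj (rs (G X)) j b) \oc ((Y |> rprj (rs (G X)) j b) \oc rinj (rs (Y \ox G X)) i a))
   (rprj (rs (Y \ox G X)) i a)).
  transitivity (\sum_i \sum_a \sum_j \sum_b beta i
     ((Y |> rinj (rs (G X)) j b) \oc ((Y |> rprj (rs (G X)) j b) \oc rinj (rs (Y \ox G X)) i a))
     (rprj (rs (Y \ox G X)) i a)); last first.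
    under eq_bigr do rewrite exchange_big /=.
    rewrite exchange_big /=; apply: eq_bigr => j _.
    under eq_bigr do rewrite exchange_big /=.
    by rewrite exchange_big.
  apply: eq_bigr => i _; apply: eq_bigr => a _; rewrite /beta.
  under eq_bigr do rewrite -compm_suml -kpair_suml.
  rewrite -compm_suml -kpair_suml; congr (kpair _ _ W \oc _).
  under eq_bigr do under eq_bigr do rewrite compmA -tensm_idl.
  under eq_bigr do rewrite -compm_suml -tensm_sumr.
  by rewrite -compm_suml -tensm_sumr resolutionP tensm1 comp1m.
apply: eq_bigr => j _; rewrite tensm_sumr compm_suml; apply: eq_bigr => b _.
set u := rinj _ _ _; set v := rprj _ _ _.
pose beta' i (x : hom (V i) (Y \ox V j)) (y : hom (Y \ox G X) (V i)) :=
  beta i ((Y |> u) \oc x) y.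
(* Sliding [Y |> v] replaces the resolution of [Y \ox G X] by that of [Y \ox V j]. *)
have := @casimir_slide _ _ _ V schur_neq schur_eq _ _ _ beta' _ _ _ _
   (Y |> v) (rs (Y \ox G X)) (rs (Y \ox V j)).
rewrite /beta' => -> //; first last.
- by move=> *; rewrite /beta kpairZr compmZl.
- by move=> *; rewrite /beta compmZr kpairZl compmZl.
- by move=> *; rewrite /beta kpairDr compmDl.
- by move=> *; rewrite /beta compmDr kpairDl compmDl.
rewrite tensm_idl -compmA (prn_tbr Fw) dinatE compm_sumr; apply: eq_bigr => i _.
by rewrite compm_sumr; apply: eq_bigr => a _; rewrite betaE.
Qed.

Lemma tbr_cons Y G W :
  tbr (mcons Y G) W = (Y |> tbr G W) \oc tbr (mcons Y (mone C)) (G W).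
Proof.
rewrite {1 2}/tbr -!lock tensm_sumr compm_suml; apply: eq_bigr => j _.
by rewrite dinat_cons tensm_idl compmA.
Qed.

Lemma modular_dinat1 Y X G : @modular k C (mcons T (mcons Y G))
   (mcons Y (mcons X (mcons (star X) G))) (fun W => dinat (mcons Y (mone C)) X (G W)).
Proof.
apply: (@modular_eq _ _ (mcons T (mcons Y G)) (mcons Y (mcons X (mcons (star X) G))) _ _
  (fun W => dinatE (mcons Y (mone C)) X (G W))).
apply: modular_sum => i; apply: modular_sum => a.
apply: (modular_comp (modular_prn i (mcons Y G))).
set x := rinj _ _ _; set y := rprj _ _ _.
apply: (@modular_eq _ _ (mcons (V i) (mcons (star (V i)) (mcons Y G)))
  (mcons Y (mcons X (mcons (star X) G))) (fun W => assoc Y X (star X \ox G W) \oc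
   ((x <| (star X \ox G W)) \oc (V i |> @sharp _ _ (mcons Y (mone C)) X (V i) y (G W))))).
  by move=> W; rewrite kpairE /= tensm1 comp1m compmA.
exact: (modular_comp (modular_comp (modular_cons (V i) (modular_sharp y G))
  (modular_act (mcons (star X) G) x)) (modular_split Y X (mcons (star X) G))).
Qed.

Lemma modular_dinat0 X G : @modular k C (mcons T G)
   (mcons X (mcons (star X) G)) (fun W => dinat (mone C) X (G W)).
Proof.
apply: (@modular_eq _ _ (mcons T G) (mcons X (mcons (star X) G)) _ _
  (fun W => dinatE (mone C) X (G W))).
apply: modular_sum => i; apply: modular_sum => a.
apply: (modular_comp (modular_prn i G)).
set x := rinj _ _ _; set y := rprj _ _ _.
apply: (@modular_eq _ _ (mcons (V i) (mcons (star (V i)) G))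
  (mcons X (mcons (star X) G)) (fun W =>
   (x <| (star X \ox G W)) \oc (V i |> starm y <| G W))).
  by move=> W; rewrite kpairE /= comp1m sharp_starm.
exact: (modular_comp (modular_cons (V i) (modular_act G (starm y)))
  (modular_act (mcons (star X) G) x)).
Qed.

Lemma modular_tbr1 Y G : @modular k C (mcons T (mcons Y G)) (mcons Y (mcons T G))
   (fun W => tbr (mcons Y (mone C)) (G W)).
Proof.
apply: (@modular_eq _ _ (mcons T (mcons Y G)) (mcons Y (mcons T G))
   (fun W => \sum_j (Y |> incn j (G W)) \oc dinat (mcons Y (mone C)) (V j) (G W))).
  by move=> W; rewrite /tbr -lock.
apply: modular_sum => j; apply: (modular_comp (modular_dinat1 Y (V j) G)).
exact: modular_cons (modular_incn j G).
Qed.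

Let Fw Y := mcons Y (mone C).

(** Rigidity inverts the half-braiding: it is the half-braiding with [star Y], bent by [er] and
    [cr]. Naturality along these two families makes the composites trivial. *)
Let tbri Y W : hom (Y \ot T \ot W) (T \ot Y \ot W) :=
  er p Y (T \ot Y \ot W) \oc (Y |> tbr (Fw (star Y)) (Y \ox W)) \oc
  (Y |> T |> cr p Y W).

Let tbr1_nat Y W W' (f : hom W W') :
  tbr (Fw Y) W' \oc (T |> Y |> f) = (Y |> T |> f) \oc tbr (Fw Y) W.
Proof. by have [e _] := modular_tbr1 Y (mone C); exact: e. Qed.

Let tbriK Y W : tbri Y W \oc tbr (Fw Y) W = idm _.
Proof.
rewrite /tbri -compmA -tbr1_nat !compmA.
have := tbr_cons Y (Fw (star Y)) (Y \ox W) => /= e.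
rewrite -(compmA _ _ (tbr (Fw Y) _)) -e.
rewrite (tbr_nat (Y \ox W) (modular_er p Y (mone C))) tbr_one comp1m.
by rewrite -tensm_idl er_cr tensm1.
Qed.

Let tbrKi Y W : tbr (Fw Y) W \oc tbri Y W = idm _.
Proof.
rewrite /tbri !compmA -er_nat -!(compmA (er p Y _)) -tensm_idl -tensm_idl.
have := tbr_cons (star Y) (Fw Y) W => /= e; rewrite -e.
rewrite -(tbr_nat W (modular_cr p Y (mone C))) tbr_one compm1.
by rewrite er_cr.
Qed.

Let tbr_natl X Y (f : hom X Y) W :
  tbr (Fw Y) W \oc (T |> f <| W) = (f <| (T \ox W)) \oc tbr (Fw X) W.
Proof. by rewrite -(tbr_nat W (modular_act (mone C) f)). Qed.

Let tbr_tens X Y W :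
  assoc X Y (T \ox W) \oc tbr (Fw (X \ox Y)) W \oc (T |> associ X Y W)
  = (X |> tbr (Fw Y) W) \oc tbr (Fw X) (Y \ox W).
Proof.
rewrite -(tbr_cons X (Fw Y)) (tbr_nat W (modular_split X Y (mone C))) -compmA.
by rewrite -tensm_idl associK tensm1 compm1.
Qed.

Definition trace_obj : center_obj C :=
  make_center tbriK tbrKi (fun X => modular_tbr1 X (mone C)) tbr_natl tbr_tens.

Lemma br_trace_obj X W : br trace_obj X W = tbr (mcons X (mone C)) W.
Proof. exact: br_make_center. Qed.

Definition tfun X W : hom (T \ox W) W := locked (er p X W \oc dinat (mone C) X W).

Lemma tfunE X W : tfun X W = er p X W \oc dinat (mone C) X W.
Proof. by rewrite /tfun -lock. Qed.

Let modular_tfun X : @modular k C (mcons T (mone C)) (mone C) (tfun X).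
Proof.
apply: (@modular_eq _ _ (mcons T (mone C)) (mone C) _ _ (tfunE X)).
exact: (modular_comp (modular_dinat0 X (mone C)) (modular_er p X (mone C))).
Qed.

(** The element of Hom(T, 1) that corresponds to the class [X]. *)
Definition tmor X : hom T one := mor10 (tfun X).

Lemma tmorE X W : lunit W \oc (tmor X <| W) = er p X W \oc dinat (mone C) X W.
Proof. by rewrite -(mor10E (modular_tfun X)) tfunE. Qed.

Lemma tmor_simpleE j W : lunit W \oc (tmor (V j) <| W) = er p (V j) W \oc prn j W.
Proof. by rewrite tmorE dinat_simple. Qed.

(** Closed by [er], a pair x, y contributes only through the endomorphism [y \oc x] of V i. The
    Casimir slide carries the isomorphism from a resolution of X to one of Y. *)
Lemma tmor_iso X Y : isomorphic X Y -> tmor X = tmor Y.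
Proof.
move=> [u [v [vu uv]]].
suff e W : er p X W \oc dinat (mone C) X W = er p Y W \oc dinat (mone C) Y W.
  by apply: to_unit_faithful => W; rewrite !tmorE e.
pose E i (c : hom (V i) (V i)) := er p (V i) W \oc (V i |> starm c <| W) \oc prn i W.
have pairE M i (x : hom (V i) M) (y : hom M (V i)) :
    er p M W \oc (@kpair _ _ (mone C) (mone C) M (V i) x y W \oc prn i W) = E i (y \oc x).
  rewrite /E sharp_starm -sharp_comp tensm_idl kpairE /= comp1m !compmA.
  by rewrite -er_starm sharp_starm.
have ED i (c c' : hom (V i) (V i)) : E i (c + c') = E i c + E i c'.
  by rewrite /E !sharp_starm sharpD tensmDr compmDr compmDl.
have EZ i a (c : hom (V i) (V i)) : E i (a *: c) = a *: E i c.
  by rewrite /E !sharp_starm sharpZ tensmZr compmZr compmZl.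
have := @casimir_slide _ _ _ V schur_neq schur_eq _ _ _
  (fun i (x : hom (V i) Y) (y : hom X (V i)) => E i (y \oc (v \oc x))) _ _ _ _ u (rs X) (rs Y).
rewrite !dinatE /= !compm_sumr => eXY.
transitivity (\sum_i \sum_a E i (rprj (rs X) i a \oc (v \oc (u \oc rinj (rs X) i a)))).
  apply: eq_bigr => i _; rewrite compm_sumr; apply: eq_bigr => a _.
  by rewrite pairE (compmA v) vu comp1m.
rewrite eXY; first last.
- by move=> i a x y; rewrite compmZl EZ.
- by move=> i a x y; rewrite !compmZr EZ.
- by move=> i x y y'; rewrite compmDl ED.
- by move=> i x x' y; rewrite !compmDr ED.
apply: eq_bigr => i _; rewrite compm_sumr; apply: eq_bigr => a _.
by rewrite pairE -(compmA _ u) (compmA u) uv comp1m.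
Qed.

Lemma delta_sharp X Y U (y : hom (X \ox Y) U) W :
  delta X Y W \oc @sharp _ _ (mone C) (X \ox Y) U y W
  = @sharp _ _ (mcons X (mone C)) Y U y (star X \ox W) \oc (star U |> cv X W).
Proof.
rewrite !sharpE /= tensm1 !compm1 (compmA (delta _ _ _)) -ev_nat -!(compmA (ev _ _)).
rewrite -!tensm_idl; congr (_ \oc (_ |> _)).
rewrite compmA -interchange -!compmA; congr (_ \oc _).
by rewrite -cv_tens !compmA assocK comp1m.
Qed.

(** Identifies the action on Hom(U(T), 1) with left multiplication of classes; [dinat_cons] absorbs
    the half-braiding that the X-loop crosses. *)
Lemma act_tmor X Y : act p (tmor Y : hom (trace_obj : C) one) X = tmor (X \ox Y).
Proof.
apply: to_unit_faithful => W; rewrite actE tmorE ptrE /= pullE tmorE tensm_idl br_trace_obj.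
have := dinat_cons X (mone C) Y (star X \ox W).
rewrite /= -!(compmA (X |> er _ _ _)) => <-.
rewrite er_tens -!compmA; congr (_ \oc (_ \oc _)).
rewrite !dinatE /= compm_suml !compm_sumr; apply: eq_bigr => i _.
rewrite compm_suml !compm_sumr; apply: eq_bigr => a _.
set x := rinj _ _ _; set y := rprj _ _ _.
rewrite -[LHS]compmA prn_nat !compmA; congr (_ \oc _).
rewrite !kpairE /= tensm1 !comp1m.
rewrite [RHS]compmA (comp_rw2 _ (esym (interchange _ _))).
rewrite -[LHS]compmA -[RHS]compmA -!tensm_idl.
by rewrite delta_sharp.
Qed.

(** * The universal property of T *)

Section Universal.
Variables (Z : center_obj C) (f : hom (Z : C) one).

Let coev_f i W : hom (Z \ox W) (V i \ot star (V i) \ot W) :=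
  pull f (V i) (star (V i) \ox W) \oc ((Z : C) |> cv (V i) W).

Let tcomp W : hom (Z \ox W) (T \ox W) := \sum_i incn i W \oc coev_f i W.

Let modular_tcomp F : @modular k C (mcons Z F) (mcons T F) (fun W => tcomp (F W)).
Proof.
apply: modular_sum => i.
exact: (modular_comp (modular_comp (modular_cons Z (modular_cvs (V i) F))
  (modular_pull f (V i) (mcons (star (V i)) F))) (modular_incn i F)).
Qed.

Let prn_tcomp j W : prn j W \oc tcomp W = coev_f j W.
Proof.
rewrite /tcomp compm_sumr (bigD1 j) //= big1 ?addr0 => [|i ij].
  by rewrite compmA prn_incn comp1m.
by rewrite compmA prn_incn_neq ?comp0m // eq_sym.
Qed.

(** Although [tcomp] is built from simple objects, its components at all X and F have the same form:
    [natural_kpair] merges each pair and the resolution collapses. *)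
Let dinat_tcomp F X W : dinat F X W \oc tcomp (F W) =
  mstr F X (star X \ox W) \oc pull f (F X) (star X \ox W)
   \oc ((Z : C) |> (mstri F X (star X \ox W) \oc mmap F (cv X W))).
Proof.
rewrite dinatE compm_suml.
transitivity (\sum_i \sum_a mstr F X (star X \ox W) \oc pull f (F X) (star X \ox W)
   \oc ((Z : C) |> (rinj (rs (F X)) i a \oc rprj (rs (F X)) i a) <| (star X \ox W))
   \oc ((Z : C) |> (mstri F X (star X \ox W) \oc mmap F (cv X W)))).
  apply: eq_bigr => i _; rewrite compm_suml; apply: eq_bigr => a _.
  rewrite -compmA prn_tcomp.
  have := natural_kpair (pull_natural f) (rinj (rs (F X)) i a) (rprj (rs (F X)) i a) W.
  by move=> /= <-; rewrite /coev_f compmA.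
under eq_bigr do rewrite -compm_suml -compm_sumr -tensm_sumr -tensm_suml.
rewrite -compm_suml -compm_sumr -tensm_sumr -tensm_suml resolutionP tensm1 tensm1.
by rewrite compm1.
Qed.

Definition to_trace : hom (Z : C) T := mor11 tcomp.

Lemma to_traceE W : to_trace <| W = tcomp W.
Proof. by rewrite -(mor11E (modular_tcomp (mone C))). Qed.

Lemma to_trace_central : to_trace \in @center_hom_pred k C Z trace_obj.
Proof.
apply: center_hom_nested => Y W; rewrite !to_traceE br_trace_obj.
suff e j : (Y |> prn j W) \oc (tbr (mcons Y (mone C)) W \oc tcomp (Y \ox W))
    = (Y |> prn j W) \oc ((Y |> tcomp W) \oc br Z Y W).
  rewrite -[LHS]comp1m -[RHS]comp1m -(tensm1 Y) -(incn_prn W) tensm_sumr !compm_suml.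
  by apply: eq_bigr => j _; rewrite tensm_idl -!compmA e.
have := prn_tbr (mcons Y (mone C)) j W; rewrite /= compmA => ->.
have := dinat_tcomp (mcons Y (mone C)) (V j) W; rewrite /= => ->.
rewrite tensm1 comp1m compm1 [RHS]compmA -tensm_idl prn_tcomp /coev_f.
rewrite tensm_idl compmA pull_tens -compmA br_natr.
by rewrite tensm_idl !compmA.
Qed.

(** The component at X = 1 encircles f by a loop coloured by the unit, which does nothing. *)
Lemma tmor_to_trace : tmor one \oc to_trace = f.
Proof.
rewrite -[RHS](act_one p); apply: to_unit_faithful => W.
rewrite tensm_idr compmA tmorE actE ptrE to_traceE -[LHS]compmA.
have := dinat_tcomp (mone C) one W; rewrite /= => ->.
by rewrite comp1m comp1m compmA.
Qed.

End Universal.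

(* A morphism T -> 1 is a combination of the tmor (V i), as
   Hom(V i \ox V i^*, 1) is one-dimensional. *)
Lemma tmor_span (f : hom T one) : exists s : 'I_m -> k, f = \sum_i s i *: tmor (V i).
Proof.
pose fn i W := lunit W \oc (f <| W) \oc incn i W.
have modf i F : @modular k C (mcons (V i) (mcons (star (V i)) F)) F (fun W => fn i (F W)).
  apply: (modular_comp (modular_incn i F)); split=> [W W' u|A W] /=.
    by rewrite -compmA interchange compmA lunit_nat compmA.
  rewrite tensm_idr -lunit_tens !compmA -(compmA (lunit _)) interchange.
  rewrite compmA lunit_nat -!compmA; congr (_ \oc (_ \oc _)).
  by rewrite assoc_nat tensm1.
have ex i : exists s, forall W, fn i W = s *: er p (V i) W.
  (* Bending the dual strand up gives an endomorphism of V i, a scalar by Schur's lemma. *)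
  pose t W := fn i (V i \ox W) \oc (V i |> cr p (V i) W).
  have mt : @modular k C (mcons (V i) (mone C)) (mcons (V i) (mone C)) t.
    exact: (modular_comp (modular_cons (V i) (modular_cr p (V i) (mone C)))
      (modf i (mcons (V i) (mone C)))).
  have [s es] := schur_eq (mor11 t); exists s => W.
  have [fnat _] := modf i (mone C).
  rewrite -[LHS]compm1 -(tensm1 (V i)) -(er_cr_star p) tensm_idl compmA.
  have := fnat _ _ (er p (V i) W) => /= ->; rewrite -compmA -/(t _) (mor11E mt) es.
  by rewrite tensmZl tensm1 compmZr compm1.
have [s es] := choice ex; exists s; apply: to_unit_faithful => W.
rewrite tensm_suml compm_sumr -[LHS]compm1 -incn_prn compm_sumr.
apply: eq_bigr => i _; rewrite compmA -[X in X \oc _]/(fn i W) es tensmZl compmZr.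
by rewrite tmor_simpleE compmZl.
Qed.

(** Restricted to the i-th summand of T, the combination is s i times a cap, and a zigzag shows that
    the cap of a nonzero object is nonzero. *)
Lemma tmor_free (s : 'I_m -> k) : (forall i, idm (V i) != 0) ->
  \sum_i s i *: tmor (V i) = 0 -> forall i, s i = 0.
Proof.
move=> nz e i; apply/eqP; apply: contraT => si; case/eqP: (nz i).
have e1 W : s i *: er p (V i) W = 0.
  have : lunit W \oc ((\sum_i s i *: tmor (V i)) <| W) \oc incn i W = 0.
    by rewrite e tensm0l compm0 comp0m.
  rewrite tensm_suml compm_sumr compm_suml (bigD1 i) //= big1 ?addr0 => [|j ji].
    by rewrite tensmZl compmZr tmor_simpleE -compmZl -compmA prn_incn compm1.
  by rewrite tensmZl compmZr tmor_simpleE compmZl -compmA prn_incn_neq ?compm0 ?scaler0.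
have e2 W : idm (V i \ox W) = 0.
  apply: (scalerI si); rewrite scaler0 -(er_cr p (V i) W).
  by rewrite -compmZl e1 comp0m.
by rewrite -(runitiK (V i)) -[runit _]compm1 e2 compm0 comp0m.
Qed.

End TraceObject.

(** * Von Neumann regular linear categories *)

Section LinearCategories.
Variables (k : fieldType) (D : lincat k).
Implicit Types X Y Z W S : D.

Lemma zero_idm X : idm X = 0 -> is_zero X.
Proof.
move=> e; split=> Y f; first by rewrite -[f]compm1 e compm0.
by rewrite -[f]comp1m e comp0m.
Qed.

Lemma simple_idm X : is_simple X -> idm X != 0.
Proof. by move=> [nz _]; apply/eqP => e; apply/nz/zero_idm. Qed.

Lemma kernel_mono X Y K (i : hom K X) (f : hom X Y) : is_kernel i f -> is_mono i.
Proof.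
move=> [fi u] W g h e.
have [|v [_ uv]] := u W (i \oc g); first by rewrite compmA fi comp0m.
by rewrite -(uv g) // -(uv h).
Qed.

Lemma split_epi X Y (q : hom X Y) s : q \oc s = idm Y -> is_epi q.
Proof.
by move=> qs W g h /(congr1 (fun u => u \oc s)); rewrite -!compmA qs !compm1.
Qed.

Definition has_kernels : Prop :=
  forall X Y (f : hom X Y), exists K (i : hom K X), is_kernel i f.

Definition von_neumann_regular : Prop :=
  forall X Y (f : hom X Y), exists g, f \oc g \oc f = f.

Section Schur.
Hypothesis ker : has_kernels.

Lemma schur_mono S Y (f : hom S Y) : is_simple S -> f != 0 -> is_mono f.
Proof.
move=> [_ sS] f0; have [K [i ki]] := ker f; have [fi univ] := ki.
case: (sS K i (kernel_mono ki)) => [[z _]|[i' [_ ii']]]; last first.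
  by case/eqP: f0; rewrite -[f]compm1 -ii' compmA fi comp0m.
move=> W g h e; apply/eqP; rewrite -subr_eq0; apply/eqP.
have [|u [<- _]] := univ W (g - h); first by rewrite compmBr e subrr.
by rewrite -[i]compm1 (z _ (idm K)) compm0 comp0m.
Qed.

Lemma schur_iso S S' (f : hom S S') : is_simple S -> is_simple S' -> f != 0 -> is_iso f.
Proof.
move=> sS [_ sS'] f0; case: (sS' S f (schur_mono sS f0)) => // z.
by have [nz _] := sS; case: nz.
Qed.

(** Gaussian elimination: a nonzero matrix entry is invertible by Schur's lemma, and subtracting f
    g0 f clears its column while zero columns stay zero. *)
Lemma semisimple_regular X Y (f : hom X Y) : semisimple_object X ->
  semisimple_object Y -> exists g, f \oc g \oc f = f.
Proof.
move=> [n [S [sS [inj [prj [pi pn ip]]]]]] [n' [S' [sS' [inj' [prj' [_ _ ip']]]]]].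
have [N] := ubnP #|[pred a | f \oc inj a != 0]|.
elim: N f => // N IH f; rewrite ltnS => leN.
have [/existsP[a fa]|/existsPn none] := boolP [exists a, f \oc inj a != 0]; last first.
  exists 0; rewrite compm0 comp0m -[f]compm1 -ip compm_sumr big1 // => a _.
  by rewrite compmA (eqP (negbNE (none a))) comp0m.
have [b fb] : exists b, prj' b \oc (f \oc inj a) != 0.
  apply/existsP; apply: contraR fa => /existsPn none.
  rewrite -[f \oc _]comp1m -ip' compm_suml big1 // => b _.
  by rewrite -compmA (eqP (negbNE (none b))) compm0.
have [t [tf ft]] := schur_iso (sS a) (sS' b) fb.
have [g0 f'a] : exists g0, (f - f \oc g0 \oc f) \oc inj a = 0.
  by exists (inj a \oc t \oc prj' b); rewrite compmBl -!compmA tf compm1 subrr.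
move: f'a; set f' := f - _ => f'a.
have [g' eg'] : exists g', f' \oc g' \oc f' = f'.
  apply: IH; apply: leq_trans leN; apply: proper_card; apply/properP; split.
    apply/subsetP => c; rewrite !inE; apply: contraNN => /eqP fc.
    by rewrite /f' compmBl -compmA fc compm0 subrr.
  by exists a; rewrite !inE ?fa // f'a eqxx.
(* If f - f g0 f has the quasi-inverse g', this is one for f. *)
exists (g0 + (idm X - g0 \oc f) \oc g' \oc (idm Y - f \oc g0)).
have e1 : f \oc (idm X - g0 \oc f) = f' by rewrite compmBr compm1 compmA.
have e2 : (idm Y - f \oc g0) \oc f = f' by rewrite compmBl comp1m.
rewrite compmDr compmDl !compmA e1 -(compmA _ (idm Y - _)) e2 eg' /f' addrC subrK //.
Qed.

End Schur.

Section Regular.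
Hypothesis ker : has_kernels.
Hypothesis reg : von_neumann_regular.
Hypothesis sums : forall n (S : 'I_n -> D), exists X, is_direct_sum S X.

Lemma regular_mono X Y (f : hom X Y) : is_mono f -> exists g, g \oc f = idm X.
Proof.
move=> fm; have [g e] := reg f; exists g; apply: fm.
by rewrite compmA e compm1.
Qed.

Lemma regular_epi X Y (f : hom X Y) : is_epi f -> exists g, f \oc g = idm Y.
Proof.
move=> fe; have [g e] := reg f; exists g; apply: fe.
by rewrite e comp1m.
Qed.

Lemma regular_kernel X Y (f : hom X Y) : exists K (i : hom K X) (r : hom X K) g,
  [/\ is_kernel i f, r \oc i = idm K, f \oc g \oc f = f & i \oc r = idm X - g \oc f].
Proof.
have [g e] := reg f; have [K [i ki]] := ker f; have [fi univ] := ki.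
have [|r [ir _]] := univ X (idm X - g \oc f).
  by rewrite compmBr compm1 compmA e subrr.
exists K, i, r, g; split=> //; apply: (kernel_mono ki).
by rewrite compmA ir compmBl -compmA fi compm0 subr0 comp1m compm1.
Qed.

(** The idempotent f g has the same image as f, so its kernel is a complement of that image and
    serves as the cokernel. *)
Lemma regular_cokernel X Y (f : hom X Y) : exists Q (q : hom Y Q) s,
  [/\ is_cokernel q f, q \oc s = idm Q & exists g, s \oc q = idm Y - f \oc g].
Proof.
have [g e] := reg f; have [K [i ki]] := ker (f \oc g); have [fi univ] := ki.
have [|r [ir _]] := univ Y (idm Y - f \oc g).
  by rewrite compmBr compm1 compmA e subrr.
have ri : r \oc i = idm K.
  apply: (kernel_mono ki).
  by rewrite compmA ir compmBl fi subr0 comp1m compm1.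
have rf : r \oc f = 0.
  by apply: (kernel_mono ki); rewrite compmA ir compmBl comp1m e subrr compm0.
exists K, r, i; split=> //; last by exists g.
split=> // W h hf; exists (h \oc i); split=> [|u <-].
  by rewrite -compmA ir compmBr compm1 compmA hf comp0m subr0.
by rewrite -compmA ri compm1.
Qed.

Lemma regular_abelian : abelian_category D.
Proof.
split=> // X Y f.
- by have [Q [q [s [cq _ _]]]] := regular_cokernel f; exists Q, q.
- move=> fm; have [g gf] := regular_mono fm; exists Y, (idm Y - f \oc g).
  split=> [|W h]; first by rewrite compmBl comp1m -compmA gf compm1 subrr.
  rewrite compmBl comp1m => /eqP; rewrite subr_eq0 => /eqP hE.
  exists (g \oc h); split=> [|u <-]; first by rewrite compmA -hE.
  by rewrite compmA gf comp1m.
move=> fe; have [g fg] := regular_epi fe; exists X, (idm X - g \oc f).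
split=> [|W h]; first by rewrite compmBr compm1 compmA fg comp1m subrr.
rewrite compmBr compm1 => /eqP; rewrite subr_eq0 => /eqP hE.
exists (h \oc g); split=> [|u <-]; first by rewrite -compmA -hE.
by rewrite -compmA fg compm1.
Qed.

Lemma direct_sum_cat n1 n2 (S1 : 'I_n1 -> D) (S2 : 'I_n2 -> D) X X1 X2
  (i1 : hom X1 X) (i2 : hom X2 X) (p1 : hom X X1) (p2 : hom X X2) :
  p1 \oc i1 = idm X1 -> p2 \oc i2 = idm X2 -> p1 \oc i2 = 0 -> p2 \oc i1 = 0 ->
  i1 \oc p1 + i2 \oc p2 = idm X ->
  is_direct_sum S1 X1 -> is_direct_sum S2 X2 ->
  is_direct_sum (fun i => match split i with inl a => S1 a | inr b => S2 b end) X.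
Proof.
move=> e11 e22 e12 e21 e [j1 [q1 [qj1 qn1 jq1]]] [j2 [q2 [qj2 qn2 jq2]]].
pose P (u : 'I_n1 + 'I_n2) := match u with inl a => S1 a | inr b => S2 b end.
pose inj (u : 'I_n1 + 'I_n2) : hom (P u) X :=
  match u with inl a => i1 \oc j1 a | inr b => i2 \oc j2 b end.
pose prj (u : 'I_n1 + 'I_n2) : hom X (P u) :=
  match u with inl a => q1 a \oc p1 | inr b => q2 b \oc p2 end.
exists (fun i => inj (split i)), (fun i => prj (split i)); split.
- move=> i; case: (split i) => a /=; rewrite compmA -(compmA (_ a)).
    by rewrite e11 compm1 qj1.
  by rewrite e22 compm1 qj2.
- move=> i j; rewrite -(inj_eq (can_inj splitK)).
  case: (split i) (split j) => [a|a] [b|b] /=; rewrite compmA -(compmA (_ a)).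
  + by rewrite e11 compm1 => ab; apply: qn1; apply: contraNneq ab => ->.
  + by rewrite e12 compm0 comp0m.
  + by rewrite e21 compm0 comp0m.
  by rewrite e22 compm1 => ab; apply: qn2; apply: contraNneq ab => ->.
rewrite big_split_ord /= -e; congr (_ + _).
  rewrite -[p1]comp1m -jq1 compm_suml compm_sumr; apply: eq_bigr => a _.
  by rewrite (unsplitK (inl a)) /= !compmA.
rewrite -[p2]comp1m -jq2 compm_suml compm_sumr; apply: eq_bigr => a _.
by rewrite (unsplitK (inr a)) /= !compmA.
Qed.

(** A non-simple object splits off a proper summand and its complement; both have smaller [mu],
    which bounds the process. *)
Lemma regular_semisimple (mu : D -> nat) :
  (forall X Y (i : hom X Y) r, r \oc i = idm X -> i \oc r <> idm Y -> (mu X < mu Y)%N) ->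
  semisimple_category D.
Proof.
move=> muP; split; first exact: regular_abelian.
move=> X; have [N] := ubnP (mu X); elim: N X => // N IH X; rewrite ltnS => leN.
have [zX|nzX] := eqVneq (idm X) 0.
  exists 0%N, (fun=> X); split=> [[]//|].
  exists (fun i => 0), (fun i => 0); split; try by case.
  by rewrite big_ord0.
have [sX|nsX] := pselect (is_simple X).
  exists 1%N, (fun=> X); split=> //; exists (fun=> idm X), (fun=> idm X).
  by split=> [i|i j|]; rewrite ?comp1m // ?ord1 ?eqxx ?big_ord1 ?comp1m // (ord1 j).
have [Y [f [fm [nzY nif]]]] : exists Y (f : hom Y X), is_mono f /\ ~ is_zero Y /\ ~ is_iso f.
  apply: contrapT => none; apply: nsX; split=> [[z _]|Y f fm].
    by case/eqP: nzX; exact: z.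
  by apply: contrapT => /not_orP[a b]; apply: none; exists Y, f.
have [g gf] := regular_mono fm.
have fg : f \oc g <> idm X by move=> fg; apply: nif; exists g.
have [K [i [r [g' [ki ri e ir]]]]] := regular_kernel g.
have gi : g \oc i = 0 by have [] := ki.
(* The section f of g need not be killed by r, but the quasi-inverse g' of g is a section that
   is. *)
have [t [gt rt tE]] : exists t : hom Y X, [/\ g \oc t = idm Y, r \oc t = 0 & t \oc g + i \oc r = idm X].
  exists g'; split.
  - by apply: (split_epi gf); rewrite e comp1m.
  - apply: (split_epi gf); apply: (kernel_mono ki); rewrite !compmA ir.
    rewrite compm0 comp0m !compmBl comp1m -!compmA (compmA g) e subrr //.
  by rewrite ir addrC subrK.
have [|n1 [S1 [sS1 dS1]]] := IH Y.
  exact: leq_trans (muP _ _ _ _ gf fg) leN.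
have [|n2 [S2 [sS2 dS2]]] := IH K.
  apply: leq_trans (muP _ _ _ _ ri _) leN => ir1; apply: nzY; apply: zero_idm.
  by rewrite -gt -[g]compm1 -ir1 compmA gi !comp0m.
exists (n1 + n2)%N, (fun i => match split i with inl a => S1 a | inr b => S2 b end).
split; first by move=> j; case: (split j).
exact: (direct_sum_cat gt ri gi rt tE).
Qed.

End Regular.

End LinearCategories.

(** * Kernels and sums in the center *)

Section CenterLimits.
Variables (k : fieldType) (C : rigidcat k).
Implicit Types (X Y W : C) (Z : center_obj C).

(** * Retracts stable under a half-braiding and its inverse *)

Section Subobject.
Variables (Z : center_obj C) (K : C) (i : hom K Z) (r : hom (Z : C) K).
Hypothesis ri : r \oc i = idm K.
Hypothesis br_i : forall X W,
  (X |> (i \oc r) <| W) \oc br Z X W \oc (i <| (X \ox W)) = br Z X W \oc (i <| (X \ox W)).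
Hypothesis bri_i : forall X W,
  ((i \oc r) <| (X \ox W)) \oc bri Z X W \oc (X |> i <| W) = bri Z X W \oc (X |> i <| W).

Let s X W : hom (K \ot X \ot W) (X \ot K \ot W) :=
  (X |> r <| W) \oc br Z X W \oc (i <| (X \ox W)).
Let si X W : hom (X \ot K \ot W) (K \ot X \ot W) :=
  (r <| (X \ox W)) \oc bri Z X W \oc (X |> i <| W).

Let i_s X W : (X |> i <| W) \oc s X W = br Z X W \oc (i <| (X \ox W)).
Proof. by rewrite /s !compmA -tensm_idl -tensm_idr br_i. Qed.

Let i_si X W : (i <| (X \ox W)) \oc si X W = bri Z X W \oc (X |> i <| W).
Proof. by rewrite /si !compmA -tensm_idr bri_i. Qed.

Let sK X W : si X W \oc s X W = idm _.
Proof.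
rewrite {1}/si -compmA i_s compmA -(compmA _ (bri _ _ _)) brK compm1.
by rewrite -tensm_idr ri tensm1.
Qed.

Let siK X W : s X W \oc si X W = idm _.
Proof.
rewrite {1}/s -compmA i_si compmA -(compmA _ (br _ _ _)) briK compm1.
by rewrite -tensm_idl -tensm_idr ri !tensm1.
Qed.

Let s_modular X :
  @modular k C (mcons K (mcons X (mone C))) (mcons X (mcons K (mone C))) (s X).
Proof.
exact: (modular_comp (modular_act (mcons X (mone C)) i) (modular_comp
  (modular_br Z X (mone C)) (modular_cons X (modular_act (mone C) r)))).
Qed.

Let s_natl X Y (f : hom X Y) W : s Y W \oc (K |> f <| W) = (f <| (K \ox W)) \oc s X W.
Proof.
rewrite /s -!compmA interchange (compmA (br _ _ _)) br_natl !compmA.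
by rewrite interchange.
Qed.

Let s_tens X Y W : assoc X Y (K \ox W) \oc s (X \ox Y) W \oc (K |> associ X Y W)
  = (X |> s Y W) \oc s X (Y \ox W).
Proof.
transitivity ((X |> Y |> r <| W) \oc (X |> br Z Y W)
    \oc ((X |> i <| (Y \ox W)) \oc s X (Y \ox W))); last first.
  by rewrite compmA -!tensm_idl.
rewrite i_s /s -!compmA interchange (compmA (br _ _ _)) (compmA (assoc _ _ _)).
rewrite -(tensm1 X Y) assoc_nat -!compmA; congr (_ \oc _).
by rewrite !compmA br_tens.
Qed.

Definition subcenter : center_obj C := make_center sK siK s_modular s_natl s_tens.

Lemma br_subcenter X W : br subcenter X W = s X W.
Proof. exact: br_make_center. Qed.

Lemma subcenter_inj : i \in @center_hom_pred k C subcenter Z.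
Proof. by apply: center_hom_nested => X W; rewrite br_subcenter i_s. Qed.

Lemma subcenter_factor Z' (u : hom (Z' : C) K) :
  i \oc u \in @center_hom_pred k C Z' Z -> u \in @center_hom_pred k C Z' subcenter.
Proof.
move=> iu; apply: center_hom_nested => X W; rewrite br_subcenter.
have := center_homE (CenterHom iu) X W; rewrite /= => e.
have m A (f g : hom A (X \ot K \ot W)) :
    (X |> i <| W) \oc f = (X |> i <| W) \oc g -> f = g.
  move/(congr1 (fun h => (X |> r <| W) \oc h)).
  by rewrite !compmA -tensm_idl -tensm_idr ri !tensm1 !comp1m.
apply: m; rewrite (compmA _ (s X W)) i_s -(compmA (br Z X W)) -tensm_idr e.
by rewrite (compmA _ (X |> u <| W)) -tensm_idl -tensm_idr.
Qed.

End Subobject.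

(** By regularity the kernel in C is a retract; it is stable under the half-braiding because f is
    central. *)
Lemma center_kernels : has_kernels C -> von_neumann_regular C ->
  has_kernels (drinfeld_center C).
Proof.
move=> ker reg Z Z' f.
have [K [i [r [g [ki ri fgf ir]]]]] := regular_kernel ker reg (center_mor f).
have [fi univ] := ki.
have H1 X W : (X |> (i \oc r) <| W) \oc br Z X W \oc (i <| (X \ox W))
    = br Z X W \oc (i <| (X \ox W)).
  rewrite ir -compmA; set u := br _ _ _ \oc _.
  have u0 : (X |> center_mor f <| W) \oc u = 0.
    by rewrite /u compmA -center_homE -compmA -tensm_idr fi tensm0l compm0.
  rewrite -scaleN1r tensmDl tensmDr compmDl tensm1 tensm1 comp1m.
  by rewrite tensmZl tensmZr compmZl tensm_idr tensm_idl -compmA u0 compm0 scaler0 addr0.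
have H2 X W : ((i \oc r) <| (X \ox W)) \oc bri Z X W \oc (X |> i <| W)
    = bri Z X W \oc (X |> i <| W).
  rewrite ir -compmA; set u := bri _ _ _ \oc _.
  have u0 : (center_mor f <| (X \ox W)) \oc u = 0.
    rewrite -[LHS]comp1m -(brK Z' X W) -compmA (compmA (br _ _ _)) center_homE /u.
    rewrite -(compmA (X |> _)) (compmA (br _ _ _)) briK comp1m -tensm_idl -tensm_idr fi.
    by rewrite tensm0l tensm0r compm0.
  rewrite -scaleN1r tensmDl compmDl tensm1 comp1m.
  by rewrite tensmZl compmZl tensm_idr -compmA u0 compm0 scaler0 addr0.
exists (subcenter ri H1 H2), (CenterHom (subcenter_inj ri H1 H2)); split.
  by apply: val_inj.
move=> W h /(congr1 val) /= fh.
have [u [iu uniq]] := univ _ _ fh.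
have iuP : i \oc u \in @center_hom_pred k C W Z by rewrite iu center_morP.
exists (CenterHom (subcenter_factor ri H1 H2 iuP)).
split=> [|v /(congr1 val) /= iv]; first by apply: val_inj.
by apply: val_inj; rewrite /=; exact: uniq.
Qed.

(** * Direct sums in the center *)

Section Sums.
Variables (n : nat) (S : 'I_n -> center_obj C) (T : C).
Variables (inj : forall i, hom (S i : C) T) (prj : forall i, hom T (S i : C)).
Hypothesis prjK : forall i, prj i \oc inj i = idm _.
Hypothesis prj_neq : forall i j, i != j -> prj i \oc inj j = 0.
Hypothesis injK : \sum_i inj i \oc prj i = idm T.

Let s X W : hom (T \ot X \ot W) (X \ot T \ot W) :=
  \sum_i (X |> inj i <| W) \oc br (S i) X W \oc (prj i <| (X \ox W)).
Let si X W : hom (X \ot T \ot W) (T \ot X \ot W) :=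
  \sum_i (inj i <| (X \ox W)) \oc bri (S i) X W \oc (X |> prj i <| W).

Let s_inj X W i : s X W \oc (inj i <| (X \ox W)) = (X |> inj i <| W) \oc br (S i) X W.
Proof.
rewrite /s compm_suml (bigD1 i) //= big1 ?addr0 => [|j ji].
  by rewrite -compmA -tensm_idr prjK tensm1 compm1.
by rewrite -compmA -tensm_idr prj_neq // tensm0l compm0.
Qed.

Let si_inj X W i : si X W \oc (X |> inj i <| W) = (inj i <| (X \ox W)) \oc bri (S i) X W.
Proof.
rewrite /si compm_suml (bigD1 i) //= big1 ?addr0 => [|j ji].
  by rewrite -compmA -tensm_idl -tensm_idr prjK !tensm1 compm1.
by rewrite -compmA -tensm_idl -tensm_idr prj_neq // tensm0l tensm0r compm0.
Qed.

Let sK X W : si X W \oc s X W = idm _.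
Proof.
rewrite -(tensm1 T) -injK tensm_suml {1}/s compm_sumr; apply: eq_bigr => i _.
rewrite !compmA si_inj -(compmA _ (bri _ _ _)) brK compm1.
by rewrite -tensm_idr.
Qed.

Let siK X W : s X W \oc si X W = idm _.
Proof.
rewrite -(tensm1 X) -(tensm1 T) -injK tensm_suml tensm_sumr {1}/si compm_sumr.
apply: eq_bigr => i _.
rewrite !compmA s_inj -(compmA _ (br _ _ _)) briK compm1.
by rewrite -tensm_idl -tensm_idr.
Qed.

Let s_modular X :
  @modular k C (mcons T (mcons X (mone C))) (mcons X (mcons T (mone C))) (s X).
Proof.
apply: modular_sum => i.
exact: (modular_comp (modular_act (mcons X (mone C)) (prj i)) (modular_comp
  (modular_br (S i) X (mone C)) (modular_cons X (modular_act (mone C) (inj i))))).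
Qed.

Let s_natl X Y (f : hom X Y) W : s Y W \oc (T |> f <| W) = (f <| (T \ox W)) \oc s X W.
Proof.
rewrite /s compm_suml compm_sumr; apply: eq_bigr => i _.
rewrite -!compmA interchange (compmA (br _ _ _)) br_natl !compmA.
by rewrite interchange.
Qed.

Let s_tens X Y W : assoc X Y (T \ox W) \oc s (X \ox Y) W \oc (T |> associ X Y W)
  = (X |> s Y W) \oc s X (Y \ox W).
Proof.
transitivity (\sum_i (X |> (s Y W \oc (inj i <| (Y \ox W)))) \oc br (S i) X (Y \ox W)
    \oc (prj i <| (X \ox (Y \ox W)))); last first.
  rewrite {2}/s compm_sumr; apply: eq_bigr => i _.
  by rewrite tensm_idl !compmA.
rewrite {1}/s compm_sumr compm_suml; apply: eq_bigr => i _.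
rewrite s_inj -!compmA interchange (compmA (br _ _ _)) (compmA (assoc _ _ _)).
rewrite -(tensm1 X Y) assoc_nat -!compmA tensm_idl -!compmA; congr (_ \oc _).
by rewrite !compmA br_tens.
Qed.

Definition sum_center : center_obj C := make_center sK siK s_modular s_natl s_tens.

Lemma br_sum_center X W : br sum_center X W = s X W.
Proof. exact: br_make_center. Qed.

Lemma sum_center_inj i : inj i \in @center_hom_pred k C (S i) sum_center.
Proof. by apply: center_hom_nested => X W; rewrite br_sum_center s_inj. Qed.

Lemma sum_center_prj i : prj i \in @center_hom_pred k C sum_center (S i).
Proof.
apply: center_hom_nested => X W; rewrite br_sum_center /s compm_sumr.
rewrite (bigD1 i) //= big1 ?addr0 => [|j ji].
  by rewrite !compmA -tensm_idl -tensm_idr prjK !tensm1 comp1m.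
by rewrite !compmA -tensm_idl -tensm_idr prj_neq 1?eq_sym // tensm0l tensm0r !comp0m.
Qed.

End Sums.

Lemma center_sums :
  (forall n (S : 'I_n -> C), exists X, is_direct_sum S X) ->
  forall n (S : 'I_n -> drinfeld_center C),
    exists T : drinfeld_center C, is_direct_sum S T.
Proof.
move=> sums n S; have [T [inj [prj [pK pn iK]]]] := sums n (fun i => center_ob (S i)).
exists (sum_center pK pn iK).
exists (fun i => CenterHom (sum_center_inj pK pn iK i)).
exists (fun i => CenterHom (sum_center_prj pK pn iK i)); split.
- by move=> i; apply: val_inj; exact: pK.
- by move=> i j ij; apply: val_inj; exact: pn.
apply: val_inj; rewrite raddf_sum; exact: iK.
Qed.

End CenterLimits.

(** * Fusion categories over an algebraically closed field *)

Section FiniteDimension.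
Variables (k : fieldType) (D : lincat k).
Variables (F : D -> vectType k) (Fm : forall X Y : D, hom X Y -> 'Hom(F X, F Y)).
Hypothesis Fm1 : forall X, Fm (idm X) = \1%VF.
Hypothesis FmM : forall X Y Z (f : hom Y Z) (g : hom X Y),
  Fm (f \oc g) = (Fm f \o Fm g)%VF.
Hypothesis Fm_inj : forall X Y, injective (@Fm X Y).

(** With equal dimensions [Fm i] would be surjective, and faithfulness would make r a two-sided
    inverse of i. *)
Lemma retract_dim X Y (i : hom X Y) r : r \oc i = idm X -> i \oc r <> idm Y ->
  (\dim {: F X} < \dim {: F Y})%N.
Proof.
move=> ri ir; have K v : Fm r (Fm i v) = v by rewrite -comp_lfunE -FmM ri Fm1 id_lfunE.
have iker : lker (Fm i) == 0%VS by apply/lker0P; exact: can_inj K.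
rewrite -(@limg_dim_eq _ _ _ (Fm i)) ?(eqP iker) ?capv0 //.
rewrite ltnNge; apply/negP => le.
have limgE : limg (Fm i) == fullv by rewrite eqEdim subvf.
apply: ir; apply: Fm_inj; rewrite FmM Fm1; apply/lfunP => v.
have /memv_imgP[u _ ->] : v \in limg (Fm i) by rewrite (eqP limgE) memvf.
by rewrite id_lfunE comp_lfunE /= K.
Qed.

End FiniteDimension.

Import VectorInternalTheory.

(** Algebraic closedness of k enters here, through a root of a characteristic polynomial. *)
Lemma lfun_eigenvalue (k : closedFieldType) (U : vectType k) (g : 'End(U)) :
  (exists u : U, u != 0) -> exists a (u : U), u != 0 /\ g u = a *: u.
Proof.
move=> [u0 nu0].
have npos : (0 < dim U)%N.
  case: posnP => // e; case/eqP: nu0; apply: (can_inj v2rK); rewrite linear0.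
  by move: (v2r u0); rewrite e => w; apply/rowP => -[].
pose h (w : 'rV[k]_(dim U)) := v2r (g (r2v w)).
have hl : linear h by move=> a x y; rewrite /h !linearP.
pose hL : {linear _ -> _} := HB.pack h (GRing.isLinear.Build _ _ _ _ _ hl).
pose A := lin1_mx hL.
have [a ra] : exists a, root (char_poly A) a.
  by apply/closed_rootP; rewrite size_char_poly eqSS -lt0n.
move: ra; rewrite -eigenvalue_root_char => /eigenvalueP[w wA nw].
exists a, (r2v w); split; first by rewrite -(inj_eq (can_inj v2rK)) linear0 r2vK.
apply: (can_inj v2rK); rewrite linearZ /= r2vK -wA.
by rewrite (mul_rV_lin1 hL).
Qed.

Section FusionFacts.
Variables (k : closedFieldType) (C : pivotal_fusion_category k).
Implicit Types X Y Z W : C.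

Let sums n (S : 'I_n -> C) : exists X, is_direct_sum S X.
Proof. by have [[h _ _ _ _] _] := fusion_semisimple C; exact: h. Qed.

Let ker : has_kernels C.
Proof. by have [[_ h _ _ _] _] := fusion_semisimple C. Qed.

Lemma fusion_regular : von_neumann_regular C.
Proof.
move=> X Y f; have [_ ss] := fusion_semisimple C.
by apply: semisimple_regular => //; exact: ss.
Qed.

(** Forgetting the module structure gives a faithful linear functor to vector spaces. It supplies
    eigenvectors for Schur's lemma and the dimension that bounds decompositions in the center. *)
Lemma fusion_fiber : exists (F : C -> vectType k)
  (Fm : forall X Y : C, hom X Y -> 'Hom(F X, F Y)),
  [/\ forall X, Fm X X (idm X) = \1%VF,
      forall X Y Z (f : hom Y Z) (g : hom X Y),
        Fm X Z (f \oc g) = (Fm Y Z f \o Fm X Y g)%VF,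
      forall X Y a (f g : hom X Y), Fm X Y (a *: f + g) = a *: Fm X Y f + Fm X Y g
    & forall X Y, injective (Fm X Y)].
Proof.
have [A [F [Fm [F1 FM FL Fb _]]]] := ftc_finite C.
exists (fun X => fdmod_space (F X)), (fun X Y f => fdmod_fun (Fm X Y f)); split.
- by move=> X; rewrite F1.
- by move=> X Y Z f g; rewrite FM.
- by move=> X Y a f g; rewrite FL.
by move=> X Y f g /val_inj e; exact: (bij_inj (Fb X Y)) e.
Qed.

(** Subtracting an eigenvalue leaves an endomorphism that kills a nonzero vector, so it is not
    invertible and must vanish. *)
Lemma simple_scalar X (c : hom X X) : is_simple X -> exists s, c = s *: idm X.
Proof.
move=> sX; have [F [Fm [F1 FM FL Fi]]] := fusion_fiber.
have [u nu] : exists u : F X, u != 0.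
  apply: contrapT => none; have /eqP[] := simple_idm sX; apply: (Fi X X).
  apply/lfunP => u; suff z : forall v : F X, v = 0 by rewrite (z (Fm X X 0 u)) [LHS]z.
  by move=> v; apply/eqP; apply: contrapT => /negP nv; apply: none; exists v.
have [a [v [nv gv]]] := lfun_eigenvalue (Fm X X c) (ex_intro _ u nu).
exists a; apply/eqP; rewrite -subr_eq0; apply: contraT => nz.
have [t [tc _]] := schur_iso ker sX sX nz; case/eqP: nv.
have := congr1 (fun h => Fm X X h v) tc; rewrite FM F1 id_lfunE comp_lfunE => <-.
rewrite addrC -scaleNr FL F1 add_lfunE scale_lfunE id_lfunE gv scaleNr addNr.
by rewrite linear0.
Qed.

End FusionFacts.

Section SplitSequences.
Variables (k : fieldType) (D : lincat k).

Lemma split_short_exact (X Y Z : D) (f : hom X Y) (g : hom Y Z) r s :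
  r \oc f = idm X -> g \oc s = idm Z -> g \oc f = 0 -> f \oc r + s \oc g = idm Y ->
  short_exact f g.
Proof.
move=> rf gs gf e; split; split=> // W h he.
  exists (r \oc h); split=> [|u <-]; last by rewrite compmA rf comp1m.
  by rewrite -[RHS]comp1m -e compmDl -[s \oc g \oc h]compmA he compm0 addr0 compmA.
exists (h \oc s); split=> [|u <-]; last by rewrite -compmA gs compm1.
by rewrite -[RHS]compm1 -e compmDr !compmA he comp0m add0r.
Qed.

Lemma short_exact_split (X Y Z : D) (f : hom X Y) (g : hom Y Z) :
  von_neumann_regular D -> short_exact f g ->
  exists r s, [/\ r \oc f = idm X, g \oc s = idm Z & f \oc r + s \oc g = idm Y].
Proof.
move=> reg [kf [gf0 cg]].
have ge : is_epi g.
  move=> W u v e; have [|w [_ uniq]] := cg W (u \oc g).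
    by rewrite -compmA gf0 compm0.
  by rewrite -(uniq u) // -(uniq v).
have [s gs] := regular_epi reg ge; have [_ univ] := kf.
have [|r [fr _]] := univ Y (idm Y - s \oc g).
  by rewrite compmBr compm1 compmA gs comp1m subrr.
exists r, s; split=> //; last by rewrite fr subrK.
apply: (kernel_mono kf).
by rewrite compmA fr compmBl comp1m -compmA gf0 compm0 subr0 compm1.
Qed.

End SplitSequences.

Section Classes.
Variables (k : fieldType) (C : rigidcat k).
Hypothesis sums : forall n (S : 'I_n -> C), exists X, is_direct_sum S X.

Lemma gr_class_sum n (S : 'I_n -> C) X : is_direct_sum S X ->
  gr_class k X = \sum_i gr_class k (S i).
Proof.
elim: n S X => [|n IH] S X [inj [prj [pi pn ip]]].
  rewrite big_ord0; move: ip; rewrite big_ord0 => /esym e.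
  have [z1 z2] := zero_idm e.
  (* An empty sum is a zero object, and this sequence gives [X] = [X] + [X]. *)
  have ex : short_exact (0 : hom X X) (0 : hom X X).
    by apply: (@split_short_exact _ _ _ _ _ _ _ 0 0);
      rewrite ?compm0 ?addr0 ?e.
  have /eqP := gr_class_exact k ex.
  by rewrite -subr_eq0 opprD addrA subrr add0r oppr_eq0 => /eqP.
have [X' [inj' [prj' [pi' pn' ip']]]] := sums (fun j => S (lift ord0 j)).
have dX' : is_direct_sum (fun j => S (lift ord0 j)) X' by exists inj', prj'.
pose g := \sum_j inj' j \oc prj (lift ord0 j).
pose s := \sum_j inj (lift ord0 j) \oc prj' j.
have gj j : g \oc inj (lift ord0 j) = inj' j.
  rewrite compm_suml (bigD1 j) //= big1 ?addr0 => [|l lj].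
    by rewrite -compmA pi compm1.
  by rewrite -compmA pn ?compm0 // (inj_eq lift_inj).
have sj j : s \oc inj' j = inj (lift ord0 j).
  rewrite compm_suml (bigD1 j) //= big1 ?addr0 => [|l lj].
    by rewrite -compmA pi' compm1.
  by rewrite -compmA pn' ?compm0.
have ex : short_exact (inj ord0) g.
  apply: (@split_short_exact _ _ _ _ _ _ _ (prj ord0) s).
  - exact: pi.
  - rewrite -ip' {1}/s compm_sumr; apply: eq_bigr => j _.
    by rewrite compmA gj.
  - rewrite compm_suml big1 // => j _; rewrite -compmA pn ?compm0 //.
  rewrite -ip big_ord_recl; congr (_ + _).
  rewrite /g compm_sumr; apply: eq_bigr => j _.
  by rewrite compmA sj.
by rewrite (gr_class_exact k ex) (IH _ _ dX') big_ord_recl.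
Qed.

End Classes.

Section Representatives.
Variables (k : closedFieldType) (C : pivotal_fusion_category k).
Variables (m : nat) (V : 'I_m.+1 -> C).
Hypothesis hV : simple_representatives V.
Implicit Types X Y Z W : C.

Let sums n (S : 'I_n -> C) : exists X, is_direct_sum S X.
Proof. by have [[h _ _ _ _] _] := fusion_semisimple C; exact: h. Qed.

Let ker : has_kernels C.
Proof. by have [[_ h _ _ _] _] := fusion_semisimple C. Qed.

Lemma rep_schur_neq i j (c : hom (V i) (V j)) : i != j -> c = 0.
Proof.
have [_ sV iV _] := hV; move=> ij; apply/eqP; apply: contraNT ij => nc.
by apply/eqP/iV; exists c; exact: schur_iso.
Qed.

Lemma rep_schur_eq i (c : hom (V i) (V i)) : exists s, c = s *: idm (V i).
Proof. by apply: simple_scalar; have [_ + _ _] := hV; apply. Qed.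

Lemma rep_idm i : idm (V i) != 0.
Proof. by apply: simple_idm; have [_ + _ _] := hV; apply. Qed.

Lemma rep_family X j : isomorphic X (V j) ->
  exists (u : forall i, hom (V i) X) (v : forall i, hom X (V i)),
    \sum_i u i \oc v i = idm X.
Proof.
move=> [f [g [gf fg]]].
(* The isomorphism is the entry at j, cast along j = i; all other entries are zero. *)
pose u i : hom (V i) X :=
  if j =P i is ReflectT e then ecast t (hom (V t) X) e g else 0.
pose v i : hom X (V i) :=
  if j =P i is ReflectT e then ecast t (hom X (V t)) e f else 0.
exists u, v; rewrite (bigD1 j) //= big1 ?addr0 => [|i ij].
  by rewrite /u /v; case: eqP => // e; rewrite (eq_axiomK e).
rewrite /u; case: eqP => [e|_]; last by rewrite comp0m.
by case/eqP: ij; exact: esym.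
Qed.

Lemma rep_resolution M : inhabited (resolution V M).
Proof.
have [_ sV _ aV] := hV.
have [_ ss] := fusion_semisimple C; have [n [S [sS [inj [prj [_ _ ip]]]]]] := ss M.
have fam a : {u : (forall i, hom (V i) (S a)) & {v : forall i, hom (S a) (V i) |
    \sum_i u i \oc v i = idm (S a)}}.
  have ex : exists u : (forall i, hom (V i) (S a)) , exists v : forall i, hom (S a) (V i),
    \sum_i u i \oc v i = idm (S a).
    by have [j /rep_family] := aV _ (sS a).
  by have [u /cid] := cid ex; exists u.
(* Every V i receives the same n indices, one for each simple summand of M. *)
split; apply: (@Resolution _ _ _ _ _ n (fun i a => inj a \oc projT1 (fam a) i)
   (fun i a => sval (projT2 (fam a)) i \oc prj a)).
rewrite exchange_big -ip; apply: eq_bigr => a _ /=.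
case: (fam a) => u [v e] /=; rewrite -[X in _ = X \oc _]compm1 -e.
rewrite compm_sumr compm_suml; apply: eq_bigr => i _.
by rewrite !compmA.
Qed.

Lemma gr_span (x : gr k C) : exists s : 'I_m.+1 -> k, x = \sum_i s i *: gr_class k (V i).
Proof.
have [_ sV _ aV] := hV; have [_ ss] := fusion_semisimple C.
pose P (y : gr k C) := exists s : 'I_m.+1 -> k, y = \sum_i s i *: gr_class k (V i).
have P0 : P 0 by exists (fun=> 0); rewrite big1 // => i _; rewrite scale0r.
have PD y z : P y -> P z -> P (y + z).
  move=> [s ->] [t ->]; exists (fun i => s i + t i).
  by rewrite -big_split; apply: eq_bigr => i _; rewrite scalerDl.
have PZ a y : P y -> P (a *: y).
  move=> [s ->]; exists (fun i => a * s i).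
  by rewrite scaler_sumr; apply: eq_bigr => i _; rewrite scalerA.
have PV i : P (gr_class k (V i)).
  exists (fun j => (j == i)%:R); rewrite (bigD1 i) //= big1 ?addr0 => [|j /negPf ->].
    by rewrite eqxx scale1r.
  by rewrite scale0r.
apply: (gr_ind (P := P)) x => // a X x Px; apply: (PD) => //; apply: (PZ).
have [n [S [sS dX]]] := ss X; rewrite (gr_class_sum sums dX).
apply: (big_ind P P0 PD) => b _; have [i iso] := aV _ (sS b).
by rewrite (gr_class_iso k iso).
Qed.

End Representatives.

(** * Rings, dimensions and the action of the Grothendieck algebra *)

Section SemisimpleRings.

(* A left ideal generated by L with L A L = 0 has square zero. *)
Lemma semisimple_square_zero (A : pzRingType) (L : A) : semisimple_ring A ->
  (forall x, L * x * L = 0) -> L = 0.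
Proof.
move=> [n [I [sI dec]]] LL.
have LI i y : I i y -> L * y = 0.
  have [[I0 ID IM] _ minI] := sI i; move=> Iy.
  (* If J = I_i, then y = b L y for some b, and L y = (L b L) y = 0. *)
  pose J z := exists a, z = a * L * y.
  have lJ : left_ideal J.
    split; first by exists 0; rewrite !mul0r.
    - by move=> u v [a ->] [b ->]; exists (a + b); rewrite !mulrDl.
    by move=> a u [b ->]; exists (a * b); rewrite !mulrA.
  case: (minI J lJ) => [z [a ->]|J0|IJ]; first by rewrite -mulrA; apply/IM/IM.
    by apply: J0; exists 1; rewrite mul1r.
  by have [a ->] := IJ y Iy; rewrite !mulrA LL mul0r.
have [e [[Ie e1] _]] := dec 1.
by rewrite -[L]mulr1 e1 mulr_sumr big1 // => i _; exact: LI.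
Qed.

(** The left ideals are those of the idempotents e a that project to the simple summands. A nonzero
    element of one has an invertible component from S a to some S b, hence generates e a. *)
Lemma semisimple_endomorphisms (A : pzRingType) (k : fieldType) (D : lincat k) (X : D)
    (phi : A -> hom X X) :
  has_kernels D -> semisimple_object X -> bijective phi ->
  (forall x y, phi (x + y) = phi x + phi y) ->
  (forall x y, phi (x * y) = phi x \oc phi y) -> phi 1 = idm X ->
  semisimple_ring A.
Proof.
move=> ker [n [S [sS [inj [prj [pi pn ip]]]]]] [psi phiK psiK] phiD phiM phi1.
have phi0 : phi 0 = 0.
  by apply: (addrI (phi 0)); rewrite addr0 -phiD addr0.
have phi_inj : injective phi := can_inj phiK.
have phi_sum (x : 'I_n -> A) : phi (\sum_a x a) = \sum_a phi (x a).
  by elim/big_rec2: _ => [//|a u v _ <-]; rewrite phiD.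
pose e a := inj a \oc prj a.
have ee a : e a \oc e a = e a by rewrite /e compmA -(compmA _ (prj a)) pi compm1.
have ee0 a b : a != b -> e a \oc e b = 0.
  by move=> ab; rewrite /e compmA -(compmA _ (prj a)) pn // compm0 comp0m.
exists n, (fun a x => phi x \oc e a = phi x); split=> [a|x].
  split.
  - split=> [|x y hx hy|x y hy]; first by rewrite phi0 comp0m.
      by rewrite phiD compmDl hx hy.
    by rewrite phiM -compmA hy.
  - exists (psi (e a)); first by rewrite psiK ee.
    apply/eqP => /(congr1 phi); rewrite psiK phi0 => ea.
    have /eqP[] := simple_idm (sS a).
    rewrite -[idm _]compm1 -(pi a) !compmA -(compmA (prj a)) -/(e a).
    by rewrite ea compm0 comp0m.
  move=> J [J0 JD JM] JI; have [[x [Jx x0]]|none] := pselect (exists x, J x /\ x <> 0);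
    last by left=> x Jx; apply: contrapT => x0; apply: none; exists x.
  right=> z hz.
  have xe := JI x Jx.
  have [b nb] : exists b, prj b \oc (phi x \oc inj a) != 0.
    apply/existsP; apply: contrapT => /negP; rewrite negb_exists => /forallP h.
    apply: x0; apply: phi_inj; rewrite phi0 -xe /e compmA.
    suff -> : phi x \oc inj a = 0 by rewrite comp0m.
    rewrite -[LHS]comp1m -ip compm_suml big1 // => b _.
    by rewrite -compmA (eqP (negbNE (h b))) compm0.
  have [t [tx _]] := schur_iso ker (sS a) (sS b) nb.
  have ye : psi (inj a \oc t \oc prj b) * x = psi (e a).
    apply: phi_inj; rewrite phiM !psiK -xe {1}/e !compmA.
    rewrite -!(compmA (inj a)); congr (_ \oc _).
    by move: tx; rewrite !compmA => ->; rewrite comp1m.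
  have -> : z = z * (psi (inj a \oc t \oc prj b) * x).
    by apply: phi_inj; rewrite ye phiM psiK hz.
  by rewrite mulrA; apply: JM.
exists [ffun a => psi (phi x \oc e a)]; split.
  split=> [a|]; first by rewrite ffunE psiK -compmA ee.
  apply: phi_inj; rewrite phi_sum -[LHS]compm1 -ip compm_sumr.
  by apply: eq_bigr => a _; rewrite ffunE psiK.
move=> y [yI ->]; apply/ffunP => b; rewrite ffunE; apply: phi_inj.
rewrite psiK phi_sum compm_suml (bigD1 b) //= big1 ?addr0 => [|a ab]; first exact: yI.
by rewrite -(yI a) -compmA ee0 // compm0.
Qed.

End SemisimpleRings.

Section UnitDimension.
Variables (k : fieldType) (C : rigidcat k).
Local Notation one := (unit_obj C).

Lemma star_one : isomorphic (star one) one.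
Proof.
pose a W : hom W (star one \ox W) := lunit _ \oc cv one W.
pose b W : hom (star one \ox W) W := ev one W \oc (star one |> luniti W).
have ba W : b W \oc a W = idm W.
  rewrite /a /b !compmA -(compmA _ _ (lunit _)) -lunit_nat !compmA -lunit_nat.
  rewrite -!compmA -cv_nat (compmA (one |> _)) ev_cv comp1m lunitiK //.
have ab W : a W \oc b W = idm _.
  have nat : ev one (star one \ox W) \oc (star one |> one |> a W) = a W \oc ev one W.
    exact: ev_nat.
  rewrite /b compmA -nat -compmA -tensm_idl -luniti_nat /a compmA lunitK comp1m.
  exact: ev_cv_star.
move: (a one) (b one) (ab one) (ba one) => a1 b1 ab1 ba1.
exists (b1 \oc runiti (star one)), (runit (star one) \oc a1); split.
  by rewrite compmA -(compmA _ a1) ab1 compm1 runitiK.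
by rewrite compmA -(compmA b1) runitK compm1 ba1.
Qed.

End UnitDimension.

Section PivotalDimension.
Variables (k : closedFieldType) (C : pivotal_fusion_category k).
Local Notation one := (unit_obj C).
Local Notation p := (pfc_pivotal C).
Implicit Types X Y W : C.

Lemma er_cv_pdim X W : er p X W \oc cv X W = pdim X *: idm W.
Proof.
rewrite er_cv -[X in X <| W]End1_scalarK -/(pdim X).
by rewrite tensmZl tensm1 compmZr compm1 compmZl lunitiK.
Qed.

(** By [er_star] this is the loop [er] after [cv] of [star X]; it is the source of the weights d. *)
Lemma ev_cr_pdim X W : ev X W \oc cr p X W = pdim (star X) *: idm W.
Proof.
rewrite -(er_star p) crE !compmA.
rewrite (comp_rw1 _ (esym (tensm_idl _ _ _))) -tensm_idr piviK !tensm1 compm1.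
exact: er_cv_pdim.
Qed.

Lemma pdim_one : pdim one = 1.
Proof.
have := er_cv_one p one; rewrite er_cv_pdim => /(congr1 (@End1_scalar _ C)).
by rewrite scalarK -{1}(scale1r (idm one)) scalarK.
Qed.

Lemma pdim_iso X Y : isomorphic X Y -> pdim X = pdim Y.
Proof.
move=> XY; have nat : @natural_family k C (mone C) (mone C) (fun X W => idm (X \ox W)).
  by split=> *; rewrite comp1m compm1.
have := ptr_iso p nat one XY; rewrite !ptrE /= !compm1 !er_cv_pdim.
by move/(congr1 (@End1_scalar _ C)); rewrite !scalarK.
Qed.

Lemma pdim_star_one : pdim (star one) = 1.
Proof. by rewrite (pdim_iso (star_one C)) pdim_one. Qed.

End PivotalDimension.

Section GrothendieckAction.
Variables (k : closedFieldType) (C : pivotal_fusion_category k).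
Local Notation one := (unit_obj C).
Local Notation p := (pfc_pivotal C).
Implicit Types (X Y W : C) (Z : center_obj C).

Lemma act_additive Z (f : hom (Z : C) one) : gr_additive (act p f).
Proof.
split=> [X Y|X Y T u v uv]; first exact: act_iso.
have [r [s [ru vs e]]] := short_exact_split (@fusion_regular _ C) uv.
pose S (i : 'I_2) : C := if val i is 0 then X else T.
pose inj (i : 'I_2) : hom (S i) Y :=
  match val i as n return hom (if n is 0 then X else T) Y with 0 => u | _ => s end.
pose prj (i : 'I_2) : hom Y (S i) :=
  match val i as n return hom Y (if n is 0 then X else T) with 0 => r | _ => v end.
rewrite (@act_split _ _ p _ f 2 S Y inj prj) ?big_ord_recl ?big_ord0 ?addr0 //.
by case=> -[].
Qed.

Definition gact Z (f : hom (Z : C) one) (x : gr k C) : hom (Z : C) one :=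
  gr_lift (act p f) x.

Lemma gact_class Z (f : hom (Z : C) one) X : gact f (gr_class k X) = act p f X.
Proof. exact/gr_lift_class/act_additive. Qed.

Lemma gactD Z (f : hom (Z : C) one) x y : gact f (x + y) = gact f x + gact f y.
Proof. exact/gr_liftD/act_additive. Qed.

Lemma gactZ Z (f : hom (Z : C) one) a x : gact f (a *: x) = a *: gact f x.
Proof. exact/gr_liftZ/act_additive. Qed.

Lemma gact0 Z (f : hom (Z : C) one) : gact f 0 = 0.
Proof. by rewrite -(scale0r 0) gactZ scale0r. Qed.

Lemma gact_sum Z (f : hom (Z : C) one) I (r : seq I) P (x : I -> gr k C) :
  gact f (\sum_(i <- r | P i) x i) = \sum_(i <- r | P i) gact f (x i).
Proof. by elim/big_rec2: _ => [|i u v _ <-]; [exact: gact0 | exact: gactD]. Qed.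

Lemma gact_one Z (f : hom (Z : C) one) : gact f 1 = f.
Proof. by rewrite [LHS]gact_class act_one. Qed.

Lemma gactM Z (f : hom (Z : C) one) x y : gact f (x * y) = gact (gact f y) x.
Proof.
elim/gr_ind: x => [|a X x IH]; first by rewrite mul0r !gact0.
rewrite mulrDl !gactD IH -gr_scalerAl !gactZ; congr (_ *: _ + _).
rewrite gact_class; elim/gr_ind: y {x IH} => [|b Y y IH].
  rewrite mulr0 !gact0; have := act_lin p (-1) (0 : hom (Z : C) one) 0 X.
  by rewrite scaler0 addr0 scaleN1r addNr => ->.
rewrite mulrDr !gactD IH -gr_scalerAr !gactZ gr_classM !gact_class act_tens.
by rewrite act_lin.
Qed.

Lemma gact_comp Z Z' (f : hom (Z' : C) one) (g : center_hom Z Z') x :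
  gact (f \oc (g : hom (Z : C) (Z' : C))) x = gact f x \oc (g : hom (Z : C) (Z' : C)).
Proof.
elim/gr_ind: x => [|a X x IH]; first by rewrite !gact0 comp0m.
by rewrite !gactD !gactZ IH !gact_class act_comp compmDl compmZl.
Qed.

End GrothendieckAction.

(** * The equivalences *)

Section Main.
Variables (k : closedFieldType) (C : pivotal_fusion_category k).
Local Notation one := (unit_obj C).
Local Notation p := (pfc_pivotal C).
Variables (m : nat) (V : 'I_m.+1 -> C).
Hypothesis hV : simple_representatives V.

Let sums n (S : 'I_n -> C) : exists X, is_direct_sum S X.
Proof. by have [[h _ _ _ _] _] := fusion_semisimple C; exact: h. Qed.

Let ker : has_kernels C.
Proof. by have [[_ h _ _ _] _] := fusion_semisimple C. Qed.

Let zker : has_kernels (drinfeld_center C).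
Proof. exact: center_kernels ker (@fusion_regular _ C). Qed.

Let sneq := rep_schur_neq hV.
Let seqv := rep_schur_eq hV.

Let rs : forall M : C, resolution V M.
Proof.
move=> M; have ex : exists r : resolution V M, True.
  by have [r] := rep_resolution hV M; exists r.
exact: projT1 (cid ex).
Qed.

(* The object of the center representing Hom(U -, 1), with its universal
   morphism; its Hom into 1 is free of rank one over the Grothendieck algebra. *)
Lemma universal_trace : exists (Zt : center_obj C) (t : hom (Zt : C) one),
  [/\ forall x, gact t x = 0 -> x = 0,
      forall f : hom (Zt : C) one, exists x, f = gact t x,
      forall s : 'I_m.+1 -> k, \sum_i s i *: gr_class k (V i) = 0 -> forall i, s i = 0
    & forall (Z : center_obj C) (f : hom (Z : C) one), exists g : center_hom Z Zt,
        t \oc (g : hom (Z : C) (Zt : C)) = f].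
Proof.
have [T [inc [pr [prK pr_neq incK]]]] := sums (fun i => V i \ox star (V i)).
pose Zt := trace_obj p sneq seqv rs prK pr_neq incK.
pose t : hom (Zt : C) one := tmor p rs pr one.
have tact X : act p t X = tmor p rs pr X.
  rewrite [LHS]act_tmor; apply: (tmor_iso p sneq seqv rs pr).
  by exists (runit X), (runiti X); rewrite runitK runitiK.
have tsum (s : 'I_m.+1 -> k) :
    gact t (\sum_i s i *: gr_class k (V i)) = \sum_i s i *: tmor p rs pr (V i).
  by rewrite gact_sum; apply: eq_bigr => i _; rewrite gactZ gact_class tact.
exists Zt, t; split=> [x|f|s s0|Z f].
- have [s ->] := gr_span hV x; rewrite tsum => /(tmor_free sneq seqv prK pr_neq (rep_idm hV)) s0.
  by rewrite big1 // => i _; rewrite s0 scale0r.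
- have [s fE] := tmor_span p sneq seqv rs incK f.
  by exists (\sum_i s i *: gr_class k (V i)); rewrite tsum.
- move: s0 => /(congr1 (gact t)); rewrite tsum gact0.
  exact: (tmor_free sneq seqv prK pr_neq (rep_idm hV)).
exists (CenterHom (to_trace_central p sneq seqv rs prK pr_neq incK f)).
exact: tmor_to_trace.
Qed.

Lemma semisimple_gr_global_dim : semisimple_ring (gr k C) -> global_dim V <> 0.
Proof.
move=> ss dim0; have [Zt [t [tinj _ free _]]] := universal_trace.
pose L : gr k C := \sum_i pdim (star (V i)) *: gr_class k (V i).
have tL : gact t L = \sum_i pdim (star (V i)) *: act p t (V i).
  by rewrite gact_sum; apply: eq_bigr => i _; rewrite gactZ gact_class.
(* Checked after acting on t, where faithfulness loses nothing and [act_kirby] applies. *)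
have YL Y : gr_class k Y * L = pdim Y *: L.
  apply/eqP; rewrite -subr_eq0; apply/eqP/tinj; rewrite -scaleN1r gactD !gactZ tL.
  rewrite mulr_sumr gact_sum -(act_kirby sneq seqv rs (fun i W => ev_cr_pdim (V i) W) t
    (er_cv_pdim Y)) scaleN1r.
  apply/eqP; rewrite subr_eq0; apply/eqP/eq_bigr => i _.
  by rewrite -gr_scalerAr gactZ gr_classM gact_class.
have xL x : exists c, x * L = c *: L.
  elim/gr_ind: x => [|a X x [c IH]]; first by exists 0; rewrite mul0r scale0r.
  exists (a * pdim X + c).
  by rewrite mulrDl -gr_scalerAl YL IH scalerA scalerDl.
have LL : L * L = 0.
  transitivity (global_dim V *: L); last by rewrite dim0 scale0r.
  rewrite {1}/L mulr_suml /global_dim scaler_suml; apply: eq_bigr => i _.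
  by rewrite -gr_scalerAl YL scalerA.
have L0 : L = 0.
  apply: (semisimple_square_zero ss) => x; rewrite -mulrA; have [c ->] := xL x.
  by rewrite -gr_scalerAr LL scaler0.
(* The coefficient of the unit class in L is the dimension of the dual of 1, which is 1, so L is
   nonzero. *)
have [V0 _ _ _] := hV.
have /eqP := free _ L0 ord0; rewrite V0 pdim_star_one.
by rewrite oner_eq0.
Qed.

Lemma global_dim_semisimple_center :
  global_dim V <> 0 -> semisimple_category (drinfeld_center C).
Proof.
move=> dim0; have [F [Fm [F1 FM FL Fi]]] := fusion_fiber C.
apply: (regular_semisimple zker _ (center_sums sums)
   (mu := fun Z : drinfeld_center C => \dim {: F (center_ob Z)})) => [Z Z' f|Z Z' i r ri ir].
  have [g fgf] := fusion_regular (center_mor f).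
  pose d i := pdim (star (V i)).
  have gP := avg_central sneq seqv rs (fun i W => ev_cr_pdim (V i) W) g.
  exists ((global_dim V)^-1 *: (CenterHom gP : hom (Z' : drinfeld_center C) Z)).
  apply: val_inj; rewrite compmZr compmZl /=.
  have := avg_regular d (fun i W => er_cv_pdim (V i) W) fgf => /= ->.
  by rewrite scalerA mulVf ?scale1r //; apply/eqP.
apply: (retract_dim F1 FM Fi (i := center_mor i) (r := center_mor r)).
  exact: (congr1 val ri).
by move=> e; apply: ir; apply: val_inj.
Qed.

Section Adjoint.
Variables (R : functor C (drinfeld_center C)) (UR : adjunction (forgetful C) R).

(** The counit at 1, which is the universal element of Hom(U -, 1). *)
Let eps : hom (center_ob (R one)) one :=
  projT1 (cid (let: Bijective g _ gK := adj_bij UR (R one) one in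
     ex_intro (fun e => adj UR e = idm (R one)) (g (idm _)) (gK _))).

Let epsE : adj UR eps = idm (R one).
Proof. by rewrite /eps; case: cid. Qed.

Let adj_eps (Z : drinfeld_center C) (f : hom (center_ob Z) one) :
  eps \oc center_mor (adj UR f) = f.
Proof.
apply: (bij_inj (adj_bij UR Z one)).
by rewrite (adj_natl UR (adj UR f)) epsE comp1m.
Qed.

Lemma semisimple_unit_gr : semisimple_object (R one) -> semisimple_ring (gr k C).
Proof.
move=> ss; have [Zt [t [tinj tspan _ tuniv]]] := universal_trace.
pose phi (x : gr k C) : hom (R one) (R one) := adj UR (gact eps x).
have phiE x : eps \oc center_mor (phi x) = gact eps x by exact: adj_eps.
have phi_inv u : adj UR (eps \oc center_mor u) = u.
  by rewrite (adj_natl UR u) epsE comp1m.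
have phiP x (u : hom (R one) (R one)) : eps \oc center_mor u = gact eps x -> u = phi x.
  by move=> e; rewrite /phi -e phi_inv.
(* The universal properties of T and of R(1) give g and u in opposite directions; [u \oc g] will be
   the identity of R(1). *)
have [g tg] := tuniv _ eps; pose u := adj UR t.
have epsu : eps \oc center_mor u = t by exact: adj_eps.
have inj : injective phi.
  (* Elements that act equally on eps act equally on t, the composite of eps with u, and t is a free
     generator. *)
  move=> x y /(congr1 (fun f => eps \oc center_mor f)); rewrite !phiE => e.
  apply/eqP; rewrite -subr_eq0; apply/eqP/tinj.
  rewrite -epsu gact_comp -scaleN1r gactD gactZ e scaleN1r subrr.
  exact: comp0m.
have surj v : exists x, phi x = v.
  (* The coefficient x is read off on T, and precomposing with g transfers the equation back to
     R(1). *)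
  have [x xE] := tspan (eps \oc center_mor v \oc center_mor u).
  exists x; symmetry; apply: phiP; rewrite -[in RHS]tg gact_comp -xE -compmA.
  have ug : (u : hom (Zt : drinfeld_center C) (R one)) \oc (g : hom (R one : drinfeld_center C) Zt) = idm (R one).
    rewrite -(phi_inv _ (u \oc g)) -epsE; congr (adj UR _).
    by rewrite /= compmA epsu.
  have := congr1 val ug; rewrite /= => ug'.
  by rewrite ug' compm1.
have [psi psiP] := choice surj.
apply: (semisimple_endomorphisms zker ss (phi := phi)).
- by exists psi => [x|v]; [apply: inj; rewrite psiP | exact: psiP].
- move=> x y; symmetry; apply: phiP; rewrite gactD -!phiE /=.
  exact: compmDr.
(* Both the action and composition reverse the order in which x and y reach eps, so phi preserves
   products and no opposite ring appears. *)
- move=> x y; symmetry; apply: phiP; rewrite gactM /= compmA phiE -gact_comp phiE.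
  by [].
symmetry; apply: phiP; rewrite gact_one; exact: compm1.
Qed.

End Adjoint.
End Main.

Theorem theorem6p5 (k : closedFieldType) (C : pivotal_fusion_category k)
    (m : nat) (V : 'I_m.+1 -> C) (hV : simple_representatives V)
    (R : functor C (drinfeld_center C)) (UR : adjunction (forgetful C) R) :
  [<-> semisimple_ring (gr k C);
       global_dim V <> 0%R;
       semisimple_category (drinfeld_center C);
       semisimple_object (R (unit_obj C))].
Proof.
tfae.
- exact: semisimple_gr_global_dim.
- exact: global_dim_semisimple_center.
- by move=> [_ ss]; exact: ss.
exact: (semisimple_unit_gr hV UR).
Qed.
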